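(* Let $C\ge1$ and let $(p_c)_{1\le c\le C}$ be nonnegative numbers summing to $1$, with $P_k=\sum_{c\le k}p_c$, $p_c:=0$ for $c>C$, and $\mathbb E_{\mathbf p}[c]=\sum_c cp_c$. Given $N\ge1$ and $T=\frac{\mu_{\mathcal U}}{\mu_{\mathcal V}}N$ (assumed integer), let $\mathrm M_T$ be the matching built by GREEDY on $\mathbf{CM}(\mathbf d^{\mathcal U},\mathbf d^{\mathcal V},\mathbf p)$. Let $$\Gamma^{\mathbf p}_{\mathcal U}(g)=\phi_{\mathcal U}'(1-g)+\sum_{k=1}^{C-1}\frac{(1-P_k)g^k}{k!}\phi_{\mathcal U}^{(k+1)}(1-g),$$ and let $G$ be the unique solution of $$G'(s)=\frac{1-\phi_{\mathcal V}\bigl(1-\frac1{\mu_{\mathcal U}}\Gamma^{\mathbf p}_{\mathcal U}(G(s))\bigr)}{\frac{\mu_{\mathcal V}}{\mu_{\mathcal U}}\Gamma^{\mathbf p}_{\mathcal U}(G(s))},\qquad G(0)=0.$$ Then, in probability as $N\to\infty$, $$\frac{|\mathrm M_T|}{N\,\mathbb E_{\mathbf p}[c]}\to1-\sum_{k=0}^{C-1}\frac{\sum_{c=1}^Ccp_{c+k}}{\mathbb E_{\mathbf p}[c]}\frac1{k!}G(1)^k\phi_{\mathcal U}^{(k)}(1-G(1)).$$ Moreover, for every $s\in[0,1]$, if $\mathrm M_T(s)$ is the matching obtained by GREEDY after seeing a proportion $s$ of the vertices of $\mathcal V$, then $\frac{|\mathrm M_T(s)|}{N\mathbb E_{\mathbf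 p}[c]}\to1-\sum_{k=0}^{C-1}\frac{\sum_{c=1}^Ccp_{c+k}}{\mathbb E_{\mathbf p}[c]}\frac1{k!}G(s)^k\phi_{\mathcal U}^{(k)}(1-G(s))$ in probability.
   Context: $\pi_{\mathcal U},\pi_{\mathcal V}$ are sub-Gaussian probability distributions on $\mathbb N$ with means $\mu_{\mathcal U},\mu_{\mathcal V}>0$ and generating functions $\phi_{\mathcal U}(s)=\sum_k\pi_{\mathcal U}(k)s^k$, $\phi_{\mathcal V}(s)=\sum_k\pi_{\mathcal V}(k)s^k$; $\phi^{(k)}$ is the $k$-th derivative. $\mathbf{CM}(\mathbf d^{\mathcal U},\mathbf d^{\mathcal V},\mathbf p)$: with $\mathcal U=\{1,\dots,N\}$, $\mathcal V=\{1,\dots,T\}$, draw $d^{\mathcal U}_1,\dots,d^{\mathcal U}_N$ i.i.d. $\sim\pi_{\mathcal U}$ and independently $d^{\mathcal V}_1,\dots,d^{\mathcal V}_T$ i.i.d. $\sim\pi_{\mathcal V}$; add $d^{\mathcal V}_{T+1}=\max\{\sum_id^{\mathcal U}_i-\sum_jd^{\mathcal V}_j,0\}$ and $d^{\mathcal U}_{N+1}=\max\{\sum_jd^{\mathcal V}_j-\sum_id^{\mathcal U}_i,0\}$; attach that many half-edges to each vertex, pair half-edges of $\mathcal U\cup\{N+1\}$ with those of $\mathcal V\cup\{T+1\}$ uniformly at random (each pair an edge, multi-edges allowed), delete $N+1,T+1$. Each $u\in\mathcal U$ has a capacity $\omega_u\in\{1,\dots,C\}$, independent of its degree, and $p_c$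 is the fraction of vertices of $\mathcal U$ with capacity exactly $c$. A matching is a set of edges in which each $v\in\mathcal V$ lies in at most one edge and each $u$ in at most $\omega_u$ edges. Vertices of $\mathcal V$ arrive online revealing their edges. GREEDY: when $v_t$ arrives, if some edge joins $v_t$ to a vertex of $\mathcal U$ with remaining capacity, add one such edge chosen uniformly at random. ''After seeing a proportion $s$'' means after the first $\lfloor sT\rfloor$ arrivals. *)

(* Defs.v *)
From HB Require Import structures.
From mathcomp Require Import all_boot all_order all_algebra.
From mathcomp Require Import all_classical all_reals all_analysis.

Set Implicit Arguments.
Unset Strict Implicit.
Unset Printing Implicit Defensive.

Import Order.TTheory GRing.Theory Num.Theory.
Import numFieldNormedType.Exports.

Local Open Scope classical_set_scope.
Local Open Scope ring_scope.

Section DegreeDistribution.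
Variables (R : realType) (pi : probability nat R).

Definition prob_at (k : nat) : R := fine (pi [set k]).

Definition mean : R := fine ('E_pi[fun k : nat => k%:R : R])%E.

(* The expectation is extended-real valued, so the bound includes the
   finiteness of all exponential moments. *)
Definition sub_gaussian : Prop :=
  exists sigma : R, forall l : R,
    ('E_pi[fun k : nat => expR (l * (k%:R - mean)) : R]
       <= (expR (sigma ^+ 2 * l ^+ 2 / 2))%:E)%E.

(* For sub-Gaussian [pi] the series converges on the whole line, so that the
   two-sided derivatives at 1 are meaningful. *)
Definition gen_fun (s : R) : R :=
  limn (series (fun k : nat => prob_at k * s ^+ k)).

End DegreeDistribution.

Section ConfigurationModel.

Definition total_deg n (d : 'I_n -> nat) : nat := (\sum_i d i)%N.

(* Degrees on one side of the graph: [Some i] is a genuine vertex, and [None] is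
   the auxiliary vertex of degree max(m - total_deg d, 0) (truncated subtraction),
   where m is the total degree of the other side. *)
Definition ext_deg n (d : 'I_n -> nat) (m : nat) (x : option 'I_n) : nat :=
  if x is Some i then d i else (m - total_deg d)%N.

Definition half_edge n (d : 'I_n -> nat) (m : nat) : finType :=
  {x : option 'I_n & 'I_(ext_deg d m x)}.

Variables (N T : nat) (dU : 'I_N -> nat) (dV : 'I_T -> nat).

Definition Uhalf : finType := half_edge dU (total_deg dV).
Definition Vhalf : finType := half_edge dV (total_deg dU).

(* Both sides carry max(total_deg dU, total_deg dV) half-edges, hence an
   injection is a perfect pairing. *)
Definition pairings : {set {ffun Vhalf -> Uhalf}} :=
  [set f : {ffun Vhalf -> Uhalf} | injectiveb f]%SET.

Variable f : {ffun Vhalf -> Uhalf}.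

(* An edge of the multigraph is named by its half-edge e on the V side; its ends
   are [tag e] and [tag (f e)].  Deleting the auxiliary vertices amounts to
   keeping the edges both of whose ends are of the form [Some _]. *)

Variable omega : 'I_N -> nat.

Definition load (M : {set Vhalf}) (u : 'I_N) : nat :=
  #|[set e in M | tag (f e) == Some u]%SET|.

Definition available (M : {set Vhalf}) (v : 'I_T) : {set Vhalf} :=
  [set e : Vhalf | (tag e == Some v) &&
     (if tag (f e) is Some u then (load M u < omega u)%N else false)]%SET.

Variable R : realType.

(* Probability that GREEDY, started from the current matching M and presented
   with the vertices vs in this order, ends with a matching whose number of
   edges satisfies Q. *)
Fixpoint greedy_prob (vs : seq 'I_T) (M : {set Vhalf}) (Q : pred nat) : R :=
  if vs is v :: vs' then
    if available M v == finset.set0 then greedy_prob vs' M Q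
    else (\sum_(e in available M v) greedy_prob vs' (e |: M)%SET Q)
         / #|available M v|%:R
  else (Q #|M|)%:R.

End ConfigurationModel.

(* Law of the size of the matching built by GREEDY during the first t arrivals:
   the degrees are i.i.d. on each side, the pairing is uniform given the degrees,
   and GREEDY is run on the resulting multigraph. *)
Definition matching_size_law (R : realType) (piU piV : probability nat R)
    (N T : nat) (omega : 'I_N -> nat) (t : nat) (Q : pred nat) : \bar R :=
  \esum_(d in [set: {ffun 'I_N -> nat} * {ffun 'I_T -> nat}])
    ((\prod_(i < N) prob_at piU (d.1 i)) * (\prod_(j < T) prob_at piV (d.2 j)) *
     ((\sum_(f in pairings d.1 d.2)
         greedy_prob f omega R (take t (enum 'I_T)) finset.set0 Q)
      / #|pairings d.1 d.2|%:R))%:E.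

Definition cvg_in_probability (R : realType)
    (law : nat -> pred nat -> \bar R) (X : nat -> nat -> R) (l : R) : Prop :=
  forall eps : R, 0 < eps ->
    law n [pred m | eps < `|X n m - l|] @[n --> \oo] --> 0%E.

Section FluidLimit.
Variables (R : realType) (phiU phiV : R -> R) (muU muV : R).
Variables (C : nat) (p : nat -> R).

Definition mean_capacity : R := \sum_(1 <= c < C.+1) c%:R * p c.

Definition cumul (k : nat) : R := \sum_(1 <= c < k.+1) p c.

Definition Gamma (g : R) : R :=
  derive1n 1 phiU (1 - g) +
  \sum_(1 <= k < C) (1 - cumul k) * g ^+ k / (k`!)%:R * derive1n k.+1 phiU (1 - g).

Definition greedy_rhs (g : R) : R :=
  (1 - phiV (1 - Gamma g / muU)) / (muV / muU * Gamma g).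

(* The equation is imposed on ]0, 1[ and G is continuous up to the endpoints:
   where [Gamma (G s) != 0] the one-sided equation at an endpoint follows, and
   [Gamma (G 1) = 0] does occur (all degrees in V at most 1 and G(s) = s), in
   which case the right-hand side has the form 0/0 at s = 1. *)
Definition greedy_ode_solution (G : R -> R) : Prop :=
  [/\ {within `[0, 1], continuous G},
      G 0 = 0 &
      forall s : R, s \in `]0, 1[ -> is_derive s (1 : R) G (greedy_rhs (G s))].

Definition limit_ratio (g : R) : R :=
  1 - \sum_(0 <= k < C)
        (\sum_(1 <= c < C.+1) c%:R * p (c + k)%N) / mean_capacity
        * (1 / (k`!)%:R) * g ^+ k * derive1n k phiU (1 - g).

End FluidLimit.

(* Main.v *)
Require Import Defs.
From HB Require Import structures.
From mathcomp Require Import all_boot all_order all_algebra.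
From mathcomp Require Import all_classical all_reals all_analysis.
From mathcomp Require Import zify ring lra.

Set Implicit Arguments.
Unset Strict Implicit.
Unset Printing Implicit Defensive.

Import Order.TTheory GRing.Theory Num.Theory.
Import numFieldNormedType.Exports.

Local Open Scope classical_set_scope.
Local Open Scope ring_scope.

(* GREEDY only looks for the first available half-edge: by exchangeability,
   choosing an available edge at random has the same effect on the law of the size
   as scanning the half-edges of v_t in a fixed order until one is paired
   with a vertex that has remaining capacity, the unused half-edges staying
   unrevealed.  The revealed half-edges of U then form a uniform sample without
   replacement.  When a proportion g of them has been revealed, the next one is a
   success with probability close to q(g) = Gamma(g)/mu_U (second moment estimate,
   comparing hypergeometric and binomial laws), so a vertex of degree d reveals
   psi_d(q) = sum_(k<d) (1-q)^k half-edges on average, and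
   E psi_d(q(g))/mu_V is the right-hand side of the equation for G.

   With Phi a primitive of the inverse of this right-hand side (so that
   Phi(G(s)) = s), Phi(x_t/L) - t mu_V/L is, for x_t the number of reveals and L the
   number of half-edges, a sum of a martingale bounded in L2, of fluctuations of the
   degrees (handled by Abel summation and Chebyshev) and of negligible terms.  The
   size of the matching is the number of successes among the x_t reveals, that is
   N Lam(x_t/L) up to another martingale, where Lam' = Gamma.  At s = 1, where the
   reveals exhaust the half-edges, one uses that the last arrivals add at most one
   edge each. *)

(** * Sampling without replacement *)

(** The number of reveals is compared with [G] through [Phi] rather than by a Gronwall argument.
    Whatever the current state, an arrival increases [Phi] on average by nearly the same amount,
    mu_V / L, so errors add up without being amplified. As the rate is at most 1, [Phi] expands
    distances, and an error on [Phi] bounds the error on the position; as the rate is at least some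
    m > 0, the derivative of [Phi] is bounded and Lipschitz. The obstacle is the exhaustion of the
    half-edges: with i of L revealed, the second moment estimate for the success probability is of
    order 1/(L - i). For s < 1 the total degree of the arrivals stays below L by a fixed fraction of
    L, and the variance bounds rest on this gap. Degrees are restricted to a typical set, on which
    all bounds are deterministic in the degrees and the pairing is the only randomness left. The
    typical set is described by moments of order at most three, and its parameters are fixed before
    N tends to infinity. *)

Section Sampling.
Variables (R : realType) (H : finType).
Implicit Types (X : {set H}) (s : seq H) (F G : seq H -> R).

Definition avg X (f : H -> R) : R := (\sum_(x in X) f x) / #|X|%:R.

Lemma eq_avg X (f g : H -> R) : {in X, f =1 g} -> avg X f = avg X g.
Proof. by move=> fg; rewrite /avg (eq_bigr g). Qed.

Lemma le_avg X (f g : H -> R) :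
  (forall x, x \in X -> f x <= g x) -> avg X f <= avg X g.
Proof. by move=> fg; rewrite ler_wpM2r ?invr_ge0 ?ler0n// ler_sum. Qed.

Lemma avg_cst X (c : R) : (0 < #|X|)%N -> avg X (fun=> c) = c.
Proof.
move=> X0; rewrite /avg sumr_const -[c *+ _]mulr_natr mulfK//.
by rewrite pnatr_eq0 -lt0n.
Qed.

Lemma avgD X (f g : H -> R) : avg X (fun x => f x + g x) = avg X f + avg X g.
Proof. by rewrite /avg big_split mulrDl. Qed.

Lemma avgZ X (c : R) (f : H -> R) : avg X (fun x => c * f x) = c * avg X f.
Proof. by rewrite /avg -mulr_sumr mulrA. Qed.

(** Both sides average over ordered pairs of distinct elements of [X]: all inner averages share the
    denominator #|X| - 1. *)
Lemma avg_swap X (f : H -> H -> R) :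
  avg X (fun x => avg (X :\ x) (f x)) =
  avg X (fun y => avg (X :\ y) (fun x => f x y)).
Proof.
rewrite /avg; congr (_ / _).
have cE x : x \in X -> #|X :\ x|%:R = (#|X|.-1)%:R :> R.
  by move=> xX; rewrite (cardsD1 x X) xX.
under eq_bigr => x xX do rewrite (cE _ xX) mulr_suml.
under [RHS]eq_bigr => x xX do rewrite (cE _ xX) mulr_suml.
rewrite (exchange_big_dep (fun y => y \in X)) /=; last first.
  by move=> x y xX; rewrite !inE => /andP[].
apply: eq_bigr => y yX; apply: eq_bigl => x; rewrite !inE yX andbT andbC.
by rewrite eq_sym.
Qed.

Definition rest X s : {set H} := [set x in X | x \notin s]%SET.

Lemma rest0 X : rest X [::] = X.
Proof. by apply/setP => x; rewrite !inE andbT. Qed.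

Lemma rest_cons X x s : rest X (x :: s) = rest (X :\ x) s.
Proof.
by apply/setP => y; rewrite !inE negb_or andbA [_ && (y != x)]andbC.
Qed.

Lemma rest_perm X s s' : perm_eq s s' -> rest X s = rest X s'.
Proof. by move=> ss'; apply/setP => y; rewrite !inE (perm_mem ss'). Qed.

Definition arrangement n X s := [&& size s == n, uniq s & all (mem X) s].

Lemma arrangement_cons n X x s :
  arrangement n.+1 X (x :: s) = (x \in X) && arrangement n (X :\ x) s.
Proof.
rewrite /arrangement /= eqSS; case: eqP => //= _; last by rewrite andbF.
have -> : all (mem (X :\ x)) s = (x \notin s) && all (mem X) s.
  elim: s => //= y s ->; rewrite !inE negb_or eq_sym.
  by case: (x == y); case: (x \in s); case: (y \in X); rewrite ?andbF ?andbT.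
by case: (x \in X); case: (x \in s); case: (uniq s).
Qed.

Lemma card_rest n X s : arrangement n X s -> #|rest X s| = (#|X| - n)%N.
Proof.
elim: n X s => [|n IH] X [|x s] //.
- by rewrite rest0 subn0.
- rewrite arrangement_cons => /andP[xX /IH].
  by rewrite rest_cons => ->; rewrite [#|X|](cardsD1 x X) xX.
Qed.

(** Expectation over a uniform sequence of n distinct elements of [X], drawn one at a time. If n
    exceeds #|X|, some average runs over the empty set and the value is 0, hence the bounds on n in
    the lemmas below. *)
Fixpoint samp n X F : R :=
  if n is n'.+1 then avg X (fun x => samp n' (X :\ x) (fun s => F (x :: s)))
  else F [::].

Lemma eq_samp n X F G :
  (forall s, arrangement n X s -> F s = G s) -> samp n X F = samp n X G.
Proof.
elim: n X F G => [|n IH] X F G FG /=; first exact: FG.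
apply: eq_avg => x xX; apply: IH => s sP; apply: FG.
by rewrite arrangement_cons xX.
Qed.

Lemma le_samp n X F G :
  (forall s, arrangement n X s -> F s <= G s) -> samp n X F <= samp n X G.
Proof.
elim: n X F G => [|n IH] X F G FG /=; first exact: FG.
apply: le_avg => x xX; apply: IH => s sP; apply: FG.
by rewrite arrangement_cons xX.
Qed.

Lemma samp_cst n X (c : R) : (n <= #|X|)%N -> samp n X (fun=> c) = c.
Proof.
elim: n X => [//|n IH] X nX /=; rewrite -[RHS](@avg_cst X c); last first.
  exact: leq_trans nX.
by apply: eq_avg => x xX; apply: IH; rewrite (cardsD1 x X) xX in nX.
Qed.

Lemma sampD n X F G : samp n X (fun s => F s + G s) = samp n X F + samp n X G.
Proof.
elim: n X F G => [//|n IH] X F G /=; rewrite -avgD.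
by apply: eq_avg => x _; rewrite IH.
Qed.

Lemma sampZ n X c F : samp n X (fun s => c * F s) = c * samp n X F.
Proof.
elim: n X F => [//|n IH] X F /=; rewrite -avgZ.
by apply: eq_avg => x _; rewrite IH.
Qed.

Lemma samp0 n X : samp n X (fun=> 0) = 0.
Proof.
rewrite -[RHS](mul0r (samp n X (fun=> 0))) -sampZ.
by apply: eq_samp => s _; rewrite mul0r.
Qed.

Lemma samp_ge0 n X F :
  (forall s, arrangement n X s -> 0 <= F s) -> 0 <= samp n X F.
Proof. by move=> F0; rewrite -(samp0 n X); apply: le_samp. Qed.

Lemma samp_sum n X (I : Type) (r : seq I) (P : pred I) (f : I -> seq H -> R) :
  samp n X (fun s => \sum_(i <- r | P i) f i s) =
  \sum_(i <- r | P i) samp n X (f i).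
Proof.
elim: r => [|i r IH].
  by rewrite big_nil -[RHS](samp0 n X); apply: eq_samp => s _; rewrite big_nil.
rewrite big_cons -IH; case: ifPn => Pi.
  by rewrite -sampD; apply: eq_samp => s _; rewrite big_cons Pi.
by apply: eq_samp => s _; rewrite big_cons (negbTE Pi).
Qed.

Lemma samp_cat m n X F :
  samp (m + n) X F =
  samp m X (fun s => samp n (rest X s) (fun s' => F (s ++ s'))).
Proof.
elim: m X F => [|m IH] X F /=; first by rewrite rest0.
apply: eq_avg => x _; rewrite IH; apply: eq_samp => s _.
by rewrite rest_cons.
Qed.

Lemma samp_rcons n X F :
  samp n.+1 X F =
  samp n X (fun s => avg (rest X s) (fun x => F (rcons s x))).
Proof.
rewrite -addn1 samp_cat; apply: eq_samp => s _ /=.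
by apply: eq_avg => x _; rewrite cats1.
Qed.

(** Exchangeability: the element drawn after the n others may as well be drawn before them. *)
Lemma samp_avg n X (f : H -> seq H -> R) :
  samp n X (fun s => avg (rest X s) (fun x => f x s)) =
  avg X (fun x => samp n (X :\ x) (f x)).
Proof.
elim: n X f => [|n IH] X f /=; first by rewrite rest0.
under eq_avg => y _ do under eq_samp do rewrite rest_cons.
under eq_avg => y _ do rewrite (IH (X :\ y) (fun x s => f x (y :: s))).
rewrite avg_swap; apply: eq_avg => x _; apply: eq_avg => y _.
by rewrite finset.setDDl finset.setUC -finset.setDDl.
Qed.

Lemma samp_skip n X F : (n < #|X|)%N ->
  avg X (fun x => samp n (X :\ x) F) = samp n X F.
Proof.
move=> nX; rewrite -samp_avg; apply: eq_samp => s sP.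
by rewrite avg_cst// (card_rest sP) subn_gt0.
Qed.

Lemma samp_drop k n X F : (k + n <= #|X|)%N ->
  samp (k + n) X (fun s => F (drop k s)) = samp n X F.
Proof.
elim: k X => [|k IH] X knX; first by apply: eq_samp => s _; rewrite drop0.
rewrite addSn /= -[RHS]samp_skip; last by apply: leq_trans knX; rewrite addSn ltnS leq_addl.
apply: eq_avg => x xX; rewrite IH//.
by rewrite (cardsD1 x X) xX addSn ltnS in knX.
Qed.

Lemma samp_take k n X F : (k + n <= #|X|)%N ->
  samp (n + k) X (fun s => F (take n s)) = samp n X F.
Proof.
move=> knX; rewrite samp_cat; apply: eq_samp => s sP.
rewrite -[RHS](@samp_cst k (rest X s)); last first.
  by rewrite (card_rest sP) leq_subRL ?(leq_trans (leq_addl _ _) knX)// addnC.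
apply: eq_samp => s' _; rewrite take_size_cat//.
by case/and3P: sP => /eqP.
Qed.

Fixpoint arrangements n X : seq (seq H) :=
  if n is n'.+1 then
    flatten [seq [seq x :: s | s <- arrangements n' (X :\ x)] | x <- enum X]
  else [:: [::]].

Lemma mem_arrangements n X s : (s \in arrangements n X) = arrangement n X s.
Proof.
elim: n X s => [|n IH] X s /=.
  by rewrite inE /arrangement; case: s => //=.
apply/flatten_mapP/idP.
  move=> [x]; rewrite mem_enum => xX /mapP[s'] + ->.
  by rewrite IH arrangement_cons xX.
case: s => [|x s]; first by rewrite /arrangement.
rewrite arrangement_cons => /andP[xX sP]; exists x; first by rewrite mem_enum.
by apply/mapP; exists s => //; rewrite IH.
Qed.

Lemma uniq_arrangements n X : uniq (arrangements n X).
Proof.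
elim: n X => [//|n IH] X /=.
apply: (@allpairs_uniq_dep _ _ _ (fun x s => x :: s)
   (enum X) (fun x => arrangements n (X :\ x))).
- exact: enum_uniq.
- by move=> x _; apply: IH.
- by move=> [x s] [y s'] /= _ _ [-> ->].
Qed.

Lemma sampE n X F :
  samp n X F = (\sum_(s <- arrangements n X) F s) / (#|X| ^_ n)%:R.
Proof.
elim: n X F => [|n IH] X F /=; first by rewrite big_seq1 divr1.
rewrite /avg ffactnS natrM invfM mulrA big_flatten big_map big_enum /=.
rewrite [_ / _ / _]mulrAC; congr (_ / _); rewrite mulr_suml.
apply: eq_bigr => x xX; rewrite IH big_map; congr (_ / _%:R).
by rewrite [#|X|](cardsD1 x) xX.
Qed.

(** Such a [phi] maps the arrangements into themselves, and an injective self-map of a finite set is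
    onto, so the sum behind the average is only reordered. *)
Lemma samp_reindex n X F (phi : seq H -> seq H) :
  injective phi -> (forall s, perm_eq (phi s) s) ->
  samp n X (fun s => F (phi s)) = samp n X F.
Proof.
move=> phiI phiP; rewrite !sampE; congr (_ / _).
rewrite -(big_map phi xpredT F); apply: perm_big; apply: uniq_perm.
- by rewrite map_inj_uniq// uniq_arrangements.
- exact: uniq_arrangements.
have sub s : s \in map phi (arrangements n X) -> s \in arrangements n X.
  move=> /mapP[s' s'P ->]; move: s'P; rewrite !mem_arrangements.
  case/and3P => /eqP s1 s2 s3.
  rewrite /arrangement (perm_size (phiP _)) s1 eqxx/=.
  by rewrite (perm_uniq (phiP _)) s2 (perm_all _ (phiP _)).
have u : uniq (map phi (arrangements n X)).
  by rewrite map_inj_uniq// uniq_arrangements.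
by have [] := uniq_min_size u sub; rewrite ?size_map.
Qed.

End Sampling.

(** * Uniform tie-breaking and exchangeability *)

Section TieBreaking.
Variables (R : realType) (H : finType) (P : pred H).
Implicit Types (X : {set H}) (b : seq H).

Section Swap.
Variables (x0 : H) (i j : nat).

Definition transp n := if n == i then j else if n == j then i else n.

Lemma transpK : involutive transp.
Proof. by rewrite /transp => n; do !case: eqP => //; lia. Qed.

Definition swap_nth b :=
  if (i < size b)%N && (j < size b)%N
  then [seq nth x0 b (transp n) | n <- iota 0 (size b)] else b.

Lemma size_swap_nth b : size (swap_nth b) = size b.
Proof. by rewrite /swap_nth; case: ifP => //; rewrite size_map size_iota. Qed.

Lemma nth_swap_nth b n : (i < size b)%N -> (j < size b)%N -> (n < size b)%N ->
  nth x0 (swap_nth b) n = nth x0 b (transp n).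
Proof.
move=> ib jb nb; rewrite /swap_nth ib jb/= (nth_map 0)%N ?size_iota//.
by rewrite nth_iota.
Qed.

Lemma swap_nthK : involutive swap_nth.
Proof.
move=> b; have [/andP[ib jb]|h] := boolP ((i < size b)%N && (j < size b)%N).
  apply: (@eq_from_nth _ x0); rewrite ?size_swap_nth// => n nb.
  have tb : (transp n < size b)%N by rewrite /transp; case: ifP => //; case: ifP.
  by rewrite !nth_swap_nth ?size_swap_nth// transpK.
by rewrite {2}/swap_nth (negbTE h)/= /swap_nth (negbTE h).
Qed.

Lemma perm_swap_nth b : perm_eq (swap_nth b) b.
Proof.
rewrite /swap_nth; case: ifP => // /andP[ib jb].
apply/(perm_iotaP x0); exists [seq transp n | n <- iota 0 (size b)].
  apply: uniq_perm; rewrite ?iota_uniq//.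
    by rewrite map_inj_uniq ?iota_uniq//; exact: inv_inj transpK.
  move=> n; rewrite mem_iota/= add0n; apply/mapP/idP.
    move=> [m]; rewrite mem_iota/= add0n => mb ->.
    by rewrite /transp; case: ifP => //; case: ifP.
  move=> nb; exists (transp n); rewrite ?transpK// mem_iota/= add0n.
  by rewrite /transp; case: ifP => //; case: ifP.
by rewrite -map_comp.
Qed.

(** The first [P]-entry sits at position i, and position j also carries a [P]-entry. Exchanging the
    two leaves the pattern of [P] along the block unchanged, so the event is invariant under the
    swap. *)
Let guard b := [&& (i < size b)%N, (j < size b)%N, find P b == i & P (nth x0 b j)].

Let guard_swap b : guard b -> guard (swap_nth b).
Proof.
rewrite /guard => /and4P[ib jb /eqP fb Pj]; rewrite size_swap_nth ib jb/=.
have Pi : P (nth x0 b i) by rewrite -fb nth_find// has_find fb.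
have E : map P (swap_nth b) = map P b.
  apply: (@eq_from_nth _ true); rewrite ?size_map ?size_swap_nth// => n nb.
  rewrite !(nth_map x0) ?size_swap_nth// nth_swap_nth// /transp.
  by case: eqP => [->|_]; [rewrite Pi Pj | case: eqP => [->|//]; rewrite Pi Pj].
have fE s : find P s = find id (map P s) by rewrite find_map.
by rewrite fE E -fE fb eqxx nth_swap_nth// /transp eqxx; case: ifP.
Qed.

Lemma guard_swapE b : guard (swap_nth b) = guard b.
Proof.
apply/idP/idP; last exact: guard_swap.
by move/guard_swap; rewrite swap_nthK.
Qed.

Lemma samp_swap D X (k : H -> {set H} -> R) :
  samp D X (fun b => (guard b)%:R * (k (nth x0 b i) (rest X b) / (count P b)%:R)) =
  samp D X (fun b => (guard b)%:R * (k (nth x0 b j) (rest X b) / (count P b)%:R)).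
Proof.
rewrite -[LHS](@samp_reindex _ _ _ _ _ swap_nth); last 2 first.
- exact: inv_inj swap_nthK.
- exact: perm_swap_nth.
apply: eq_samp => b _; rewrite guard_swapE.
have [gb|] := boolP (guard b); last by rewrite !mul0r.
case/and4P: gb => ib jb _ _; rewrite nth_swap_nth// {1}/transp eqxx.
rewrite (rest_perm _ (perm_swap_nth b)); congr (_ * (_ / _%:R)).
by move/permP: (perm_swap_nth b) => ->.
Qed.

End Swap.

(* With ties broken uniformly, each of the P-entries of a block is chosen with
   the same probability; swapping it with the first P-entry shows that always
   choosing the first one gives the same expectation. *)
Lemma samp_tie_break D X (k : H -> {set H} -> R) (k0 : {set H} -> R) :
  samp D X (fun b => if has P b
    then (\sum_(x <- seq.filter P b) k x (rest X b)) / (count P b)%:R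
    else k0 (rest X b)) =
  samp D X (fun b => if has P b
    then \sum_(x <- take 1 (seq.filter P b)) k x (rest X b) else k0 (rest X b)).
Proof.
have [x0 _|H0] := pickP (@predT H); last first.
  by apply: eq_samp => -[//|x s]; have := H0 x.
pose g i j b := [&& (i < size b)%N, (j < size b)%N, find P b == i & P (nth x0 b j)].
(* Both expectations are split over i, the position of the first [P]-entry, and j, the position of
   any [P]-entry; [h] tells which of the two is the chosen one, and [samp_swap] exchanges them. *)
have E h (V : seq H -> R) :
    (forall b, has P b -> size b = D ->
      \sum_(0 <= i < D) \sum_(0 <= j < D) (g i j b)%:R *
         (k (nth x0 b (h i j)) (rest X b) / (count P b)%:R) = V b) ->
    samp D X (fun b => if has P b then V b else k0 (rest X b)) =
    \sum_(0 <= i < D) \sum_(0 <= j < D) samp D X (fun b => (g i j b)%:R *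
         (k (nth x0 b (h i j)) (rest X b) / (count P b)%:R)) +
    samp D X (fun b => if has P b then 0 else k0 (rest X b)).
  move=> hV; under eq_bigr do rewrite -samp_sum.
  rewrite -samp_sum -sampD; apply: eq_samp => b /and3P[/eqP sb _ _].
  case: ifPn => [hb|nb]; first by rewrite addr0 -hV.
  rewrite big1 ?add0r// => i _; rewrite big1// => j _.
  rewrite /g; case: ltnP => ib; rewrite ?mul0r//=.
  rewrite (_ : (find P b == i) = false) ?andbF ?mul0r//.
  by apply/negbTE/eqP => fi; move: ib; rewrite -fi -has_find (negbTE nb).
have gE i j b : has P b -> size b = D -> (i < D)%N -> (j < D)%N ->
    (g i j b)%:R = (i == find P b)%:R * (P (nth x0 b j))%:R :> R.
  move=> hb sb iD jD; rewrite /g sb iD jD/= eq_sym.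
  by case: eqP => //; rewrite ?mul1r ?mul0r.
have oneE b (F : nat -> R) : has P b -> size b = D ->
    \sum_(0 <= i < D) (i == find P b)%:R * F i = F (find P b).
  move=> hb sb; rewrite big_mkord.
  have fD : (find P b < D)%N by rewrite -sb -has_find.
  rewrite (bigD1 (Ordinal fD))//= eqxx mul1r big1 ?addr0// => i.
  by rewrite -val_eqE/= => /negbTE ->; rewrite mul0r.
have cntE b (F : H -> R) : size b = D ->
    \sum_(0 <= j < D) (P (nth x0 b j))%:R * F (nth x0 b j) =
    \sum_(x <- seq.filter P b) F x.
  move=> <-; rewrite big_filter (big_nth x0) [RHS]big_mkcond/=.
  by apply: eq_bigr => j _; case: ifP; rewrite ?mul1r ?mul0r.
have cnt1E b : size b = D ->
    \sum_(0 <= j < D) (P (nth x0 b j))%:R = (count P b)%:R :> R.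
  move=> sb; have := cntE b (fun=> 1) sb; under eq_bigr do rewrite mulr1.
  by move=> ->; rewrite big_const_seq count_predT size_filter iter_addr_0.
pose kk x b := k x (rest X b) / (count P b)%:R.
rewrite [LHS](E (fun _ j => j) (fun b =>
  (\sum_(x <- seq.filter P b) k x (rest X b)) / (count P b)%:R)); last first.
  move=> b hb sb; rewrite mulr_suml -(cntE b (fun x => kk x b) sb).
  rewrite -[RHS](oneE b (fun _ => _))//.
  apply: eq_big_nat => i /andP[_ iD]; rewrite mulr_sumr.
  by apply: eq_big_nat => j /andP[_ jD]; rewrite gE// -mulrA.
rewrite [RHS](E (fun i _ => i) (fun b =>
  \sum_(x <- take 1 (seq.filter P b)) k x (rest X b))).
  by congr (_ + _); apply: eq_bigr => i _; apply: eq_bigr => j _;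
     rewrite (samp_swap x0 i j).
move=> b hb sb.
(* When the chosen entry does not depend on j, the sum over j only produces the number of
   [P]-entries, which cancels the denominator. *)
transitivity (kk (nth x0 b (find P b)) b * (count P b)%:R).
  rewrite -[X in _ * X]cnt1E// mulr_sumr exchange_big/=.
  apply: eq_big_nat => j /andP[_ jD].
  rewrite -(oneE b (fun i => kk (nth x0 b i) b * (P (nth x0 b j))%:R))//.
  by apply: eq_big_nat => i /andP[_ iD]; rewrite gE// -mulrA [X in _ * X = _]mulrC.
rewrite /kk divfK; last by rewrite pnatr_eq0 -lt0n -has_count.
case: (split_find_nth x0 hb) => x s1 s2 Px nP1.
rewrite filter_cat filter_rcons Px.
have -> : seq.filter P s1 = [::].
  by apply/eqP; rewrite -size_eq0 size_filter -leqn0 leqNgt -has_count.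
by rewrite /= take0 big_seq1.
Qed.

End TieBreaking.

(** * Exploration of the pairing by GREEDY *)

Section Exploration.
Variables (N : nat) (H : finType) (grp : H -> option 'I_N) (omega : 'I_N -> nat).
Implicit Types (s rho : seq H) (l : 'I_N -> nat) (D : nat) (ds : seq nat).

Definition free l (x : H) := if grp x is Some u then (l u < omega u)%N else false.

Definition incr l (x : H) : 'I_N -> nat := fun u => (l u + (grp x == Some u))%N.

Definition open_after s (x : H) :=
  if grp x is Some u then (count (fun y => grp y == Some u) s < omega u)%N
  else false.

Definition hit rho (i : nat) : bool :=
  if drop i rho is x :: _ then open_after (take i rho) x else false.

(* An arriving vertex of degree D reveals the partners of its half-edges one by
   one, from the x-th reveal on, until the first success; the others stay
   unrevealed, so that the next arrival resumes at the returned position. *)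
Fixpoint step (b : nat -> bool) D (x : nat) : nat :=
  if D is D'.+1 then if b x then x.+1 else step b D' x.+1 else x.

Definition position b ds x : nat := foldl (fun y D => step b D y) x ds.

Lemma step_ge b D x : (x <= step b D x)%N.
Proof.
elim: D x => [//|D IH] x /=; case: ifP => _ //.
exact: leq_trans (IH _).
Qed.

Lemma step_le b D x : (step b D x <= x + D)%N.
Proof.
elim: D x => [|D IH] x /=; first by rewrite addn0.
case: ifP => _; first by rewrite addnS ltnS leq_addr.
by rewrite addnS -addSn.
Qed.

Lemma step_allF b D x : (forall i, (i < D)%N -> b (x + i)%N = false) ->
  step b D x = (x + D)%N.
Proof.
elim: D x => [|D IH] x bF /=; first by rewrite addn0.
have := bF 0%N isT; rewrite addn0 => ->; rewrite IH ?addSnnS// => i iD.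
by rewrite addSnnS bF.
Qed.

Lemma step_first b D x k : (k < D)%N ->
  (forall i, (i < k)%N -> b (x + i)%N = false) -> b (x + k)%N ->
  step b D x = (x + k).+1.
Proof.
elim: D x k => [//|D IH] x [|k] kD bF bk /=; first by rewrite addn0 in bk *; rewrite bk.
have := bF 0%N isT; rewrite addn0 => ->; rewrite (IH _ k)//.
- by rewrite addSnnS.
- by move=> i ik; rewrite addSnnS bF.
- by rewrite addSnnS.
Qed.

Lemma position_ge b ds x : (x <= position b ds x)%N.
Proof.
elim: ds x => [//|D ds IH] x /=.
exact: leq_trans (step_ge b D x) (IH _).
Qed.

(** Under the scan, each revealed half-edge of u is matched until u is full. The load is thus the
    number of revealed half-edges truncated at the capacity, which is why [open_after] may count
    revealed half-edges instead of matched ones. *)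
Definition consistent s l :=
  forall u, l u = minn (count (fun y => grp y == Some u) s) (omega u).

Lemma free_consistent s l x : consistent s l -> free l x = open_after s x.
Proof.
by move=> c; rewrite /free /open_after; case: (grp x) => // u; rewrite c; lia.
Qed.

Lemma consistent_incr s l x : consistent s l -> open_after s x ->
  consistent (rcons s x) (incr l x).
Proof.
rewrite /open_after => c; case E: (grp x) => [u|//] ux v.
rewrite /incr c -cats1 count_cat /= E addn0.
case: eqP => [[<-]|_]; lia.
Qed.

Lemma consistent_closed s l s' : consistent s l -> ~~ has (free l) s' ->
  consistent (s ++ s') l.
Proof.
move=> c; elim: s' s c => [|x s' IH] s c /=; first by rewrite cats0.
rewrite negb_or => /andP[fx hs'].
rewrite -cat_rcons; apply: IH => // u.
rewrite -cats1 count_cat /= addn0 c.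
move: fx; rewrite /free; case E: (grp x) => [v|]; last by rewrite addn0.
by case: eqP => [[<-]|]; rewrite ?addn0// c; lia.
Qed.

Lemma hit_cat s x t : hit (s ++ x :: t) (size s) = open_after s x.
Proof. by rewrite /hit drop_size_cat// take_size_cat. Qed.

Section Value.
Variables (R : realType) (Q : pred nat).

Fixpoint greedy_value ds l (m : nat) rho : R :=
  if ds is D :: ds' then
    let a := [seq x <- take D rho | free l x] in
    if has (free l) (take D rho) then
      (\sum_(x <- a) greedy_value ds' (incr l x) m.+1 (drop D rho)) /
        (count (free l) (take D rho))%:R
    else greedy_value ds' l m (drop D rho)
  else (Q m)%:R.

(** Unlike in [greedy_value], the entries after the first free one stay in [rho] and are offered to
    the next vertex. The sum over [take 1] of the filtered list selects the first free entry without
    a default element. *)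
Fixpoint scan_value ds l (m : nat) rho : R :=
  if ds is D :: ds' then
    if has (free l) (take D rho) then
      \sum_(x <- take 1 [seq x <- take D rho | free l x])
        scan_value ds' (incr l x) m.+1 (drop (find (free l) rho).+1 rho)
    else scan_value ds' l m (drop D rho)
  else (Q m)%:R.

Lemma greedy_value_cat ds l m rho t : (sumn ds <= size rho)%N ->
  greedy_value ds l m (rho ++ t) = greedy_value ds l m rho.
Proof.
elim: ds l m rho => [//|D ds IH] l m rho /= dsr.
have Dr : (D <= size rho)%N by lia.
rewrite takel_cat// drop_cat.
have dr : (sumn ds <= size (drop D rho))%N by rewrite size_drop; lia.
have E l' m' : greedy_value ds l' m' (if (D < size rho)%N then drop D rho ++ t
    else drop (D - size rho) t) = greedy_value ds l' m' (drop D rho).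
  case: ltnP => rD; first exact: IH.
  have -> : (D = size rho)%N by apply/eqP; rewrite eqn_leq Dr.
  by rewrite subnn drop0 drop_size -[in LHS](cat0s t) IH//=; move: dr; rewrite size_drop; lia.
rewrite E; case: ifP => // _; congr (_ / _).
by apply: eq_bigr => x _; rewrite E.
Qed.

Lemma scan_value_take ds l m rho n : (sumn ds <= n)%N ->
  (sumn ds <= size rho)%N ->
  scan_value ds l m (take n rho) = scan_value ds l m rho.
Proof.
elim: ds l m rho n => [//|D ds IH] l m rho n /= dn dr.
rewrite take_takel; last lia.
have [h|nh] := boolP (has _ _); last first.
  have -> : drop D (take n rho) = take (n - D) (drop D rho).
    by rewrite take_drop subnK//; lia.
  by rewrite IH// ?size_drop; lia.
apply: eq_bigr => x _.
have hr : has (free l) rho.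
  by rewrite -(cat_take_drop D rho) has_cat h.
have fD : (find (free l) rho < D)%N by rewrite -has_take.
have -> : find (free l) (take n rho) = find (free l) rho.
  rewrite -[in RHS](cat_take_drop n rho) find_cat ifT//.
  by rewrite has_take//; lia.
have -> : drop (find (free l) rho).+1 (take n rho) =
    take (n - (find (free l) rho).+1) (drop (find (free l) rho).+1 rho).
  by rewrite take_drop subnK//; lia.
by apply: IH; rewrite ?size_drop; lia.
Qed.

(** Turns the scan into a deterministic functional of the sequence of successes. In the induction
    [s] is the part already revealed: an arrival without free entry moves its whole block into [s],
    otherwise the block up to and including the success is moved. *)
Lemma scan_valueE ds l m s rho : consistent s l -> (sumn ds <= size rho)%N ->
  scan_value ds l m rho =
  (Q (m + \sum_(size s <= i < position (hit (s ++ rho)) ds (size s))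
            hit (s ++ rho) i)%N)%:R.
Proof.
elim: ds l m s rho => [|D ds IH] l m s rho c /= dsr.
  by rewrite big_geq// addn0.
have [h|nh] := boolP (has _ _); last first.
  have cD := consistent_closed c nh.
  have sD : size (s ++ take D rho) = (size s + D)%N.
    by rewrite size_cat size_takel//; lia.
  have hF i : (i < D)%N -> hit (s ++ rho) (size s + i)%N = false.
    move=> iD; have ir : (i < size rho)%N by lia.
    have := cat_take_drop i rho; case E: (drop i rho) => [|y t].
      by have := size_drop i rho; rewrite E /=; lia.
    have it : size (s ++ take i rho) = (size s + i)%N.
      by rewrite size_cat size_takel//; lia.
    move=> <-; rewrite catA -it hit_cat.
    have ni : ~~ has (free l) (take i rho).
      by move: nh; rewrite -{1}(@subnK i D) ?(ltnW iD)// addnC takeD has_cat negb_or => /andP[].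
    rewrite -(free_consistent y (consistent_closed c ni)).
    apply/negbTE; move: nh; apply: contra => fy.
    apply/hasP; exists y => //.
    have -> : take D rho = take i rho ++ y :: take (D - i).-1 t.
      rewrite -{1}(@subnK i D) ?(ltnW iD)// addnC takeD E.
      by have -> : (D - i = (D - i).-1.+1)%N by lia.
    by rewrite mem_cat inE eqxx orbT.
  rewrite (step_allF hF) (IH _ _ (s ++ take D rho))//; last by rewrite size_drop; lia.
  rewrite -catA cat_take_drop sD.
  congr ((Q (m + _)%N)%:R).
  rewrite [RHS](@big_cat_nat _ _ _ (size s + D)%N)/= ?leq_addr ?position_ge//.
  rewrite [X in (_ = X + _)%N]big1_seq ?add0n// => i /=.
  rewrite mem_index_iota => /andP[si iD].
  by rewrite -(subnKC si) hF//; lia.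
have hr : has (free l) rho by rewrite -(cat_take_drop D rho) has_cat h.
have kD : (find (free l) rho < D)%N by rewrite -has_take.
set k := find (free l) rho in kD *.
have kr : (k < size rho)%N by rewrite -has_find.
have := cat_take_drop k rho; case E: (drop k rho) => [|x t].
  by have := size_drop k rho; rewrite E /=; lia.
move=> rE.
have fx : free l x.
  have := nth_find x hr; rewrite -/k.
  by rewrite -{1}rE nth_cat size_takel ?(ltnW kr)// ltnn subnn.
have nk : ~~ has (free l) (take k rho) by rewrite has_take// ltnn.
have aE : take 1 [seq y <- take D rho | free l y] = [:: x].
  have -> : take D rho = take k rho ++ x :: take (D - k).-1 t.
    rewrite -{1}(@subnK k D) ?(ltnW kD)// addnC takeD E.
    by have -> : (D - k = (D - k).-1.+1)%N by lia.
  rewrite filter_cat /= fx.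
  have -> : [seq y <- take k rho | free l y] = [::].
    by apply/eqP; rewrite -size_eq0 size_filter -leqn0 leqNgt -has_count.
  by rewrite /= take0.
rewrite aE big_seq1.
have ck := consistent_closed c nk.
have sk : size (s ++ take k rho) = (size s + k)%N.
  by rewrite size_cat size_takel//; lia.
have hk : hit (s ++ rho) (size s + k).
  by rewrite -rE catA -sk hit_cat -(free_consistent _ ck).
have hF i : (i < k)%N -> hit (s ++ rho) (size s + i)%N = false.
  move=> ik; have ir : (i < size rho)%N by lia.
  have := cat_take_drop i rho; case E': (drop i rho) => [|y t'].
    by have := size_drop i rho; rewrite E' /=; lia.
  have it : size (s ++ take i rho) = (size s + i)%N.
    by rewrite size_cat size_takel//; lia.
  move=> rE'; rewrite -{1}rE' catA -it hit_cat.
  have ni : ~~ has (free l) (take i rho) by rewrite has_take// -/k; lia.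
  rewrite -(free_consistent y (consistent_closed c ni)).
  have := before_find y ik; rewrite -{1}rE' nth_cat size_takel ?(ltnW ir)//.
  by rewrite ltnn subnn.
rewrite (step_first kD hF hk).
have cx : consistent (rcons (s ++ take k rho) x) (incr l x).
  by apply: consistent_incr => //; rewrite -(free_consistent _ ck).
have dk : drop k.+1 rho = t by rewrite -addn1 addnC -drop_drop E /= drop0.
rewrite dk (IH _ _ _ _ cx); last first.
  by rewrite -dk size_drop; lia.
rewrite size_rcons sk cat_rcons -catA rE.
congr ((Q _)%:R).
rewrite [in RHS](@big_cat_nat _ _ _ (size s + k).+1)/=; last 2 first.
- by rewrite leqW ?leq_addr.
- exact: position_ge.
rewrite big_nat_recr ?leq_addr//= hk.
rewrite [X in (_ = _ + (X + _ + _))%N]big1_seq ?add0n; first by lia.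
move=> i /=; rewrite mem_index_iota => /andP[si iD].
by rewrite -(subnKC si) hF//; lia.
Qed.

(** The continuation [K x] reads only n - D entries, and after the success any n - D consecutive
    remaining entries form a uniform sample. Resuming right after the success, rather than after the
    D entries of the block, keeps the expectation. *)
Lemma samp_scan_skip (P : pred H) n D (K : H -> seq H -> R) (X : {set H}) :
  (D <= n)%N -> (n <= #|X|)%N ->
  (forall x rho, (n - D <= size rho)%N -> K x (take (n - D) rho) = K x rho) ->
  samp n X (fun rho => if has P (take D rho) then
     \sum_(x <- take 1 (seq.filter P (take D rho))) K x (drop D rho) else 0) =
  samp n X (fun rho => if has P (take D rho) then
     \sum_(x <- take 1 (seq.filter P (take D rho)))
         K x (drop (find P rho).+1 rho) else 0).
Proof.
elim: D n K X => [|D IH] n K X Dn nX KP.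
  by apply: eq_samp => rho _; rewrite take0.
case: n Dn nX KP => [//|n] /= Dn nX KP.
apply: eq_avg => x xX.
have nX' : (n <= #|X :\ x|)%N by rewrite (cardsD1 x) xX in nX.
have [Px|nPx] := boolP (P x).
  under eq_samp => s _ do rewrite /= take0 big_seq1.
  under [RHS]eq_samp => s _ do rewrite /= take0 big_seq1 drop0.
  have {1}-> : n = (D + (n - D))%N by rewrite subnKC.
  rewrite (samp_drop (fun s => K x s)); last by rewrite subnKC.
  rewrite -(@samp_take _ _ D (n - D) (X :\ x)); last by rewrite subnKC.
  rewrite subnK//; apply: eq_samp => rho /and3P[/eqP sr _ _].
  by rewrite KP// sr subSS leq_subr.
by rewrite (IH n).
Qed.

End Value.
End Exploration.

Section GreedyLaw.
Variables (R : realType).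

Lemma samp_greedy_scan (N : nat) (H : finType) (grp : H -> option 'I_N)
    (omega : 'I_N -> nat) (Q : pred nat) ds l m n (X : {set H}) :
  (sumn ds <= n)%N -> (n <= #|X|)%N ->
  samp n X (greedy_value grp omega R Q ds l m) =
  samp n X (scan_value grp omega R Q ds l m).
Proof.
elim: ds l m n X => [|D ds IH] l m n X dn nX; first exact: eq_samp.
have Dn : (D <= n)%N by move: dn => /=; lia.
have dn' : (sumn ds <= n - D)%N by move: dn => /=; lia.
pose P := free grp omega l.
(* The value of the future depends on the current block only through the chosen entry and the set of
   unsampled half-edges, which is the form required by [samp_tie_break]. *)
pose k x Y := samp (n - D) Y (scan_value grp omega R Q ds (incr grp l x) m.+1).
pose k0 Y := samp (n - D) Y (scan_value grp omega R Q ds l m).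
transitivity (samp D X (fun b => if has P b
    then (\sum_(x <- seq.filter P b) k x (rest X b)) / (count P b)%:R
    else k0 (rest X b))).
  rewrite -{1}(subnKC Dn) samp_cat; apply: eq_samp => b bP.
  have nb : (n - D <= #|rest X b|)%N by rewrite (card_rest bP); lia.
  have sb : size b = D by case/and3P: bP => /eqP.
  rewrite -/P; case: ifPn => hb.
    transitivity (samp (n - D) (rest X b) (fun s =>
      (count P b)%:R^-1 * \sum_(x <- seq.filter P b)
        greedy_value grp omega R Q ds (incr grp l x) m.+1 s)).
      apply: eq_samp => s _ /=.
      by rewrite take_size_cat// drop_size_cat// -/P hb mulrC.
    rewrite sampZ samp_sum mulrC; congr (_ / _); apply: eq_bigr => x _.
    exact: IH.
  rewrite /k0 -IH//; apply: eq_samp => s _ /=.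
  by rewrite take_size_cat// drop_size_cat// -/P (negbTE hb).
rewrite samp_tie_break.
transitivity (samp n X (fun rho =>
   (if has P (take D rho) then \sum_(x <- take 1 (seq.filter P (take D rho)))
     scan_value grp omega R Q ds (incr grp l x) m.+1 (drop D rho) else 0) +
   (if has P (take D rho) then 0
    else scan_value grp omega R Q ds l m (drop D rho)))).
  rewrite -{1}(subnKC Dn) samp_cat; apply: eq_samp => b bP.
  have sb : size b = D by case/and3P: bP => /eqP.
  case: ifPn => hb.
    rewrite -samp_sum; apply: eq_samp => s _ /=.
    by rewrite take_size_cat// drop_size_cat// hb addr0.
  apply: eq_samp => s _ /=.
  by rewrite take_size_cat// drop_size_cat// (negbTE hb) add0r.
rewrite sampD.
rewrite (@samp_scan_skip _ _ P _ _
  (fun x => scan_value grp omega R Q ds (incr grp l x) m.+1))//; last first.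
  by move=> x rho rhoP; apply: scan_value_take => //; lia.
rewrite -sampD; apply: eq_samp => rho _ /=; rewrite -/P.
by case: ifP => _; rewrite ?addr0 ?add0r.
Qed.

Section Pairing.
Variables (N T : nat) (dU : 'I_N -> nat) (dV : 'I_T -> nat) (omega : 'I_N -> nat).
Variable Q : pred nat.

Let Vh := Vhalf dU dV.
Let Uh := Uhalf dU dV.
Let owner (x : Uh) : option 'I_N := tag x.

Lemma card_half_edge n (d : 'I_n -> nat) m :
  #|half_edge d m| = maxn (total_deg d) m.
Proof.
rewrite card_tagged sumnE big_map big_enum /=.
under eq_bigr do rewrite card_ord.
rewrite (bigD1 None)//= (reindex_omap Some id)/=; last by case.
rewrite [X in (_ + X)%N](_ : _ = total_deg d); first by lia.
by apply: eq_bigl => i; rewrite eqxx.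
Qed.

Lemma card_Uhalf : #|Uh| = maxn (total_deg dU) (total_deg dV).
Proof. exact: card_half_edge. Qed.

Lemma card_Vhalf : #|Vh| = maxn (total_deg dU) (total_deg dV).
Proof. by rewrite card_half_edge maxnC. Qed.

Definition halves (v : 'I_T) : seq Vh :=
  [seq Tagged (fun x => 'I_(ext_deg dV (total_deg dU) x)) (i : 'I_(ext_deg dV (total_deg dU) (Some v)))
     | i <- enum 'I_(dV v)].

Lemma size_halves v : size (halves v) = dV v.
Proof. by rewrite size_map size_enum_ord. Qed.

Lemma mem_halves v (e : Vh) : (e \in halves v) = (tag e == Some v).
Proof.
apply/mapP/eqP => [[i _ ->]//|].
case: e => x i /= xv; move: i; rewrite xv => i; exists i => //.
exact: mem_enum.
Qed.

Lemma uniq_halves v : uniq (halves v).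
Proof.
rewrite map_inj_in_uniq ?enum_uniq// => i j _ _ /eqP.
by rewrite eq_Tagged => /eqP.
Qed.

Section Fixed.
Variable f : {ffun Vh -> Uh}.

Lemma load_add (M : {set Vh}) e : e \notin M ->
  load f (e |: M)%SET = incr owner (load f M) (f e).
Proof.
move=> eM; apply/funext => u; rewrite /load /incr /owner.
case: eqP => [fe|fe].
  transitivity #|(e |: [set e' in M | tag (f e') == Some u])%SET|.
    apply: eq_card => e'; rewrite !inE; case: eqP => [->|//].
    by rewrite fe eqxx.
  by rewrite cardsU1 inE (negbTE eM) /= add1n addn1.
rewrite addn0; apply: eq_card => e'; rewrite !inE.
case: (eqVneq e' e) => [->|//]; rewrite (negbTE eM)/=.
exact/eqP.
Qed.

(** GREEDY consults [f] only through the partners of the half-edges of the arriving vertices, here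
    listed vertex by vertex. The condition on [M] makes every added edge new, so that loads and
    cardinality are updated exactly. *)
Lemma greedy_probE vs (M : {set Vh}) : uniq vs ->
  (forall e v, e \in M -> v \in vs -> tag e != Some v) ->
  greedy_prob f omega R vs M Q =
  greedy_value owner omega R Q (map dV vs) (load f M) #|M|
    (flatten [seq map f (halves v) | v <- vs]).
Proof.
elim: vs M => [//|v vs IH] M /= /andP[vvs uvs] Mvs.
have sv : size (map f (halves v)) = dV v by rewrite size_map size_halves.
rewrite take_size_cat// drop_size_cat//.
set A := [seq e <- halves v | free owner omega (load f M) (f e)].
have uA : uniq A by rewrite filter_uniq// uniq_halves.
have AE : available f omega M v =i A.
  by move=> e; rewrite inE mem_filter mem_halves andbC.
have cA : #|available f omega M v| = size A.
  by rewrite (eq_card AE); apply/card_uniqP.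
have hA : has (free owner omega (load f M)) (map f (halves v)) = (0 < size A)%N.
  by rewrite has_map has_count size_filter.
have cE : count (free owner omega (load f M)) (map f (halves v)) = size A.
  by rewrite count_map size_filter.
rewrite -cards_eq0 cA hA cE.
case: posnP => [_|A0].
  by apply: IH => // e w eM wvs; apply: Mvs => //; rewrite inE wvs orbT.
congr (_ / _); rewrite (eq_bigl _ _ AE) -big_uniq//= filter_map big_map.
rewrite -/A big_seq [RHS]big_seq; apply: eq_bigr => e.
rewrite mem_filter mem_halves => /andP[_ /eqP ev].
have eM : e \notin M.
  by apply/negP => eM; have := Mvs e v eM (mem_head _ _); rewrite ev eqxx.
rewrite IH//; first by rewrite load_add// cardsU1 eM add1n.
move=> e' w; rewrite !inE => /orP[/eqP ->|e'M] wvs.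
  by rewrite ev; apply: contra vvs => /eqP[->].
by apply: Mvs => //; rewrite inE wvs orbT.
Qed.

End Fixed.

(** Reading an injection along an enumeration of its domain gives an arrangement of all the
    half-edges of U. This map is injective between sets of equal cardinality, hence transports the
    uniform law. *)
Lemma pairings_samp (es : seq Vh) (F : seq Uh -> R) :
  uniq es -> (forall e, e \in es) ->
  (\sum_(f in pairings dU dV) F (map f es)) / #|pairings dU dV|%:R =
  samp #|Uh| [set: Uh]%SET F.
Proof.
move=> ues ess.
have ses : size es = #|Uh|.
  rewrite card_Uhalf -card_Vhalf -(card_uniqP ues).
  by apply: eq_card => e; rewrite ess.
have cP : #|pairings dU dV| = (#|Uh| ^_ #|Uh|)%N.
  by rewrite /pairings card_inj_ffuns card_Vhalf card_Uhalf.
(* The number of arrangements is read off from the average of the constant 1. *)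
have sA : size (arrangements #|Uh| [set: Uh]%SET) = (#|Uh| ^_ #|Uh|)%N.
  have := sampE (R := R) #|Uh| [set: Uh]%SET (fun=> 1).
  rewrite samp_cst ?cardsT// big_const_seq count_predT iter_addr_0 => /esym.
  have f0 : (#|Uh| ^_ #|Uh|)%:R != 0 :> R by rewrite pnatr_eq0 -lt0n ffact_gt0.
  by move=> /(canRL (divfK f0)); rewrite mul1r => /eqP; rewrite eqr_nat => /eqP.
rewrite sampE cardsT cP; congr (_ / _).
rewrite -big_enum -(big_map (fun f : {ffun Vh -> Uh} => map f es) xpredT F).
apply: perm_big.
have um : uniq [seq map f es | f : {ffun Vh -> Uh} <- enum (pairings dU dV)].
  rewrite map_inj_in_uniq ?enum_uniq// => f g _ _ fg; apply/ffunP => e.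
  by have /eq_in_map := fg; apply.
apply: uniq_perm => //; first exact: uniq_arrangements.
have sub : {subset [seq map f es | f : {ffun Vh -> Uh} <- enum (pairings dU dV)]
    <= arrangements #|Uh| [set: Uh]%SET}.
  move=> s /mapP[f]; rewrite mem_enum inE => /injectiveP fI ->.
  rewrite mem_arrangements /arrangement size_map ses eqxx map_inj_uniq// ues/=.
  by apply/allP => x _; exact: finset.in_setT.
have [//|//] := uniq_min_size um sub.
by rewrite size_map -cardE cP sA.
Qed.

Definition revealed_hit (rho : seq Uh) : nat -> bool := hit owner omega rho.

Lemma average_greedy_prob (t n : nat) :
  (sumn (take t [seq dV v | v <- enum 'I_T]) <= n)%N -> (n <= #|Uh|)%N ->
  (\sum_(f in pairings dU dV)
      greedy_prob f omega R (take t (enum 'I_T)) finset.set0 Q)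
    / #|pairings dU dV|%:R =
  samp n [set: Uh]%SET (fun rho => (Q (\sum_(0 <= i < position (revealed_hit rho)
     (take t [seq dV v | v <- enum 'I_T]) 0) revealed_hit rho i)%N)%:R).
Proof.
move=> dn nU.
set vs := take t (enum 'I_T).
have uvs : uniq vs by rewrite take_uniq// enum_uniq.
have dsE : take t [seq dV v | v <- enum 'I_T] = map dV vs by rewrite map_take.
rewrite dsE in dn *.
(* Half-edges are listed in the order of arrival; those of later vertices and of the auxiliary
   vertex follow in any order and are never read. *)
pose es1 := flatten [seq halves v | v <- vs].
pose es := es1 ++ [seq e <- enum Vh | e \notin es1].
have ues : uniq es.
  rewrite cat_uniq filter_uniq ?enum_uniq// andbT; apply/andP; split.
    have -> : es1 = [seq e | v <- vs, e <- halves v].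
      by congr flatten; apply: eq_map => v; rewrite map_id.
    apply: allpairs_uniq_dep => //.
      by move=> v _; exact: uniq_halves.
    move=> [v e] [w e'] /= /allpairsPdep[v' [e1 [_ + [-> ->]]]].
    rewrite mem_halves => /eqP ev'.
    move=> /allpairsPdep[w' [e2 [_ + [-> ->]]]].
    rewrite mem_halves => /eqP ew' /= ee; subst e2.
    by move: ev'; rewrite ew' => -[->].
  by apply/hasPn => e; rewrite mem_filter => /andP[].
have ess e : e \in es.
  by rewrite mem_cat mem_filter mem_enum andbT orbN.
pose l0 : 'I_N -> nat := fun=> 0%N.
transitivity (samp #|Uh| [set: Uh]%SET
    (greedy_value owner omega R Q (map dV vs) l0 0)).
  rewrite -(pairings_samp _ ues ess); congr (_ / _); apply: eq_bigr => f _.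
  rewrite greedy_probE//; last by move=> e v; rewrite inE.
  rewrite cards0 map_cat greedy_value_cat; last first.
    rewrite size_map size_flatten /shape -map_comp; apply: eq_leq; congr sumn.
    by apply: eq_map => v /=; rewrite size_halves.
  rewrite map_flatten -map_comp; congr greedy_value; apply/funext => u.
  rewrite /load; apply/eqP; rewrite cards_eq0; apply/eqP/setP => e.
  by rewrite !inE.
rewrite samp_greedy_scan ?cardsT//; last exact: leq_trans nU.
rewrite -[in LHS](subnKC nU).
rewrite -[RHS](@samp_take _ _ (#|Uh| - n)); last by rewrite cardsT subnK.
apply: eq_samp => rho /and3P[/eqP srho _ _].
rewrite subnKC// in srho.
rewrite -(scan_value_take _ _ _ _ _ _ dn); last by rewrite srho (leq_trans dn).
rewrite (@scan_valueE _ _ _ _ _ _ _ _ _ [::]) ?add0n//.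
  by move=> u; rewrite /= min0n.
by rewrite size_takel ?srho.
Qed.

End Pairing.
End GreedyLaw.

(** * The scan and its noise *)

Section RealSums.
Variable R : realType.

(** Cauchy-Schwarz, from the nonnegativity of the sum of (a_i t - b_i)^2 at t = S / A. *)
Lemma sum_sqr_le (n : nat) (a b : nat -> R) :
  (\sum_(0 <= i < n) a i * b i) ^+ 2 <=
  (\sum_(0 <= i < n) a i ^+ 2) * (\sum_(0 <= i < n) b i ^+ 2).
Proof.
set S := \sum_(0 <= i < n) a i * b i.
set A := \sum_(0 <= i < n) a i ^+ 2; set B := \sum_(0 <= i < n) b i ^+ 2.
have quad t : 0 <= A * t ^+ 2 - 2 * S * t + B.
  have -> : A * t ^+ 2 - 2 * S * t + B = \sum_(0 <= i < n) (a i * t - b i) ^+ 2.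
    rewrite (eq_bigr (fun i => t ^+ 2 * a i ^+ 2 + ((- 2 * t) * (a i * b i) + b i ^+ 2))).
      by rewrite big_split/= big_split/= -!mulr_sumr -/A -/B -/S; ring.
    by move=> i _; ring.
  by apply: sumr_ge0 => i _; exact: sqr_ge0.
have A0 : 0 <= A by apply: sumr_ge0 => i _; exact: sqr_ge0.
have B0 : 0 <= B by apply: sumr_ge0 => i _; exact: sqr_ge0.
have [A00|An0] := eqVneq A 0.
  have [->|Sn0] := eqVneq S 0; first by rewrite expr0n/= mulr_ge0.
  (* With A = 0 the quadratic is affine in t, and at this t it would equal -1. *)
  have := quad ((B + 1) / (2 * S)); rewrite A00 mul0r sub0r.
  have -> : 2 * S * ((B + 1) / (2 * S)) = B + 1 by field; rewrite Sn0.
  lra.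
have Ap : 0 < A by rewrite lt_def An0.
have := quad (S / A).
have -> : A * (S / A) ^+ 2 - 2 * S * (S / A) + B = (A * B - S ^+ 2) / A by field.
by rewrite pmulr_lge0 ?invr_gt0// subr_ge0.
Qed.

End RealSums.

Section Position.
Variables (b : nat -> bool) (D : nat -> nat).

Fixpoint pos t : nat := if t is t'.+1 then step b (D t') (pos t') else 0%N.

Lemma position_mkseq t : position b (mkseq D t) 0 = pos t.
Proof. by elim: t => [//|t IH]; rewrite mkseqS /position foldl_rcons -/(position _ _ _) IH. Qed.

Lemma pos_leS t : (pos t <= pos t.+1)%N.
Proof. exact: step_ge. Qed.

Lemma pos_le s t : (s <= t)%N -> (pos s <= pos t)%N.
Proof.
elim: t => [|t IH]; first by rewrite leqn0 => /eqP ->.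
rewrite leq_eqVlt => /orP[/eqP -> //|]; rewrite ltnS => /IH h.
exact: leq_trans h (pos_leS t).
Qed.

Lemma posS_le t : (pos t.+1 <= pos t + D t)%N.
Proof. exact: step_le. Qed.

Lemma pos_le_sum t : (pos t <= \sum_(0 <= j < t) D j)%N.
Proof.
elim: t => [|t IH]; first by rewrite big_geq.
by rewrite big_nat_recr//= (leq_trans (posS_le t))// leq_add2r.
Qed.

End Position.

Lemma step_local (b b' : nat -> bool) i D x :
  (forall j, (j < i)%N -> b j = b' j) -> (step b D x <= i)%N ->
  step b' D x = step b D x.
Proof.
move=> bb'; elim: D x => [//|D IH] x /=.
case: ifP => bx si; rewrite -bb' ?bx//; first exact: IH.
by rewrite (leq_trans _ si)// step_ge.
Qed.

Lemma pos_local (b b' : nat -> bool) D i t :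
  (forall j, (j < i)%N -> b j = b' j) -> (pos b D t <= i)%N ->
  pos b' D t = pos b D t.
Proof.
move=> bb'; elim: t => [//|t IH] /= si.
have pi : (pos b D t <= i)%N by rewrite (leq_trans _ si)// step_ge.
by rewrite IH// (step_local bb').
Qed.

(** Stopping time property: whether t arrivals have been served within the first i reveals is
    decided by the outcomes of these reveals. *)
Lemma pos_local_le (b b' : nat -> bool) D i t :
  (forall j, (j < i)%N -> b j = b' j) ->
  (pos b D t <= i)%N = (pos b' D t <= i)%N.
Proof.
move=> bb'; apply/idP/idP => h; first by rewrite (pos_local bb').
by rewrite (pos_local _ h)// => j ji; rewrite bb'.
Qed.

Section Blocks.
Variables (R : realType) (D : nat -> nat).
(* [a j y i]: weight of the i-th reveal when it is made for the j-th arrival and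
   the reveals of that arrival start at y *)
Variable a : nat -> nat -> nat -> R.

(** Passes from weights indexed by arrivals to weights indexed by reveals, so that the noise becomes
    a martingale transform. For given i at most one j contributes, the arrival during which the i-th
    reveal is made. *)
Definition block_weight (b : nat -> bool) t i : R :=
  \sum_(0 <= j < t) ((pos b D j <= i) && (i < pos b D j.+1))%N%:R * a j (pos b D j) i.

Definition predictable (C : (nat -> bool) -> nat -> R) :=
  forall i b b', (forall j, (j < i)%N -> b j = b' j) -> C b i = C b' i.

Lemma block_weight_predictable t : predictable (block_weight^~ t).
Proof.
move=> i b b' bb'; apply: eq_bigr => j _.
rewrite (pos_local_le D j bb') ltnNge (pos_local_le D j.+1 bb') -ltnNge.
have [h|_] := boolP (pos b' D j <= i)%N; last by rewrite !mul0r.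
by rewrite (pos_local (b := b') (b' := b) _ h)// => k ki; rewrite bb'.
Qed.

Lemma block_weight_out b t i : (pos b D t <= i)%N -> block_weight b t i = 0.
Proof.
move=> ti; rewrite /block_weight big1_seq// => j; rewrite mem_index_iota => /andP[_ jt].
rewrite ltnNge (leq_trans (pos_le b D jt) ti)/= andbF mul0r//.
Qed.

Lemma sum_block_weight b t n (h : R -> nat -> R) : (pos b D t <= n)%N ->
  (forall i, h 0 i = 0) ->
  \sum_(0 <= i < n) h (block_weight b t i) i =
  \sum_(0 <= j < t) \sum_(pos b D j <= i < pos b D j.+1) h (a j (pos b D j) i) i.
Proof.
move=> tn h0; rewrite (@big_cat_nat _ _ _ (pos b D t))//= [X in _ + X]big1_seq ?addr0; last first.
  by move=> i; rewrite mem_index_iota => /andP[_ /andP[ti _]]; rewrite block_weight_out.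
elim: t {tn} => [|t IH]; first by rewrite !big_geq.
rewrite big_nat_recr//= -IH (@big_cat_nat _ _ _ (pos b D t))//=; last exact: pos_leS.
congr (_ + _).
  apply: eq_big_nat => i /andP[_ it]; congr (h _ _).
  by rewrite [LHS]/block_weight big_nat_recr//= leqNgt it/= mul0r addr0.
apply: eq_big_nat => i /andP[ti it]; congr (h _ _).
by rewrite /block_weight big_nat_recr//= ti it/= mul1r -/(block_weight b t i) block_weight_out// add0r.
Qed.

End Blocks.

Section ExpectedScan.
Variable R : realType.

(* Expected number of reveals for a vertex of degree D when each reveal succeeds
   independently with probability q. *)
Definition psi D (q : R) : R := \sum_(0 <= k < D) (1 - q) ^+ k.

Lemma psiS D q : psi D.+1 q = 1 + (1 - q) * psi D q.
Proof.
rewrite /psi big_nat_recl// expr0 mulr_sumr; congr (_ + _).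
by apply: eq_bigr => k _; rewrite exprS.
Qed.

Lemma psi_ge0 D q : q <= 1 -> 0 <= psi D q.
Proof. by move=> q1; apply: sumr_ge0 => k _; rewrite exprn_ge0// subr_ge0. Qed.

Lemma psi_le D q : 0 <= q <= 1 -> psi D q <= D%:R.
Proof.
move=> /andP[q0 q1]; rewrite /psi big_mkord -[D in leRHS]card_ord -sum1_card natr_sum.
by apply: ler_sum => k _; rewrite exprn_ile1//; lra.
Qed.

(** A pathwise Doob decomposition, valid for every q: a success at a reveal after which k half-edges
    would remain saves the [psi k q] reveals still expected, whence the coefficient of q - b_i. *)
Lemma step_identity (b : nat -> bool) D x (q : R) :
  (step b D x)%:R - x%:R = psi D q +
  \sum_(x <= i < step b D x) psi (D - (i - x)).-1 q * (q - (b i)%:R).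
Proof.
elim: D x => [|D IH] x /=; first by rewrite big_geq// /psi big_geq// subrr addr0.
case: ifP => bx.
  by rewrite big_nat1 subnn subn0 bx psiS /= -natr1; ring.
have sx : (x < step b D x.+1)%N by exact: step_ge.
rewrite big_ltn// subnn subn0 bx psiS /=.
rewrite (_ : _ - _ = 1 + ((step b D x.+1)%:R - x.+1%:R)); last by rewrite -natr1; ring.
rewrite IH; set S1 := \sum_(_ <= _ < _) _; set S2 := \sum_(_ <= _ < _) _.
have -> : S2 = S1.
  apply: eq_big_nat => i /andP[xi _]; rewrite (_ : (D.+1 - (i - x) = D - (i - x.+1))%N)//.
  by lia.
by rewrite /=; ring.
Qed.

End ExpectedScan.

(** * Square-integrable martingales of the success indicators *)

Section Martingale.
Variables (R : realType) (N : nat) (H : finType).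
Variables (grp : H -> option 'I_N) (omega : 'I_N -> nat).

Local Notation hit := (hit grp omega).
Local Notation open_after := (open_after grp omega).
Local Notation sampT n := (samp n [set: H]%SET).

Definition succ_rate (s : seq H) : R :=
  avg (rest [set: H]%SET s) (fun x => (open_after s x)%:R).

Lemma hit_take n (rho : seq H) i : (i < n)%N -> hit (take n rho) i = hit rho i.
Proof.
move=> iN; rewrite /hit take_takel ?(ltnW iN)//.
rewrite -(subnK (ltnW iN)) -take_drop.
have : (0 < n - i)%N by rewrite subn_gt0.
by case: (n - i)%N => // k _; case: (drop i rho).
Qed.

Lemma hit_rcons (s : seq H) x : hit (rcons s x) (size s) = open_after s x.
Proof. by rewrite -cats1 hit_cat. Qed.

Lemma samp_take_le i n (F : seq H -> R) : (i <= n)%N -> (n <= #|H|)%N ->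
  sampT n (fun rho => F (take i rho)) = sampT i F.
Proof.
move=> iN nH; rewrite -[in LHS](subnKC iN) samp_take// cardsT subnK//.
Qed.

(** The increments are orthogonal: given the first i draws, the next success indicator has mean
    [succ_rate], and its centred square is at most 1. *)
Lemma martingale_sqr n (c : seq H -> R) : (n <= #|H|)%N ->
  sampT n (fun rho => (\sum_(0 <= i < n)
     c (take i rho) * (succ_rate (take i rho) - (hit rho i)%:R)) ^+ 2) <=
  sampT n (fun rho => \sum_(0 <= i < n) c (take i rho) ^+ 2).
Proof.
elim: n => [|n IH] nH; first by rewrite /= !big_geq// expr0n.
rewrite !samp_rcons.
pose S s := \sum_(0 <= i < n) c (take i s) * (succ_rate (take i s) - (hit s i)%:R).
apply: (@le_trans _ _ (sampT n (fun s => S s ^+ 2 + c s ^+ 2))); last first.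
  rewrite sampD.
  apply: (le_trans (lerD (IH (ltnW nH)) (lexx _))).
  rewrite -sampD; apply: le_samp => s sP.
  have rs : (0 < #|rest [set: H]%SET s|)%N.
    by rewrite (card_rest sP) cardsT subn_gt0.
  rewrite -[leLHS](avg_cst _ rs); apply: le_avg => x _.
  have ss : size s = n by case/and3P: sP => /eqP.
  rewrite big_nat_recr//= -cats1 take_size_cat// lerD2r.
  rewrite le_eqVlt; apply/orP; left; apply/eqP; apply: eq_big_nat => i /andP[_ iN].
  by rewrite takel_cat// ss ltnW.
apply: le_samp => s sP.
have rs : (0 < #|rest [set: H]%SET s|)%N.
  by rewrite (card_rest sP) cardsT subn_gt0.
have ss : size s = n by case/and3P: sP => /eqP.
(* The square is expanded so that the two halves of the cross term cancel once averaged over the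
   next draw. *)
rewrite (@eq_avg _ _ _ _ (fun x => S s ^+ 2 + ((2 * S s * c s * succ_rate s) +
   (- (2 * S s * c s)) * (open_after s x)%:R +
   c s ^+ 2 * (succ_rate s - (open_after s x)%:R) ^+ 2))); last first.
  move=> x _; rewrite big_nat_recr//=.
  have -> : \sum_(0 <= i < n) c (take i (rcons s x)) *
      (succ_rate (take i (rcons s x)) - (hit (rcons s x) i)%:R) = S s.
    apply: eq_big_nat => i /andP[_ iN]; rewrite -cats1 takel_cat ?ss 1?ltnW//.
    by rewrite -(@hit_take n (s ++ _))// take_size_cat.
  have ts : take n (rcons s x) = s by rewrite -cats1 take_size_cat.
  have hx : hit (rcons s x) n = open_after s x by rewrite -ss hit_rcons.
  by rewrite ts hx; ring.
rewrite !avgD !avgZ !avg_cst// -/(succ_rate s) lerD2l.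
rewrite mulNr subrr add0r -[leRHS]mulr1 ler_wpM2l ?sqr_ge0//.
rewrite -[leRHS](avg_cst 1 rs); apply: le_avg => x _.
have q01 : 0 <= succ_rate s <= 1.
  apply/andP; split.
    by rewrite /succ_rate /avg divr_ge0// sumr_ge0.
  rewrite -[leRHS](avg_cst 1 rs); apply: le_avg => y _.
  by rewrite lern1 leq_b1.
by case: (open_after s x) => /=; nra.
Qed.

(* [qs] is a deterministic guess for the success probabilities. *)
Lemma predictable_sqr n (C : (nat -> bool) -> nat -> R) (qs : nat -> R) (V : R) :
  (n <= #|H|)%N -> predictable C ->
  (forall rho, size rho = n -> \sum_(0 <= i < n) C (hit rho) i ^+ 2 <= V) ->
  sampT n (fun rho => (\sum_(0 <= i < n) C (hit rho) i * (qs i - (hit rho i)%:R)) ^+ 2)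
  <= 2 * V * (1 + \sum_(0 <= i < n) sampT i (fun s => (succ_rate s - qs i) ^+ 2)).
Proof.
move=> nH CP CV.
have CE rho i : C (hit rho) i = C (hit (take i rho)) i.
  by apply: CP => j ji; rewrite hit_take.
pose c s := C (hit s) (size s).
have cE rho i : size rho = n -> (i < n)%N -> C (hit rho) i = c (take i rho).
  by move=> sr iN; rewrite /c size_takel ?sr 1?ltnW// CE.
pose M rho := \sum_(0 <= i < n) c (take i rho) * (succ_rate (take i rho) - (hit rho i)%:R).
pose E rho := \sum_(0 <= i < n) (succ_rate (take i rho) - qs i) ^+ 2.
have V0 : 0 <= V.
  have [rho sr] : exists rho : seq H, size rho = n.
    by exists (take n (enum H)); rewrite size_takel// -cardE.
  by apply: le_trans (CV rho sr); apply: sumr_ge0 => i _; exact: sqr_ge0.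
apply: (@le_trans _ _ (sampT n (fun rho => 2 * M rho ^+ 2 + 2 * V * E rho))).
  apply: le_samp => rho /and3P[/eqP sr _ _].
  (* A martingale minus a bias due to the guess [qs]. The square of the difference is at most twice
     the sum of the squares, and Cauchy-Schwarz bounds that of the bias. *)
  have -> : \sum_(0 <= i < n) C (hit rho) i * (qs i - (hit rho i)%:R) =
      M rho - \sum_(0 <= i < n) C (hit rho) i * (succ_rate (take i rho) - qs i).
    rewrite -sumrB; apply: eq_big_nat => i /andP[_ iN]; rewrite cE//; ring.
  have := sum_sqr_le n (C (hit rho)) (fun i => succ_rate (take i rho) - qs i).
  rewrite -/(E rho); set Z := \sum_(0 <= i < n) _ * _.
  have E0 : 0 <= E rho by apply: sumr_ge0 => i _; exact: sqr_ge0.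
  have := ler_wpM2r E0 (CV rho sr).
  by have := sqr_ge0 (M rho + Z); lra.
rewrite sampD !sampZ mulrDr mulr1; apply: lerD.
  rewrite ler_pM2l//; apply: le_trans (martingale_sqr c nH) _.
  rewrite -[leRHS](@samp_cst _ _ n [set: H]%SET V) ?cardsT//.
  apply: le_samp => rho /and3P[/eqP sr _ _]; apply: le_trans (CV rho sr).
  rewrite le_eqVlt; apply/orP; left; apply/eqP.
  by apply: eq_big_nat => i /andP[_ iN]; rewrite cE.
rewrite samp_sum le_eqVlt; apply/orP; left; apply/eqP; congr (_ * _).
apply: eq_big_nat => i /andP[_ iN].
by rewrite (samp_take_le (fun s => (succ_rate s - qs i) ^+ 2))// ltnW.
Qed.

End Martingale.

(** * Concentration of the success probability *)

Section Bernoulli.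
Variable R : realType.
Implicit Types (f : nat -> R) (g : R).

(* [bern a f g] is the expectation of f (X) for X binomial (a, g). *)
Fixpoint bern a f g : R :=
  if a is a'.+1 then g * bern a' (f \o succn) g + (1 - g) * bern a' f g
  else f 0%N.

Lemma bern_norm_le a f g (c : R) : 0 <= g <= 1 -> (forall k, `|f k| <= c) ->
  `|bern a f g| <= c.
Proof.
move=> g01; elim: a f => [|a IH] f fc //=.
have h1 := IH (f \o succn) (fun k => fc k.+1); have h2 := IH _ fc.
apply: (le_trans (ler_normD _ _)); rewrite !normrM.
have /andP[g0 g1] := g01.
rewrite (ger0_norm g0) (@ger0_norm _ (1 - g)) ?subr_ge0//.
have := ler_wpM2l g0 h1; have := ler_wpM2l (_ : 0 <= 1 - g) h2.
by rewrite subr_ge0 => /(_ g1); lra.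
Qed.

Lemma eq_bern a f f' g : f =1 f' -> bern a f g = bern a f' g.
Proof. by elim: a f f' => [|a IH] f f' ff' //=; rewrite (IH f f')// (IH _ (f' \o succn))// => k /=. Qed.

Lemma bernD a f f' g : bern a (fun k => f k + f' k) g = bern a f g + bern a f' g.
Proof.
elim: a f f' => [|a IH] f f' //=.
rewrite (IH f f') (IH (f \o succn) (f' \o succn)); ring.
Qed.

Lemma bernZ a c f g : bern a (fun k => c * f k) g = c * bern a f g.
Proof.
elim: a f => [|a IH] f //=.
rewrite (IH f) (IH (f \o succn)); ring.
Qed.

Lemma bern_cst a c g : bern a (fun=> c) g = c.
Proof. by elim: a => [|a IH] //=; rewrite (@eq_bern _ _ (fun=> c))// IH; ring. Qed.

Lemma bernB_cst a f c g : bern a (fun k => f k - c) g = bern a f g - c.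
Proof. by rewrite (bernD a f (fun=> - c)) bern_cst. Qed.

End Bernoulli.

Section Hypergeometric.
Variables (R : realType) (H : finType).
Implicit Types (X A B : {set H}) (f : nat -> R).

(** The element [h] belongs to the sample with probability i / #|X|; as [F] ignores the order, it
    can then be put in front. *)
Lemma samp_split1 i X h (F : seq H -> R) : h \in X -> (i <= #|X|)%N ->
  (forall s s', perm_eq s s' -> F s = F s') ->
  samp i X F = i%:R / #|X|%:R * samp i.-1 (X :\ h) (fun s => F (h :: s)) +
    (1 - i%:R / #|X|%:R) * samp i (X :\ h) F.
Proof.
elim: i X F => [|i IH] X F hX iX FP; first by rewrite mul0r mul0r subr0 add0r mul1r.
have cX : #|X| = #|X :\ h|.+1 by rewrite [LHS](cardsD1 h) hX.
set l := #|X :\ h| in cX.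
have l1 : l.+1%:R != 0 :> R by rewrite pnatr_eq0.
rewrite [LHS]/= {1}/avg (bigD1 h)//= cX.
have E x : x \in X -> x != h ->
    samp i (X :\ x) (fun s => F (x :: s)) =
    i%:R / l%:R * samp i.-1 (X :\ h :\ x) (fun s => F (h :: x :: s)) +
    (1 - i%:R / l%:R) * samp i (X :\ h :\ x) (fun s => F (x :: s)).
  move=> xX xh; have cx : #|X :\ x| = l.
    by apply/eqP; rewrite -eqSS -cX [#|X|](cardsD1 x) xX.
  rewrite (IH (X :\ x)); last first.
  - by move=> s s' ss'; apply: FP; rewrite perm_cons.
  - by rewrite cx -ltnS -cX.
  - by rewrite !inE hX eq_sym xh.
  rewrite cx finset.setDDl finset.setUC -finset.setDDl; congr (_ * _ + _).
  by apply: eq_samp => s _; apply: FP; apply/permP => P /=; lia.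
rewrite (eq_bigr _ (fun x h => E x (andP h).1 (andP h).2)).
under eq_bigl do rewrite andbC -in_setD1.
rewrite big_split/= -!mulr_sumr.
have [l0|lp] := posnP l.
  have -> : i = 0%N by move: iX; rewrite cX l0; case: (i).
  have /eqP X0 : X :\ h == finset.set0 by rewrite -cards_eq0 -/l l0.
  rewrite X0 !big_set0 !mulr0 !addr0 l0 /= /avg big_set0 mul0r mulr0 addr0.
  by rewrite !divr1 mul1r.
have lR : l%:R != 0 :> R by rewrite pnatr_eq0 -lt0n.
have -> : \sum_(x in X :\ h) samp i (X :\ h :\ x) (fun s => F (x :: s)) =
    l%:R * samp i.+1 (X :\ h) F by rewrite /= /avg -/l mulrC divfK.
have [i0|ip] := posnP i.
  by rewrite i0 /= !mul0r add0r subr0 mul1r -!natr1 in l1 *; field.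
have -> : \sum_(x in X :\ h) samp i.-1 (X :\ h :\ x) (fun s => F (h :: x :: s)) =
    l%:R * samp i (X :\ h) (fun s => F (h :: s)).
  by case: (i) ip => // i' _ /=; rewrite /avg -/l mulrC divfK.
by rewrite /= -!natr1 in l1 *; field; apply/andP.
Qed.

Lemma count_setD1 A h (s : seq H) : h \notin s ->
  count (mem (A :\ h)) s = count (mem A) s.
Proof.
move=> hs; apply: eq_in_count => y ys; rewrite !inE.
by case: eqP => // yh; rewrite -yh ys in hs.
Qed.

(** The membership of the elements of [A] and [B] is decided one at a time by [samp_split1]. Each
    decision has probability i'/l' for slightly reduced sample and population sizes, and replacing
    it by g costs at most 2 d because [f] and [f'] are bounded by 1. *)
Lemma samp_bern_le i X A B f f' (g d : R) :
  0 <= g <= 1 -> 0 <= d ->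
  (forall k, `|f k| <= 1) -> (forall k, `|f' k| <= 1) ->
  A \subset X -> B \subset X -> disjoint (mem (A)) (mem B) ->
  (i + (#|A| + #|B|) <= #|X|)%N ->
  (forall i' l', (i' <= i <= i' + (#|A| + #|B|))%N ->
     (l' <= #|X| <= l' + (#|A| + #|B|))%N -> `|i'%:R / l'%:R - g| <= d) ->
  `|samp i X (fun s => f (count (mem A) s) * f' (count (mem B) s)) -
    bern #|A| f g * bern #|B| f' g| <= 2 * (#|A| + #|B|)%:R * d.
Proof.
move=> g01 d0; have [a aE] : exists a, a = (#|A| + #|B|)%N by eexists.
elim: a i X A B f f' aE => [|a IH] i X A B f f' aE f1 f'1 AX BX AB iX gd.
  have /eqP A0 : A == finset.set0 by rewrite -cards_eq0; move/esym/eqP: aE; rewrite addn_eq0 => /andP[].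
  have /eqP B0 : B == finset.set0 by rewrite -cards_eq0; move/esym/eqP: aE; rewrite addn_eq0 => /andP[].
  rewrite A0 B0 cards0 /=.
  rewrite (@eq_samp _ _ _ _ _ (fun=> f 0%N * f' 0%N)); last first.
    by move=> s _; congr (f _ * f' _); rewrite -[RHS](count_pred0 s);
       apply: eq_count => y; rewrite /= !inE.
  by rewrite samp_cst ?subrr ?normr0 ?mulr_ge0//; apply: leq_trans iX; rewrite leq_addr.
wlog A0 : A B f f' aE f1 f'1 AX BX AB iX gd / (0 < #|A|)%N.
  move=> W; have [A0|//] := posnP #|A|; last exact: W.
  have := W B A f' f; rewrite [(#|B| + #|A|)%N]addnC.
  move=> /(_ aE f'1 f1 BX AX); rewrite disjoint_sym => /(_ AB iX gd).
  rewrite [bern #|B| _ _ * _]mulrC.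
  rewrite (@eq_samp _ _ _ _ _ (fun s => f (count (mem A) s) * f' (count (mem B) s))).
    by apply; move: aE; rewrite A0 add0n => <-.
  by move=> s _; rewrite mulrC.
have [h hA] : exists h, h \in A by apply/card_gt0P.
have hX : h \in X by apply: (fintype.subsetP AX).
have hB : h \notin B by rewrite (disjointFr AB).
have cA : #|A| = #|A :\ h|.+1 by rewrite [LHS](cardsD1 h) hA.
have cX : #|X| = #|X :\ h|.+1 by rewrite [LHS](cardsD1 h) hX.
set F := fun s => f (count (mem A) s) * f' (count (mem B) s).
rewrite (samp_split1 hX); last first.
- by move=> s s' /permP ss'; rewrite /F !ss'.
- exact: leq_trans (leq_addr _ _) iX.
have aE' : (#|A :\ h| + #|B| = a)%N by move: aE; rewrite cA addSn => -[].
have iX' : (i + a <= #|X :\ h|)%N by move: iX; rewrite -aE cX addnS ltnS.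
rewrite -aE cX in gd.
have B' : B \subset X :\ h.
  by rewrite subsetD1 BX.
have A' : A :\ h \subset X :\ h by rewrite finset.setSD.
have AB' : disjoint (mem (A :\ h)) (mem B).
  by apply: disjointWl AB; rewrite subD1set.
have S0 : `|samp i (X :\ h) F - bern #|A :\ h| f g * bern #|B| f' g| <=
    2 * a%:R * d.
  have := IH i (X :\ h) (A :\ h) B f f'.
  rewrite aE'.
  move=> /(_ erefl f1 f'1 A' B' AB').
  rewrite (@eq_samp _ _ _ _ F (fun s => f (count (mem (A :\ h)) s) * f' (count (mem B) s))).
    apply=> // i' l' hi hl; apply: gd; clear -hi hl; lia.
  move=> s /and3P[_ _ /allP sX]; rewrite count_setD1//.
  by apply/negP => /sX; rewrite !inE eqxx.
set p := i%:R / #|X|%:R.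
have p01 : 0 <= p <= 1.
  rewrite divr_ge0//= ler_pdivrMr ?ltr0n ?cX// mul1r ler_nat -cX.
  exact: leq_trans (leq_addr _ _) iX.
have pg : `|p - g| <= d by rewrite /p cX; apply: gd; rewrite leqnn leq_addr.
have S1 : p * `|samp i.-1 (X :\ h) (fun s => F (h :: s)) -
      bern #|A :\ h| (f \o succn) g * bern #|B| f' g| <= p * (2 * a%:R * d).
  have [i0|ip] := posnP i; first by rewrite /p i0 !mul0r.
  rewrite ler_wpM2l//; first by case/andP: p01.
  have := IH i.-1 (X :\ h) (A :\ h) B (f \o succn) f'.
  rewrite aE'.
  move=> /(_ erefl (fun k => f1 k.+1) f'1 A' B' AB').
  rewrite (@eq_samp _ _ _ _ (fun s => F (h :: s))
     (fun s => (f \o succn) (count (mem (A :\ h)) s) * f' (count (mem B) s))).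
    apply=> // [|i' l' hi hl].
      by apply: leq_trans iX'; rewrite leq_add2r leq_pred.
    by apply: gd; clear -hi hl ip; lia.
  move=> s /and3P[_ _ /allP sX]; rewrite count_setD1; last first.
    by apply/negP => /sX; rewrite !inE eqxx.
  by rewrite /F /= hA (negbTE hB).
clearbody p; rewrite cA [bern _.+1 _ _]/=.
move: S0 S1; set s0 := samp _ _ _; set s1 := samp _ _ _.
set b1 := bern _ (f \o succn) g; set b0 := bern _ f g; set b' := bern _ f' g.
have nb1 : `|b1| <= 1 by apply: bern_norm_le => // k; exact: f1.
have nb0 : `|b0| <= 1 by apply: bern_norm_le.
have nb' : `|b'| <= 1 by apply: bern_norm_le.
move=> S0 S1.
have -> : p * s1 + (1 - p) * s0 - (g * b1 + (1 - g) * b0) * b' =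
  p * (s1 - b1 * b') + (1 - p) * (s0 - b0 * b') + (p - g) * ((b1 - b0) * b') by ring.
have /andP[p0 p1] := p01.
apply: (le_trans (ler_normD _ _)).
have T1 : `|p * (s1 - b1 * b') + (1 - p) * (s0 - b0 * b')| <= 2 * a%:R * d.
  apply: (le_trans (ler_normD _ _)); rewrite !normrM (ger0_norm p0).
  rewrite (ger0_norm (_ : 0 <= 1 - p)) ?subr_ge0//.
  have := ler_wpM2l (_ : 0 <= 1 - p) S0; rewrite subr_ge0 => /(_ p1); lra.
have T2 : `|(p - g) * ((b1 - b0) * b')| <= 2 * d.
  rewrite !normrM mulrC ler_pM ?mulr_ge0//.
  have : `|b1 - b0| <= 2 by apply: (le_trans (ler_normB _ _)); lra.
  by move=> ?; rewrite -[leRHS]mulr1 ler_pM.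
rewrite addSn aE'.
by rewrite -natr1; lra.
Qed.

End Hypergeometric.

(** * Second moment of the success rate *)

Section Concentration.
Variables (R : realType) (N : nat) (H : finType).
Variables (grp : H -> option 'I_N) (omega : 'I_N -> nat).
Implicit Types (h : H) (s : seq H).

Definition siblings h : {set H} :=
  if grp h is Some u then [set y | (y != h) && (grp y == Some u)]%SET
  else finset.set0.

Definition cap_of h : nat := if grp h is Some u then omega u else 0%N.

(** Probability that the owner of [h] has capacity left if each other half-edge of this owner is
    revealed independently with probability g. A half-edge of the auxiliary vertex has capacity 0
    and is never open. *)
Definition open_prob h (g : R) : R :=
  bern #|siblings h| (fun k => (k < cap_of h)%N%:R) g.

Definition mean_open (g : R) : R := avg [set: H]%SET (open_prob^~ g).

Lemma open_afterE s h : h \notin s ->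
  open_after grp omega s h = (count (mem (siblings h)) s < cap_of h)%N.
Proof.
rewrite /open_after /siblings /cap_of => hs; case: (grp h) => [u|] //.
congr (_ < _)%N; apply: eq_in_count => y ys; rewrite !inE.
by case: (eqVneq y h) => [yh|//]; rewrite yh (negbTE hs) in ys.
Qed.

Lemma avg_pairs (Y : {set H}) (y : H -> R) : (1 < #|Y|)%N ->
  avg Y (fun h => avg (Y :\ h) (fun h' => y h * y h')) =
  ((\sum_(h in Y) y h) ^+ 2 - \sum_(h in Y) y h ^+ 2) / (#|Y|%:R * (#|Y|%:R - 1)).
Proof.
move=> Y1; rewrite /avg.
have cE x : x \in Y -> #|Y :\ x|%:R = #|Y|%:R - 1 :> R.
  by move=> xY; rewrite (cardsD1 x Y) xY add1n -natr1 addrK.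
rewrite (eq_bigr (fun h => y h * (\sum_(h' in Y) y h' - y h) / (#|Y|%:R - 1))); last first.
  move=> h hY; rewrite cE// -mulr_sumr; congr (_ * _ / _).
  rewrite [in RHS](big_setD1 h)//=; ring.
rewrite -mulr_suml (eq_bigr (fun h => y h * (\sum_(h' in Y) y h') - y h ^+ 2)).
  by rewrite sumrB -mulr_suml -expr2 invfM; ring.
by move=> h _; ring.
Qed.

(** Averaging over pairs of distinct elements drops the diagonal and changes the normalisation, at a
    cost of order 1 / #|Y| for bounded [y]. *)
Lemma avg_sqr_le (Y : {set H}) (y : H -> R) : (1 < #|Y|)%N ->
  (forall h, `|y h| <= 1) ->
  avg Y y ^+ 2 <= avg Y (fun h => avg (Y :\ h) (fun h' => y h * y h')) + 2 / #|Y|%:R.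
Proof.
move=> Y1 y1; rewrite avg_pairs// /avg.
set S := \sum_(h in Y) y h; set Q := \sum_(h in Y) _.
have M2 : 2 <= #|Y|%:R :> R by rewrite ler_nat.
have QM : Q <= #|Y|%:R.
  rewrite -sum1_card natr_sum; apply: ler_sum => h _.
  by rewrite -real_normK ?num_real// exprn_ile1.
move: M2 QM; set M := #|Y|%:R => M2 QM.
have -> : (S ^+ 2 - Q) / (M * (M - 1)) + 2 / M = (S / M) ^+ 2 +
  (S ^+ 2 - M * Q + 2 * M * (M - 1)) / (M ^+ 2 * (M - 1)).
  by field; apply/andP; split; lra.
rewrite lerDl divr_ge0//; last by rewrite mulr_ge0 ?sqr_ge0//; lra.
have := ler_wpM2l (_ : 0 <= M) QM; have := sqr_ge0 S; nra.
Qed.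

Lemma avg_pairs_le (Y : {set H}) (y : H -> R) : (1 < #|Y|)%N ->
  (forall h, `|y h| <= 1) ->
  avg Y (fun h => avg (Y :\ h) (fun h' => y h * y h')) <= avg Y y ^+ 2 + 2 / #|Y|%:R.
Proof.
move=> Y1 y1; rewrite avg_pairs// /avg.
set S := \sum_(h in Y) y h; set Q := \sum_(h in Y) _.
have M2 : 2 <= #|Y|%:R :> R by rewrite ler_nat.
have Q0 : 0 <= Q by apply: sumr_ge0 => h _; exact: sqr_ge0.
have SM : `|S| <= #|Y|%:R.
  apply: (le_trans (ler_norm_sum _ _ _)).
  by rewrite -sum1_card natr_sum; apply: ler_sum.
have S2 : S ^+ 2 <= #|Y|%:R ^+ 2.
  by rewrite -(real_normK (num_real S)) lerXn2r ?nnegrE.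
move: M2 S2 {SM}; set M := #|Y|%:R => M2 S2.
have -> : (S / M) ^+ 2 + 2 / M = (S ^+ 2 - Q) / (M * (M - 1)) +
  (M * Q - S ^+ 2 + 2 * M * (M - 1)) / (M ^+ 2 * (M - 1)).
  by field; apply/andP; split; lra.
rewrite lerDl divr_ge0//; last by rewrite mulr_ge0 ?sqr_ge0//; lra.
have : 0 <= M * Q by rewrite mulr_ge0//; lra.
nra.
Qed.

Definition centered (k : R) s h : R := (open_after grp omega s h)%:R - k.

(** With different owners the sibling sets are disjoint and [samp_bern_le] gives approximate
    independence. The other cases follow from the trivial bound 2 on the difference: it is the
    indicator term when [h] and [h'] are siblings, and it is below the last term when there are many
    siblings or few unrevealed half-edges. *)
Lemma open_pair_le i (k : R) h h' : (i + 2 <= #|H|)%N -> 0 <= k <= 1 -> h' != h ->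
  samp i ([set: H]%SET :\ h :\ h') (fun s => centered k s h * centered k s h') <=
  (open_prob h (i%:R / #|H|%:R) - k) * (open_prob h' (i%:R / #|H|%:R) - k) + 2 * (h' \in siblings h)%:R +
  4 * (#|siblings h| + #|siblings h'| + 2)%:R ^+ 2 / (#|H| - i)%:R.
Proof.
move=> iH k01 hh'; set g := i%:R / _; pose y := centered k.
rewrite -/y.
set X := _ :\ h'.
have cX : #|X| = (#|H| - 2)%N.
  have c1 : #|H| = #|[set: H]%SET :\ h|.+1 by rewrite -cardsT [LHS](cardsD1 h) inE.
  have c2 : #|[set: H]%SET :\ h| = #|X|.+1 by rewrite [LHS](cardsD1 h') !inE hh'.
  by rewrite c1 c2 subn2.
have M2 : 2 <= (#|H| - i)%:R :> R by rewrite ler_nat; lia.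
have L0 : 0 < #|H|%:R :> R by rewrite ltr0n; lia.
have g01 : 0 <= g <= 1.
  rewrite divr_ge0//= ler_pdivrMr// mul1r ler_nat; lia.
have yb (b : bool) : `|b%:R - k| <= 1 by case: b => /=; rewrite ler_norml; lra.
set a := (#|siblings h| + #|siblings h'|)%N.
set E := 4 * _ / _.
have E0 : 0 <= E by rewrite divr_ge0// mulr_ge0// exprn_ge0.
have ob h0 : `|open_prob h0 g - k| <= 1.
  rewrite /open_prob -bernB_cst; apply: bern_norm_le => // j.
have triv : samp i X (fun s => y s h * y s h') <= 1.
  rewrite -[leRHS](@samp_cst R _ i X 1); last by rewrite cX; lia.
  apply: le_samp => s _; apply: (le_trans (ler_norm _)).
  by rewrite normrM mulr_ile1 ?yb.
have triv' : -1 <= (open_prob h g - k) * (open_prob h' g - k).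
  have : `|(open_prob h g - k) * (open_prob h' g - k)| <= 1 by rewrite normrM mulr_ile1 ?ob.
  by rewrite ler_norml => /andP[].
have [sib|nsib] := boolP (h' \in siblings h); first by move=> /=; lra.
rewrite mulr0 addr0.
have big_case : 2 <= E -> samp i X (fun s => y s h * y s h') <=
    (open_prob h g - k) * (open_prob h' g - k) + E by lra.
have [aL|aL] := leqP (2 * (a + 2)) #|H|; last first.
  apply: big_case; rewrite /E ler_pdivlMr; last lra.
  have h1 : (#|H| - i)%:R <= 2 * (a + 2)%:R :> R.
    by rewrite -natrM ler_nat (leq_trans (leq_subr _ _))// ltnW.
  have h2 : 2 <= (a + 2)%:R :> R by rewrite ler_nat addn2.
  by rewrite expr2; nra.
have [iaL|iaL] := leqP (i + a + 2) #|H|; last first.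
  apply: big_case; rewrite /E ler_pdivlMr; last lra.
  have h1 : (#|H| - i)%:R <= (a + 2)%:R :> R.
    by rewrite ler_nat leq_subLR addnA ltnW.
  have h2 : 2 <= (a + 2)%:R :> R by rewrite ler_nat addn2.
  by rewrite expr2; nra.
have subX h0 : h0 \in [:: h; h'] -> siblings h0 \subset X.
  move=> h0P; apply/fintype.subsetP => z; rewrite /X !inE andbT.
  have hin : h \notin siblings h by rewrite /siblings; case: (grp h) => [u|]; rewrite !inE ?eqxx.
  have hin' : h' \notin siblings h' by rewrite /siblings; case: (grp h') => [u|]; rewrite !inE ?eqxx.
  have hn : h \notin siblings h'.
    apply: contra nsib; rewrite /siblings; case E1: (grp h') => [u|]; rewrite !inE//.
    by move=> /andP[_ /eqP ->]; rewrite inE hh' E1 eqxx.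
  move: h0P; rewrite !inE => /orP[] /eqP -> zs; apply/andP; split; apply: contraTneq zs => -> //.
have dis : disjoint (mem (siblings h)) (mem (siblings h')).
  rewrite disjoint_subset; apply/fintype.subsetP => z zh; rewrite !inE.
  apply: contra nsib => zh'; move: zh zh'; rewrite /siblings.
  case E1: (grp h) => [u|]; rewrite !inE// => /andP[_ /eqP zu].
  case E2: (grp h') => [v|]; rewrite !inE// zu => /andP[_ uv].
  by rewrite hh' eq_sym.
(* Lowering i by at most a and #|H| by at most a + 2 moves the ratio i / #|H| by at most this much,
   since the reduced population still has at least #|H| / 2 elements. *)
pose d : R := 2 * (a + 2)%:R / #|H|%:R.
have key := @samp_bern_le R H i X (siblings h) (siblings h')
  (fun j => (j < cap_of h)%N%:R - k) (fun j => (j < cap_of h')%N%:R - k) g d g01.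
rewrite -/a in key.
have d0 : 0 <= d by rewrite divr_ge0// mulr_ge0.
have := key d0 (fun=> yb _) (fun=> yb _) (subX h _) (subX h' _) dis.
rewrite !inE !eqxx orbT cX => /(_ isT isT); rewrite !bernB_cst.
rewrite -/(open_prob h g) -/(open_prob h' g).
have -> : samp i X (fun s => ((count (mem (siblings h)) s < cap_of h)%N%:R - k) *
     ((count (mem (siblings h')) s < cap_of h')%N%:R - k)) =
  samp i X (fun s => y s h * y s h').
  apply: eq_samp => s /and3P[_ _ /allP sX].
  rewrite /y /centered !open_afterE//.
    by apply/negP => /sX; rewrite !inE eqxx.
  by apply/negP => /sX; rewrite !inE eqxx /= andbF.
move=> W; have H2 : (2 <= #|H|)%N by apply: leq_trans iH; rewrite leq_addl.
have W1 : (i + a <= #|H| - 2)%N by rewrite -(leq_add2r 2) subnK.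
have W2 i' l' : (i' <= i <= i' + a)%N -> (#|H| - 2 >= l')%N && (#|H| - 2 <= l' + a)%N ->
    `|i'%:R / l'%:R - g| <= d.
  move=> /andP[i1 i2] /andP[l1 l2].
  have l2' : (#|H| <= l' + (a + 2))%N by move: l2; rewrite -(leq_add2r 2) subnK// addnA.
  have l1' : (l' <= #|H|)%N by rewrite (leq_trans l1)// leq_subr.
  have iR : i%:R <= #|H|%:R :> R.
    by rewrite ler_nat (leq_trans _ iH)// leq_addr.
  have i'i : i'%:R <= i%:R :> R by rewrite ler_nat.
  have ii' : i%:R <= i'%:R + a%:R :> R by rewrite -natrD ler_nat.
  have lL : l'%:R <= #|H|%:R :> R by rewrite ler_nat.
  have Ll : #|H|%:R <= l'%:R + (a + 2)%:R :> R by rewrite -natrD ler_nat.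
  have hl : #|H|%:R <= 2 * l'%:R :> R.
    by rewrite -natrM ler_nat; clear -aL l2'; lia.
  have i'0 : 0 <= i'%:R :> R by [].
  have l'0 : 0 < l'%:R :> R by clear -L0 hl; lra.
  have a2 : (a + 2)%:R = a%:R + 2 :> R by rewrite natrD.
  have a0 : 0 <= a%:R :> R by [].
  rewrite /d /g ler_norml -mulNr; apply/andP; split.
    rewrite lerBrDl -mulrDl ler_pdivrMr// mulrAC ler_pdivlMr//.
    rewrite a2 in Ll *.
    nra.
  rewrite lerBlDl -mulrDl ler_pdivlMr// mulrAC ler_pdivrMr//.
  rewrite a2 in Ll *.
  nra.
have {W} := W W1 W2.
rewrite ler_norml => /andP[_]; rewrite lerBlDl => /le_trans; apply.
rewrite lerD2l /d /E.
have Mle : (#|H| - i)%:R <= #|H|%:R :> R by rewrite ler_nat leq_subr.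
have a2 : (a + 2)%:R = a%:R + 2 :> R by rewrite natrD.
have a0 : 0 <= a%:R :> R by [].
rewrite (_ : 2 * a%:R * _ = 4 * (a%:R * (a + 2)%:R) / #|H|%:R); last by field; lra.
rewrite ler_pdivrMr// mulrAC ler_pdivlMr; last lra.
rewrite a2.
have p1 : 0 <= a%:R * (a%:R + 2) :> R by rewrite mulr_ge0//; lra.
have p2 : a%:R * (a%:R + 2) <= (a%:R + 2) ^+ 2 :> R by rewrite expr2; nra.
by apply: ler_pM; lra.
Qed.

(** The squared deviation is an average over pairs of unrevealed half-edges; by [samp_avg], used
    twice, the pair may be drawn before the sample, and [open_pair_le] applies. The constant is 24 =
    2 + 2 + 4 + 16: two removals of the diagonal, the sibling pairs, and the comparison error. *)
Lemma succ_rate_concentration i (k : R) : (i + 2 <= #|H|)%N -> 0 <= k <= 1 ->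
  samp i [set: H]%SET (fun s => (succ_rate R grp omega s - k) ^+ 2) <=
  (mean_open (i%:R / #|H|%:R) - k) ^+ 2 +
  24 / (#|H| - i)%:R * avg [set: H]%SET (fun h => (#|siblings h|.+1)%:R ^+ 2).
Proof.
move=> iH k01; set g := i%:R / #|H|%:R.
set M : R := (#|H| - i)%:R; set S := avg _ (fun h => _ ^+ 2).
pose y := centered k.
have M2 : 2 <= M by rewrite ler_nat; lia.
have HT : (1 < #|[set: H]%SET|)%N by rewrite cardsT; lia.
have yb s h : `|y s h| <= 1 by rewrite /y /centered; case: open_after => /=; rewrite ler_norml; lra.
have g01 : 0 <= g <= 1.
  rewrite divr_ge0//= ler_pdivrMr ?mul1r ?ler_nat ?ltr0n; lia.
pose z h := open_prob h g - k.
have zb h : `|z h| <= 1.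
  rewrite /z /open_prob -bernB_cst; apply: bern_norm_le => // j.
  by case: (j < _)%N => /=; rewrite ler_norml; lra.
apply: (@le_trans _ _ (samp i [set: H]%SET (fun s => avg (rest [set: H]%SET s) (fun h =>
    avg (rest ([set: H]%SET :\ h) s) (fun h' => y s h * y s h'))) + 2 / M)).
  rewrite -(@samp_cst R _ i [set: H]%SET (2 / M)) ?cardsT; last by lia.
  rewrite -sampD; apply: le_samp => s sP.
  have cs : #|rest [set: H]%SET s| = (#|H| - i)%N by rewrite (card_rest sP) cardsT.
  have s1 : (1 < #|rest [set: H]%SET s|)%N by rewrite cs; lia.
  have -> : succ_rate R grp omega s - k = avg (rest [set: H]%SET s) (y s).
    by rewrite avgD -/(succ_rate R grp omega s) avg_cst// ltnW.
  apply: (le_trans (avg_sqr_le s1 (yb s))); rewrite cs lerD2r.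
  rewrite le_eqVlt; apply/orP; left; apply/eqP; apply: eq_avg => h hs.
  congr (avg _ _); apply/setP => x; rewrite !inE; by rewrite andbT.
rewrite samp_avg.
under eq_avg => h _ do rewrite samp_avg.
set a2 := fun h => (#|siblings h|.+1)%:R ^+ 2 : R.
have S1 : 1 <= S.
  rewrite -[leLHS](@avg_cst R _ [set: H]%SET 1); last by rewrite ltnW.
  apply: le_avg => h _; rewrite exprn_ege1// ler1n//.
have step1 : avg [set: H]%SET (fun h => avg ([set: H]%SET :\ h) (fun h' =>
     samp i ([set: H]%SET :\ h :\ h') (fun s => y s h * y s h'))) <=
   avg [set: H]%SET (fun h => avg ([set: H]%SET :\ h) (fun h' =>
     z h * z h' + (2 * (h' \in siblings h)%:R + 8 / M * (a2 h + a2 h')))).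
  apply: le_avg => h _; apply: le_avg => h'; rewrite !inE andbT => h'h.
  apply: le_trans (open_pair_le iH k01 h'h) _; rewrite -addrA lerD2l lerD2l.
  rewrite -/M (_ : 8 / M * (a2 h + a2 h') = 8 * (a2 h + a2 h') / M); last by ring.
  rewrite ler_pM2r ?invr_gt0; last by apply: lt_le_trans M2.
  rewrite /a2 natrD natrD -!natr1; set u := #|_|%:R; set v := #|_|%:R.
  have := sqr_ge0 (u - v); nra.
apply: (le_trans (lerD step1 (lexx _))).
have cD h : #|[set: H]%SET :\ h| = #|H|.-1.
  by rewrite -cardsT [in RHS](cardsD1 h) inE.
have D0 h : (0 < #|[set: H]%SET :\ h|)%N by rewrite cD; lia.
have a2avg : avg [set: H]%SET (fun h => avg ([set: H]%SET :\ h) (fun h' => a2 h + a2 h')) = 2 * S.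
  under eq_avg => h _ do rewrite avgD avg_cst//.
  rewrite avgD (avg_swap _ (fun h h' => a2 h')).
  under [X in _ + X]eq_avg => h _ do rewrite avg_cst//.
  by rewrite -/S mulr2n mulrDl mul1r.
have sibavg : avg [set: H]%SET (fun h => avg ([set: H]%SET :\ h)
    (fun h' => (h' \in siblings h)%:R : R)) <= 2 * S / M.
  rewrite (_ : 2 * S / M = 2 / M * S); last by ring.
  rewrite -avgZ; apply: le_avg => h _; rewrite /avg cD.
  have -> : \sum_(x in [set: H]%SET :\ h) (x \in siblings h)%:R = #|siblings h|%:R :> R.
    rewrite -sum1_card natr_sum [LHS]big_mkcond [RHS]big_mkcond /=.
    apply: eq_bigr => x _; rewrite !inE andbT; case: eqP => [->|_] /=; last by case: (_ \in _).
    by rewrite /siblings; case: (grp h) => [u|]; rewrite !inE ?eqxx.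
  have L1 : M <= 2 * #|H|.-1%:R :> R by rewrite -natrM ler_nat; lia.
  have L0 : 0 < #|H|.-1%:R :> R by lra.
  have : #|siblings h|%:R <= #|siblings h|.+1%:R ^+ 2 :> R.
    by rewrite -natrX ler_nat; clear; nia.
  set u := #|siblings h|%:R; set v := _ ^+ 2 => uv.
  have u0 : 0 <= u by [].
  rewrite (_ : 2 / M * v = 2 * v / M); last by ring.
  rewrite ler_pdivrMr// mulrAC ler_pdivlMr; last by apply: lt_le_trans M2.
  rewrite (_ : 2 * v * _ = v * (2 * #|H|.-1%:R)); last by ring.
  by rewrite ler_pM//; apply: le_trans M2.
under eq_avg => h _ do rewrite avgD.
rewrite avgD.
have zz := avg_pairs_le HT zb.
have -> : mean_open g - k = avg [set: H]%SET z.
  by rewrite avgD -/(mean_open g) avg_cst// ltnW.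
under [X in _ + X + _]eq_avg => h _ do rewrite avgD !avgZ.
rewrite avgD !avgZ a2avg.
have LM : 2 / #|[set: H]%SET|%:R <= 2 / M.
  by rewrite ler_pM2l// lef_pV2 ?posrE ?ltr0n ?cardsT ?ler_nat ?leq_subr//; lra || lia.
have SM : 1 / M <= S / M by rewrite ler_pM2r// invr_gt0; lra.
rewrite -(mulrA 8) -[24 / M * S]mulrA.
move: zz LM SM sibavg; rewrite -[2 * S / M]mulrA -(mulrC S M^-1).
rewrite (_ : M^-1 * (2 * S) = 2 * (S / M)); last by ring.
rewrite (_ : 2 / M = 2 * (1 / M)); last by ring.
lra.
Qed.

End Concentration.

(** * Expectations under a sub-Gaussian law *)

Section DiscreteExpectation.
Variables (R : realType) (pi : probability nat R).

Local Notation a := (prob_at pi).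

Lemma prob_at_ge0 k : 0 <= a k.
Proof. by rewrite /prob_at fine_ge0. Qed.

Lemma prob_atE k : (a k)%:E = pi [set k].
Proof. by rewrite /prob_at fineK// fin_num_measure. Qed.

Lemma integral_nat (f : nat -> R) : (forall k, 0 <= f k) ->
  (\int[pi]_k (f k)%:E = \sum_(0 <= k <oo) (a k * f k)%:E)%E.
Proof.
move=> f0.
have -> : [set: nat] = \bigcup_k [set k] by apply/seteqP; split => // k _; exists k.
rewrite ge0_integral_bigcup//.
- apply: eq_eseriesr => k _.
  rewrite (eq_integral (cst (f k)%:E)); last by move=> x; rewrite inE => ->.
  by rewrite integral_cst// EFinM prob_atE muleC.
- by move=> x _; rewrite lee_fin.
- by move=> i j _ _ [x [/= -> ->]].
Qed.

(** Real-valued and meant for signed functions as well; the growth condition [expb] below provides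
    absolute convergence. *)
Definition EX (f : nat -> R) : R := limn (series (fun k => a k * f k)).

(* Exponential growth: the functions that every sub-Gaussian law integrates. *)
Definition expb (f : nat -> R) : Prop :=
  exists A r : R, [/\ 0 <= A, 1 <= r & forall k, `|f k| <= A * r ^+ k].

Lemma expb_le f g : (forall k, `|f k| <= `|g k|) -> expb g -> expb f.
Proof.
move=> fg [A [r [A0 r1 H]]]; exists A, r; split => // k.
exact: le_trans (fg k) (H k).
Qed.

Lemma expb_cst c : expb (fun=> c).
Proof. by exists `|c|, 1; split => // k; rewrite expr1n mulr1. Qed.

Lemma expb_pow x : expb (fun k => x ^+ k).
Proof.
exists 1, (1 + `|x|); split => // [|k]; first by rewrite lerDl.
by rewrite mul1r normrX lerXn2r ?nnegrE ?addr_ge0// lerDr.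
Qed.

Lemma expb_natr : expb (fun k => k%:R).
Proof.
exists 1, 2; split => // [|k]; first by rewrite ler1n.
by rewrite mul1r normr_nat -natrX ler_nat ltnW// ltn_expl.
Qed.

Lemma expbD f g : expb f -> expb g -> expb (fun k => f k + g k).
Proof.
move=> [A [r [A0 r1 Hf]]] [B [s [B0 s1 Hg]]].
exists (A + B), (r * s); split; rewrite ?addr_ge0//.
  by rewrite -[1]mulr1 ler_pM.
move=> k; apply: (le_trans (ler_normD _ _)).
have rk : 1 <= r ^+ k by apply: exprn_ege1.
have sk : 1 <= s ^+ k by apply: exprn_ege1.
rewrite mulrDl exprMn; apply: lerD.
  apply: (le_trans (Hf k)); rewrite ler_wpM2l// ler_peMr//; exact: le_trans rk.
apply: (le_trans (Hg k)); rewrite ler_wpM2l// ler_peMl//; exact: le_trans sk.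
Qed.

Lemma expbM f g : expb f -> expb g -> expb (fun k => f k * g k).
Proof.
move=> [A [r [A0 r1 Hf]]] [B [s [B0 s1 Hg]]].
exists (A * B), (r * s); split; rewrite ?mulr_ge0//.
  by rewrite -[1]mulr1 ler_pM.
by move=> k; rewrite normrM exprMn mulrACA ler_pM.
Qed.

Lemma expb_sum (I : Type) (s : seq I) (P : pred I) (f : I -> nat -> R) :
  (forall i, P i -> expb (f i)) -> expb (fun k => \sum_(i <- s | P i) f i k).
Proof.
move=> H; elim: s => [|i s IH].
  by apply: expb_le (expb_cst 0) => k; rewrite big_nil.
have [Pi|nPi] := boolP (P i).
  apply: expb_le (expbD (H i Pi) IH) => k; by rewrite big_cons Pi.
by apply: expb_le IH => k; rewrite big_cons (negbTE nPi).
Qed.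

Lemma expbX f n : expb f -> expb (fun k => f k ^+ n).
Proof.
move=> fb; elim: n => [|n IH]; first exact: expb_cst.
by apply: expb_le (expbM fb IH) => k; rewrite exprS.
Qed.

Hypothesis subG : sub_gaussian pi.

(** The sub-Gaussian bound at l = ln r controls the series of terms r^k up to the constant factor
    exp(- l mean). *)
Lemma cvg_exp_moment (r : R) : 1 <= r -> cvgn (series (fun k => a k * r ^+ k)).
Proof.
move=> r1; have r0 : 0 < r by apply: lt_le_trans r1.
have [sigma /(_ (ln r))] := subG; rewrite unlock => H.
set f := fun k : nat => expR (ln r * (k%:R - mean pi)).
have fE k : f k = r ^+ k * expR (- (ln r * mean pi)).
  by rewrite /f mulrBr expRD [ln r * k%:R]mulrC expRM_natl lnK// posrE.
rewrite integral_nat in H; last by move=> k; exact: expR_ge0.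
have cf : cvgn (series (fun k => a k * f k)).
  apply: nnseries_is_cvg; first by move=> k; rewrite mulr_ge0 ?prob_at_ge0 ?expR_ge0.
  by apply: le_lt_trans H _; rewrite ltry.
have := @is_cvg_seriesZ _ _ (expR (ln r * mean pi)) cf.
rewrite (_ : _ *: _ = fun k => a k * r ^+ k)//; apply/funext => k.
change (expR (ln r * mean pi) * (a k * f k) = a k * r ^+ k); rewrite fE.
transitivity (a k * r ^+ k * (expR (ln r * mean pi) * expR (- (ln r * mean pi)))).
  by ring.
by rewrite -expRD subrr expR0 mulr1.
Qed.

Lemma EX_cvg_norm f : expb f -> cvgn (series (fun k => `|a k * f k|)).
Proof.
move=> [A [r [A0 r1 H]]].
apply: (@series_le_cvg _ _ (A *: (fun k => a k * r ^+ k))).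
- by [].
- by move=> k; change (0 <= A * (a k * r ^+ k)); rewrite mulr_ge0// mulr_ge0 ?prob_at_ge0// exprn_ge0// (le_trans ler01).
- move=> k; rewrite normrM ger0_norm ?prob_at_ge0//.
  change (a k * `|f k| <= A * (a k * r ^+ k)); rewrite mulrCA.
  by rewrite ler_wpM2l ?prob_at_ge0.
- exact: is_cvg_seriesZ (cvg_exp_moment r1).
Qed.

Lemma EX_cvg f : expb f -> cvgn (series (fun k => a k * f k)).
Proof. by move=> /EX_cvg_norm; exact: normed_cvg. Qed.

Lemma eq_EX f g : f =1 g -> EX f = EX g.
Proof. by move=> fg; rewrite /EX; congr (limn (series _)); apply/funext => k; rewrite fg. Qed.

Lemma EXD f g : expb f -> expb g -> EX (fun k => f k + g k) = EX f + EX g.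
Proof.
move=> fb gb; rewrite /EX -lim_seriesD; try exact: EX_cvg.
by congr (limn (series _)); apply/funext => k; rewrite mulrDr.
Qed.

Lemma EXZ c f : expb f -> EX (fun k => c * f k) = c * EX f.
Proof.
move=> fb; rewrite /EX -[RHS]lim_seriesZ; last exact: EX_cvg.
by congr (limn (series _)); apply/funext => k; rewrite mulrCA.
Qed.

Lemma EX_le f g : expb f -> expb g -> (forall k, f k <= g k) -> EX f <= EX g.
Proof.
move=> fb gb fg; apply: lim_series_le; try exact: EX_cvg.
by move=> k; rewrite ler_wpM2l ?prob_at_ge0.
Qed.

Lemma EX_esum f : expb f -> (forall k, 0 <= f k) ->
  (\esum_(k in [set: nat]) (a k * f k)%:E = (EX f)%:E)%E.
Proof.
move=> fb f0; rewrite -nneseries_esumT; last first.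
  by move=> k; rewrite lee_fin mulr_ge0 ?prob_at_ge0.
rewrite /EX -EFin_lim; last exact: EX_cvg.
by congr (limn _); apply/funext => n; rewrite /series/= sumEFin.
Qed.

Lemma EX_integral f : expb f -> (forall k, 0 <= f k) ->
  (\int[pi]_k (f k)%:E = (EX f)%:E)%E.
Proof.
move=> fb f0; rewrite integral_nat// -EX_esum// -nneseries_esumT// => k.
by rewrite lee_fin mulr_ge0 ?prob_at_ge0.
Qed.

Lemma EX1 : EX (fun=> 1) = 1.
Proof.
have := EX_integral (expb_cst 1) (fun=> ler01).
by rewrite integral_cst//= probability_setT mule1 => -[<-].
Qed.

Lemma EX_cst c : EX (fun=> c) = c.
Proof.
rewrite -[RHS]mulr1 -EX1 -EXZ; last exact: expb_cst.
by apply: eq_EX => k; rewrite mulr1.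
Qed.

Lemma EX_mean : EX (fun k => k%:R) = mean pi.
Proof. by rewrite /mean unlock EX_integral//; exact: expb_natr. Qed.

Lemma EX_ge0 f : expb f -> (forall k, 0 <= f k) -> 0 <= EX f.
Proof. by move=> fb f0; rewrite -[leLHS](EX_cst 0); apply: EX_le => //; exact: expb_cst. Qed.

Lemma EXN f : expb f -> EX (fun k => - f k) = - EX f.
Proof. by move=> fb; rewrite -mulN1r -EXZ//; apply: eq_EX => k; rewrite mulN1r. Qed.

Lemma expbN f : expb f -> expb (fun k => - f k).
Proof. by apply: expb_le => k; rewrite normrN. Qed.

Lemma EXB f g : expb f -> expb g -> EX (fun k => f k - g k) = EX f - EX g.
Proof. by move=> fb gb; rewrite EXD ?EXN//; exact: expbN. Qed.

Lemma EX_norm f : expb f -> `|EX f| <= EX (fun k => `|f k|).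
Proof.
move=> fb.
have nb : expb (fun k => `|f k|) by apply: expb_le fb => k; rewrite normr_id.
rewrite ler_norml -EXN//; apply/andP; split; apply: EX_le => //.
- exact: expbN.
- by move=> k; rewrite lerNl -normrN ler_norm.
- by move=> k; rewrite ler_norm.
Qed.

Lemma EX_sum (I : Type) (s : seq I) (P : pred I) (f : I -> nat -> R) :
  (forall i, P i -> expb (f i)) ->
  EX (fun k => \sum_(i <- s | P i) f i k) = \sum_(i <- s | P i) EX (f i).
Proof.
move=> H; elim: s => [|i s IH].
  by rewrite big_nil -[RHS](EX_cst 0); apply: eq_EX => k; rewrite big_nil.
rewrite big_cons; case: ifPn => Pi.
  rewrite -IH -EXD; [|exact: H|exact: expb_sum].
  by apply: eq_EX => k; rewrite big_cons Pi.
by rewrite -IH; apply: eq_EX => k; rewrite big_cons (negbTE Pi).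
Qed.

Lemma EX_ge_term f k : expb f -> (forall k, 0 <= f k) -> a k * f k <= EX f.
Proof.
move=> fb f0; rewrite -lee_fin -EX_esum//.
apply: esum_ge; exists [set k]; last by rewrite fsbig_set1.
by split => //; exact: finite_set1.
Qed.

Let dcoef n := iter n (@pseries_diffs R) a.

Lemma dcoefE n i : dcoef n i = ((i + n) ^_ n)%:R * a (i + n)%N.
Proof.
elim: n i => [|n IH] i; first by rewrite /dcoef /= addn0 ffactn0 mul1r.
rewrite /dcoef iterS -/(dcoef n) /pseries_diffs IH addSnnS mulrA -natrM.
congr (_%:R * _); rewrite -addSnnS.
by rewrite addSn ffactnSr subSn ?leq_addl// addnK mulnC.
Qed.

Lemma expb_ffact n x : expb (fun d => (d ^_ n)%:R * x ^+ (d - n)).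
Proof.
pose y := Num.max 1 `|x|.
have y1 : 1 <= y by rewrite le_max lexx.
apply: expb_le (expbM (expbX n expb_natr) (expb_pow y)) => d.
rewrite !normrM !normrX !normr_nat ler_pM ?exprn_ge0//.
  rewrite -natrX ler_nat; elim: n => [|n IH]; first by rewrite ffactn0.
  by rewrite ffactnSr expnSr leq_mul// leq_subr.
have xy : `|x| <= `|y| by rewrite (ger0_norm (le_trans ler01 y1)) le_max lexx orbT.
apply: (@le_trans _ _ (`|y| ^+ (d - n))); first by rewrite lerXn2r.
by rewrite ler_weXn2l ?leq_subr// (ger0_norm (le_trans ler01 y1)).
Qed.

Lemma dcoef_series n x :
  pseries (dcoef n) x @ \oo --> EX (fun d => (d ^_ n)%:R * x ^+ (d - n)).
Proof.
have := EX_cvg (expb_ffact n x); rewrite -/(EX _) => h.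
rewrite -(cvg_shiftn n) in h.
rewrite (_ : pseries _ _ =
  [sequence (series (fun d => a d * ((d ^_ n)%:R * x ^+ (d - n)))) (m + n)%N]_m)//.
apply/funext => m; rewrite /pseries /series /=.
rewrite [RHS](@big_cat_nat _ _ _ n)/= ?leq_addl// [X in _ = X + _]big1_seq ?add0r.
  rewrite -{2}[n]add0n big_addn addnK; apply: eq_bigr => i _.
  by rewrite dcoefE addnK; ring.
move=> i; rewrite mem_index_iota => /andP[_ /andP[_ iN]].
by rewrite ffact_small// mul0r mulr0.
Qed.

(** The power series converges on the whole line, hence may be differentiated term by term at every
    point, including 1 and beyond. *)
Lemma derive1n_gen_fun n x :
  derive1n n (gen_fun pi) x = EX (fun d => (d ^_ n)%:R * x ^+ (d - n)).
Proof.
suff -> : derive1n n (gen_fun pi) = (fun x => limn (pseries (dcoef n) x)).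
  exact/cvg_lim/dcoef_series.
elim: n => [|n IH]; first by [].
rewrite derive1nS IH; apply/funext => y.
have cv m K : cvgn (pseries (dcoef m) K) by apply: cvgP; exact: dcoef_series.
(* Term-by-term differentiation at y asks for convergence at a point of larger modulus; |y| + 1 is
   one. *)
have := @pseries_snd_diffs R (dcoef n) (`|y| + 1) y (cv n _) (cv n.+1 _) (cv n.+2 _).
rewrite (ger0_norm (_ : 0 <= `|y| + 1)) ?addr_ge0// ltrDl ltr01 => /(_ isT) H.
by rewrite derive1E; apply: derive_val.
Qed.

Lemma derivable_derive1n_gen_fun n x : derivable (derive1n n (gen_fun pi)) x 1.
Proof.
suff -> : derive1n n (gen_fun pi) = (fun x => limn (pseries (dcoef n) x)).
  have cv m K : cvgn (pseries (dcoef m) K) by apply: cvgP; exact: dcoef_series.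
  have := @pseries_snd_diffs R (dcoef n) (`|x| + 1) x (cv n _) (cv n.+1 _) (cv n.+2 _).
  rewrite (ger0_norm (_ : 0 <= `|x| + 1)) ?addr_ge0// ltrDl ltr01 => /(_ isT) H.
  exact: ex_derive.
apply/funext => y; rewrite derive1n_gen_fun.
by apply/esym/cvg_lim => //; exact: dcoef_series.
Qed.

End DiscreteExpectation.

(** * The fluid limit *)

Section BernoulliAnalysis.
Variable R : realType.
Implicit Types (f : nat -> R) (g : R).

Lemma bern_sum n f g m : (n < m)%N ->
  bern n f g = \sum_(0 <= k < m) 'C(n, k)%:R * g ^+ k * (1 - g) ^+ (n - k) * f k.
Proof.
elim: n f m => [|n IH] f m nm.
  rewrite big_ltn// big1_seq ?addr0 /= ?expr0 ?mul1r// => k.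
  by rewrite mem_index_iota => /andP[k1 _]; rewrite bin_small// !mul0r.
case: m nm => // m nm; rewrite /= (IH f m.+1)//; last by rewrite ltnW.
rewrite (IH (f \o succn) m)// !big_nat_recl//.
rewrite !bin0 !expr0 !subn0 !mulr1 mulrDr addrCA; congr (_ + _).
  by rewrite exprS; ring.
rewrite !mulr_sumr -big_split; apply: eq_big_nat => k /andP[_ km] /=.
rewrite binS natrD subSS exprS.
have [kn|nk] := ltnP k n; first by rewrite (_ : (n - k = (n - k.+1).+1)%N) ?exprS; [ring|lia].
by rewrite (bin_small (_ : (n < k.+1)%N))//; ring.
Qed.

Lemma bern_sum_supp n f g m : (forall k, (m <= k)%N -> f k = 0) ->
  bern n f g = \sum_(0 <= k < m) 'C(n, k)%:R * g ^+ k * (1 - g) ^+ (n - k) * f k.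
Proof.
move=> f0; rewrite (@bern_sum _ _ _ (maxn n.+1 m)) ?leq_max ?leqnn//.
rewrite (@big_cat_nat _ _ _ m)/= ?leq_maxr// [X in _ + X]big1_seq ?addr0// => k.
by rewrite mem_index_iota => /andP[_ /andP[mk _]]; rewrite f0// mulr0.
Qed.

Lemma bern_ge0 n f g : 0 <= g <= 1 -> (forall k, 0 <= f k) -> 0 <= bern n f g.
Proof.
move=> g01 f0; have /andP[g0 g1] := g01; rewrite (@bern_sum n f g n.+1)//.
by apply: sumr_ge0 => k _; rewrite !mulr_ge0 ?exprn_ge0 ?subr_ge0.
Qed.

Lemma bern_ge_first n f g : 0 <= g <= 1 -> (forall k, 0 <= f k) ->
  (1 - g) ^+ n * f 0%N <= bern n f g.
Proof.
move=> g01 f0; have /andP[g0 g1] := g01; rewrite (@bern_sum n f g n.+1)//.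
rewrite big_ltn// bin0 expr0 !mul1r subn0 lerDl.
by apply: sumr_ge0 => k _; rewrite !mulr_ge0 ?exprn_ge0 ?subr_ge0.
Qed.

Lemma bern_lip n f g g' : 0 <= g <= 1 -> 0 <= g' <= 1 ->
  (forall k, `|f k| <= 1) -> `|bern n f g - bern n f g'| <= 2 * n%:R * `|g - g'|.
Proof.
move=> g01 g01'; elim: n f => [|n IH] f f1 /=.
  by rewrite subrr normr0 mulr0 mul0r.
have f1' k : `|(f \o succn) k| <= 1 by exact: f1.
have := IH _ f1; have := IH _ f1'.
have := bern_norm_le n g01' f1; have := bern_norm_le n g01' f1'.
set A := bern n (f \o succn) g; set A' := bern n (f \o succn) g'.
set B := bern n f g; set B' := bern n f g'.
move=> a1 b1 hA hB.
have -> : g * A + (1 - g) * B - (g' * A' + (1 - g') * B') =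
  g * (A - A') + (1 - g) * (B - B') + (g - g') * (A' - B') by ring.
have /andP[g0 g1] := g01.
have h1 : `|g * (A - A')| <= g * (2 * n%:R * `|g - g'|).
  by rewrite normrM (ger0_norm g0) ler_wpM2l.
have h2 : `|(1 - g) * (B - B')| <= (1 - g) * (2 * n%:R * `|g - g'|).
  by rewrite normrM (@ger0_norm _ (1 - g)) ?subr_ge0// ler_wpM2l ?subr_ge0.
have h3 : `|(g - g') * (A' - B')| <= `|g - g'| * 2.
  by rewrite normrM ler_wpM2l// (le_trans (ler_normB _ _))//; lra.
apply: (le_trans (ler_normD _ _)); apply: (le_trans (lerD (ler_normD _ _) (lexx _))).
rewrite -[n.+1%:R]natr1; lra.
Qed.

Definition fdiff f (k : nat) : R := f k.+1 - f k.

(** The derivative in g of a binomial expectation is n times the expectation, over n - 1 trials, of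
    the discrete derivative of [f]. The induction conditions on one trial and yields the explicit
    quadratic remainder. *)
Lemma bern_taylor n f g g' (c : R) : 0 <= g <= 1 -> 0 <= g' <= 1 ->
  (forall k, `|f k| <= c) ->
  `|bern n f g' - bern n f g - (g' - g) * (n%:R * bern n.-1 (fdiff f) g)|
     <= 4 * c * n%:R ^+ 2 * (g' - g) ^+ 2.
Proof.
move=> g01 g01'; elim: n f => [|n IH] f fc.
  by rewrite /= subrr mul0r mulr0 subrr normr0 expr0n/= mulr0 mul0r.
have c0 : 0 <= c by apply: le_trans (fc 0%N).
have fc' k : `|(f \o succn) k| <= c by exact: fc.
have := IH _ fc; have := IH _ fc'.
have -> : bern n.+1 f g' = g' * bern n (f \o succn) g' + (1 - g') * bern n f g' by [].
have -> : bern n.+1 f g = g * bern n (f \o succn) g + (1 - g) * bern n f g by [].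
have E : bern n.+1.-1 (fdiff f) g = bern n (f \o succn) g - bern n f g.
  rewrite /= -mulN1r -bernZ -bernD; apply: eq_bern => k; rewrite mulN1r//.
have dc k : `|fdiff f k| <= 2 * c.
  rewrite (le_trans (ler_normB _ _))// mulr2n mulrDl mul1r lerD//; exact: fc.
have dc' k : `|fdiff (f \o succn) k| <= 2 * c by exact: (dc k.+1).
have := bern_norm_le n.-1 g01 dc; have := bern_norm_le n.-1 g01 dc'.
have E2 : n%:R * (bern n (f \o succn) g - bern n f g) =
    n%:R * (g * bern n.-1 (fdiff (f \o succn)) g + (1 - g) * bern n.-1 (fdiff f) g).
  rewrite -E; case: (n) => [|n'] /=; first by rewrite !mul0r.
  by congr (_ * _).
rewrite E; move: E2.
set A := bern n (f \o succn) g; set A' := bern n (f \o succn) g'.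
set B := bern n f g; set B' := bern n f g'.
set a := bern _ (fdiff (f \o succn)) g; set b := bern _ (fdiff f) g.
move=> E2 ac bc hA hB.
have -> : g' * A' + (1 - g') * B' - (g * A + (1 - g) * B) - (g' - g) * (n.+1%:R * (A - B))
  = g' * (A' - A - (g' - g) * (n%:R * a)) + (1 - g') * (B' - B - (g' - g) * (n%:R * b))
    + (g' - g) ^+ 2 * (n%:R * (a - b)).
  rewrite -[n.+1%:R]natr1.
  have -> : (g' - g) * ((n%:R + 1) * (A - B)) = (g' - g) * (A - B) +
     (g' - g) * (n%:R * (g * a + (1 - g) * b)) by rewrite -E2; ring.
  by ring.
have /andP[g0 g1] := g01'.
set X := 4 * c * n%:R ^+ 2 * (g' - g) ^+ 2 in hA hB.
have h1 : `|g' * (A' - A - (g' - g) * (n%:R * a))| <= g' * X.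
  by rewrite normrM (ger0_norm g0) ler_wpM2l.
have h2 : `|(1 - g') * (B' - B - (g' - g) * (n%:R * b))| <= (1 - g') * X.
  by rewrite normrM (@ger0_norm _ (1 - g')) ?subr_ge0// ler_wpM2l ?subr_ge0.
have h3 : `|(g' - g) ^+ 2 * (n%:R * (a - b))| <= (g' - g) ^+ 2 * (n%:R * (4 * c)).
  rewrite normrM ger0_norm ?sqr_ge0// ler_wpM2l ?sqr_ge0// normrM normr_nat.
  by rewrite ler_wpM2l// (le_trans (ler_normB _ _))//; lra.
apply: (le_trans (ler_normD _ _)); apply: (le_trans (lerD (ler_normD _ _) (lexx _))).
apply: (le_trans (lerD (lerD h1 h2) h3)).
rewrite (_ : g' * X + (1 - g') * X = X); last by ring.
rewrite /X -[n.+1%:R]natr1.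
have -> : 4 * c * (n%:R + 1) ^+ 2 * (g' - g) ^+ 2 =
  4 * c * n%:R ^+ 2 * (g' - g) ^+ 2 + (g' - g) ^+ 2 * (n%:R * (4 * c)) +
  4 * c * (n%:R + 1) * (g' - g) ^+ 2 by ring.
rewrite lerDl; apply: mulr_ge0; last exact: sqr_ge0.
by rewrite mulr_ge0 ?addr_ge0// mulr_ge0.
Qed.

Lemma psi_mul d q : q * psi d q = 1 - (1 - q) ^+ d :> R.
Proof.
elim: d => [|d IH]; first by rewrite /psi big_geq// mulr0 expr0 subrr.
by rewrite psiS mulrDr mulrCA IH exprS; ring.
Qed.

Lemma pow_lip k (x y : R) : 0 <= x <= 1 -> 0 <= y <= 1 ->
  `|x ^+ k - y ^+ k| <= k%:R * `|x - y|.
Proof.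
move=> /andP[x0 x1] /andP[y0 y1]; elim: k => [|k IH].
  by rewrite !expr0 subrr normr0 mul0r.
have -> : x ^+ k.+1 - y ^+ k.+1 = x * (x ^+ k - y ^+ k) + (x - y) * y ^+ k.
  by rewrite !exprS; ring.
apply: (le_trans (ler_normD _ _)); rewrite -[k.+1%:R]natr1 [leRHS]mulrDl mul1r; apply: lerD.
  rewrite normrM (ger0_norm x0); apply: le_trans IH.
  by rewrite ler_piMl.
by rewrite normrM ler_piMr// ger0_norm ?exprn_ge0// exprn_ile1.
Qed.

Lemma psi_lip d (q q' : R) : 0 <= q <= 1 -> 0 <= q' <= 1 ->
  `|psi d q - psi d q'| <= d%:R ^+ 2 * `|q - q'|.
Proof.
move=> /andP[q0 q1] /andP[q0' q1'].
rewrite /psi -sumrB; apply: (le_trans (ler_norm_sum _ _ _)).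
apply: (@le_trans _ _ (\sum_(0 <= k < d) d%:R * `|q - q'|)).
  rewrite big_seq [leRHS]big_seq; apply: ler_sum => k.
  rewrite mem_index_iota => /andP[_ kd].
  apply: (le_trans (pow_lip _ _ _)); rewrite ?subr_ge0 ?lerBlDr ?lerDl ?q1 ?q1' ?q0 ?q0'//.
  rewrite (_ : 1 - q - (1 - q') = q' - q); last by ring.
  by rewrite distrC ler_wpM2r// ler_nat ltnW.
by rewrite sumr_const_nat subn0 -[leLHS]mulr_natl expr2 mulrA.
Qed.

End BernoulliAnalysis.

Section Model.
Variables (R : realType) (piU piV : probability nat R) (C : nat) (p : nat -> R).
Hypothesis subU : sub_gaussian piU.
Hypothesis subV : sub_gaussian piV.
Hypothesis muU0 : 0 < mean piU.
Hypothesis muV0 : 0 < mean piV.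
Hypothesis C1 : (1 <= C)%N.
Hypothesis p0 : forall c : nat, (1 <= c <= C)%N -> 0 <= p c.
Hypothesis pC : forall c : nat, (C < c)%N -> p c = 0.
Hypothesis p1 : \sum_(1 <= c < C.+1) p c = 1.

Local Notation muU := (mean piU).
Local Notation muV := (mean piV).
Local Notation Ec := (mean_capacity C p).

(** For a random capacity c of law p, [surv k] is P(c > k), and [leftover k] is E max(c - k, 0), the
    capacity expected to remain at a vertex of which k half-edges have been revealed. *)
Definition surv k : R := 1 - cumul p k.
Definition leftover k : R := \sum_(1 <= c < C.+1) c%:R * p (c + k)%N.

(* [fluid_Gamma], [fluid_rate] and [fluid_matched] are Gamma, the right-hand side
   of the equation for G and E[c] times the limit ratio, written as expectations;
   [fluid_open] g is the probability that a half-edge revealed at time g belongs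
   to a vertex that still has capacity. *)
Definition fluid_Gamma g : R := EX piU (fun d => d%:R * bern d.-1 surv g).
Definition fluid_open g : R := fluid_Gamma g / muU.
Definition fluid_rate g : R := EX piV (fun d => psi d (fluid_open g)) / muV.
Definition fluid_matched g : R := Ec - EX piU (fun d => bern d leftover g).

Lemma p_ge0' c : (0 < c)%N -> 0 <= p c.
Proof.
move=> c0; have [cC|Cc] := leqP c C; first by rewrite p0// c0.
by rewrite pC.
Qed.

Lemma cumul0 : cumul p 0 = 0.
Proof. by rewrite /cumul big_geq. Qed.

Lemma cumulS k : cumul p k.+1 = cumul p k + p k.+1.
Proof. by rewrite /cumul big_nat_recr. Qed.

Lemma cumul_C k : (C <= k)%N -> cumul p k = 1.
Proof.
elim: k => [|k IH]; first by rewrite leqn0 => /eqP h; move: C1; rewrite h.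
rewrite leq_eqVlt => /orP[/eqP <- //|]; rewrite ltnS => Ck.
by rewrite cumulS IH// pC// addr0.
Qed.

Lemma surv01 k : 0 <= surv k <= 1.
Proof.
have c0 j : 0 <= cumul p j.
  elim: j => [|j IH]; first by rewrite cumul0.
  by rewrite cumulS addr_ge0// p_ge0'.
have mono j l : cumul p j <= cumul p (j + l).
  elim: l => [|l IH]; first by rewrite addn0.
  by rewrite addnS cumulS (le_trans IH)// lerDl p_ge0'.
rewrite /surv lerBlDr lerDl c0 andbT subr_ge0.
by rewrite (le_trans (mono k C))// cumul_C// leq_addl.
Qed.

Lemma surv_norm k : `|surv k| <= 1.
Proof. by have /andP[h0 h1] := surv01 k; rewrite ger0_norm. Qed.

Lemma surv_C k : (C <= k)%N -> surv k = 0.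
Proof. by move=> Ck; rewrite /surv cumul_C// subrr. Qed.

Lemma surv_indic k : surv k = \sum_(1 <= c < C.+1) p c * (k < c)%N%:R.
Proof.
have [Ck|kC] := leqP C k.
  rewrite surv_C// big1_seq// => c; rewrite mem_index_iota => /andP[_ /andP[_ cC]].
  by rewrite ltnNge (leq_trans _ Ck)//= mulr0.
have E : \sum_(1 <= c < C.+1) p c = cumul p k + \sum_(k.+1 <= c < C.+1) p c.
  by rewrite (@big_cat_nat _ _ _ k.+1)//= ltnW.
rewrite /surv -[X in X - _]p1 E addrC addKr.
rewrite [RHS](@big_cat_nat _ _ _ k.+1)//=; last by rewrite ltnW.
rewrite [X in _ = X + _]big1_seq ?add0r.
  by apply: eq_big_nat => c /andP[kc _]; rewrite kc /= mulr1.
move=> c; rewrite mem_index_iota => /andP[_ /andP[_ ck]].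
by rewrite ltnNge -ltnS ck /= mulr0.
Qed.

Lemma leftover_C k : (C <= k)%N -> leftover k = 0.
Proof.
move=> Ck; rewrite /leftover big1_seq// => c; rewrite mem_index_iota => /andP[_ /andP[c1 _]].
by rewrite pC ?mulr0//; lia.
Qed.

(** One more revealed half-edge uses up one unit of capacity exactly when c > k. This is what makes
    [fluid_Gamma] the derivative of [fluid_matched]. *)
Lemma leftover_diff k : fdiff leftover k = - surv k.
Proof.
(* Partial sums carry a boundary term, which vanishes at n = C. *)
have key n : \sum_(1 <= c < n.+1) c%:R * p (c + k)%N - \sum_(1 <= c < n.+1) c%:R * p (c + k.+1)%N
   = cumul p (n + k) - cumul p k - n%:R * p (n.+1 + k)%N.
  elim: n => [|n IH]; first by rewrite !big_geq// add0n mul0r !subrr.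
  rewrite big_nat_recr//= [X in _ - X]big_nat_recr//=.
  rewrite [RHS](_ : _ = (cumul p (n + k) - cumul p k - n%:R * p (n.+1 + k)%N) +
    (n.+1%:R * p (n.+1 + k)%N - n.+1%:R * p (n.+1 + k.+1)%N)).
    by rewrite -IH; ring.
  by rewrite addSn cumulS -[n.+1%:R]natr1 !addSn addnS; ring.
rewrite /fdiff -opprB key cumul_C ?leq_addr// pC; last by lia.
by rewrite mulr0 subr0.
Qed.

Lemma leftover_norm k : `|leftover k| <= (C * C)%:R.
Proof.
rewrite /leftover; apply: (le_trans (ler_norm_sum _ _ _)).
apply: (@le_trans _ _ (\sum_(1 <= c < C.+1) C%:R)).
  rewrite big_seq [leRHS]big_seq; apply: ler_sum => c.
  rewrite mem_index_iota => /andP[c1 cC].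
  have pn : 0 <= p (c + k)%N <= 1.
    rewrite p_ge0' ?addn_gt0 ?c1//=.
    have [ck|kc] := leqP (c + k) C; last by rewrite pC.
    rewrite -p1 (big_rem (c + k)%N)/= ?mem_index_iota; last by lia.
    rewrite lerDl big_seq; apply: sumr_ge0 => j /mem_rem.
    by rewrite mem_index_iota => /andP[j1 _]; rewrite p_ge0'.
  have /andP[pn0 pn1] := pn.
  rewrite ger0_norm ?mulr_ge0// -[leRHS]mulr1 ler_pM// ler_nat//.
by rewrite sumr_const_nat subn1/= -[leLHS]mulr_natl -natrM.
Qed.

Lemma Ec_gt0 : 0 < Ec.
Proof.
apply: (@lt_le_trans _ _ 1) => //; rewrite -p1 /mean_capacity big_seq [leRHS]big_seq.
apply: ler_sum => c; rewrite mem_index_iota => /andP[c1 cC].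
by rewrite ler_peMl ?p_ge0'// ler1n.
Qed.

Lemma expb_bern n f g : 0 <= g <= 1 -> (exists c, forall k, `|f k| <= c) ->
  expb (fun d => bern (n d) f g : R).
Proof.
move=> g01 [c fc]; apply: expb_le (expb_cst `|c|) => d.
by rewrite normr_id (le_trans (bern_norm_le _ g01 fc))// ler_norm.
Qed.

Lemma expb_dbern f g : 0 <= g <= 1 -> (exists c, forall k, `|f k| <= c) ->
  expb (fun d => d%:R * bern d.-1 f g : R).
Proof. by move=> g01 fc; apply: expbM; [exact: expb_natr|exact: expb_bern]. Qed.

Lemma expb_sq : expb (fun d => d%:R ^+ 2 : R).
Proof. by apply: expbX; exact: expb_natr. Qed.

(** The derivatives are factorial moments, and the factorial (d)_(k+1) divided by k! is d times the
    binomial coefficient of d - 1 and k: the terms are binomial weights, cut at C because [surv]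
    vanishes from there on. *)
Lemma GammaE g : Gamma (gen_fun piU) C p g = fluid_Gamma g.
Proof.
rewrite /Gamma.
transitivity (\sum_(0 <= k < C) (surv k * g ^+ k / k`!%:R) *
    EX piU (fun d => (d ^_ k.+1)%:R * (1 - g) ^+ (d - k.+1))).
  rewrite [RHS]big_ltn// expr0 fact0 divr1 mulr1 /surv cumul0 subr0 mul1r.
  rewrite derive1n_gen_fun//; congr (_ + _).
  by apply: eq_big_nat => k _; rewrite derive1n_gen_fun.
under eq_bigr => k _ do rewrite -(EXZ subU _ (expb_ffact k.+1 (1 - g))).
rewrite -EX_sum//.
  apply: eq_EX => -[|n]; last first.
    rewrite (bern_sum_supp _ _ surv_C) mulr_sumr; apply: eq_bigr => k _.
    rewrite subSS ffactSS natrM -bin_ffact natrM /=.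
    by field; rewrite pnatr_eq0 -lt0n fact_gt0.
  by rewrite mul0r big1// => k _; rewrite ffact0n /= mul0r mulr0.
move=> k _; apply: expbM; [exact: expb_cst|exact: expb_ffact].
Qed.

Lemma limit_ratioE g : 0 <= g <= 1 ->
  limit_ratio (gen_fun piU) C p g = fluid_matched g / Ec.
Proof.
move=> g01; have E0 : Ec != 0 by rewrite gt_eqF// Ec_gt0.
rewrite /limit_ratio /fluid_matched mulrBl divff//; congr (_ - _).
transitivity (\sum_(0 <= k < C) (leftover k / Ec * (1 / k`!%:R) * g ^+ k) *
    EX piU (fun d => (d ^_ k)%:R * (1 - g) ^+ (d - k))).
  by apply: eq_big_nat => k _; rewrite derive1n_gen_fun.
under eq_bigr => k _ do rewrite -(EXZ subU _ (expb_ffact k (1 - g))).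
rewrite -EX_sum//.
  rewrite mulrC -EXZ//; last first.
    by apply: expb_bern => //; exists (C * C)%:R => k; exact: leftover_norm.
  apply: eq_EX => n; rewrite (bern_sum_supp _ _ leftover_C) mulr_sumr.
  apply: eq_bigr => k _; rewrite -bin_ffact natrM /=.
  by field; rewrite E0 pnatr_eq0 -lt0n fact_gt0.
move=> k _; apply: expbM; [exact: expb_cst|exact: expb_ffact].
Qed.

Lemma fluid_Gamma_bnd g : 0 <= g <= 1 -> 0 <= fluid_Gamma g <= muU.
Proof.
move=> g01; have eb := expb_dbern g01 (ex_intro _ 1 surv_norm).
have b0 d : 0 <= bern d surv g by apply: bern_ge0 => // k; have /andP[] := surv01 k.
apply/andP; split; first by apply: EX_ge0 => // d; rewrite mulr_ge0.
rewrite -EX_mean//; apply: EX_le => //; first exact: expb_natr.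
move=> d; rewrite ler_piMr//.
by rewrite (le_trans (ler_norm _))// bern_norm_le// => k; exact: surv_norm.
Qed.

Lemma fluid_open_bnd g : 0 <= g <= 1 -> 0 <= fluid_open g <= 1.
Proof.
move=> /fluid_Gamma_bnd /andP[h0 h1]; rewrite /fluid_open.
by rewrite divr_ge0 ?(ltW muU0)// ler_pdivrMr// mul1r.
Qed.

Lemma exists_pos_deg (pi : probability nat R) : sub_gaussian pi -> 0 < mean pi ->
  exists d, (0 < d)%N /\ 0 < prob_at pi d.
Proof.
move=> sub m0; apply: contrapT => H; move: m0; rewrite -EX_mean//.
rewrite (_ : EX _ _ = 0) ?ltxx// /EX (_ : series _ = fun=> 0) ?lim_cst//.
apply/funext => n; rewrite /series /= big1// => k _.
case: k => [|k]; first by rewrite mulr0.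
have := prob_at_ge0 pi k.+1; rewrite le_eqVlt => /orP[/eqP <-|h]; first by rewrite mul0r.
by exfalso; apply: H; exists k.+1.
Qed.

(** For a degree d >= 1 of positive probability, none of the d - 1 other half-edges is revealed with
    probability (1 - g)^(d - 1) > 0, and then the vertex is open. *)
Lemma fluid_Gamma_gt0 g : 0 <= g < 1 -> 0 < fluid_Gamma g.
Proof.
move=> /andP[g0 g1]; have g01 : 0 <= g <= 1 by rewrite g0 ltW.
have [d [d0 ad]] := exists_pos_deg subU muU0.
have eb := expb_dbern g01 (ex_intro _ 1 surv_norm).
have s0 k : 0 <= surv k by have /andP[] := surv01 k.
have b0 k : 0 <= bern k surv g by apply: bern_ge0.
apply: lt_le_trans (EX_ge_term subU d eb _); last by move=> k; rewrite mulr_ge0.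
rewrite mulr_gt0// mulr_gt0 ?ltr0n//.
apply: lt_le_trans (bern_ge_first _ g01 s0).
by rewrite /surv cumul0 subr0 mulr1 exprn_gt0// subr_gt0.
Qed.

Lemma expb_psi q : 0 <= q <= 1 -> expb (fun d => psi d q : R).
Proof.
move=> q01; apply: expb_le (expb_natr R) => d.
by rewrite normr_nat ger0_norm ?psi_le// psi_ge0//; case/andP: q01.
Qed.

(** The geometric sum [psi_mul] gives 1 - phi_V(1 - q) = q E psi(q), and q cancels the factor Gamma
    of the denominator. The resulting [fluid_rate] still makes sense where Gamma vanishes, so all
    later analysis is done with it on the closed interval. *)
Lemma greedy_rhsE g : 0 <= g < 1 ->
  greedy_rhs (gen_fun piU) (gen_fun piV) muU muV C p g = fluid_rate g.
Proof.
move=> g01; have G0 := fluid_Gamma_gt0 g01.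
have g01' : 0 <= g <= 1 by case/andP: g01 => -> /ltW ->.
have q01 := fluid_open_bnd g01'.
rewrite /greedy_rhs GammaE -/(fluid_open g).
have := derive1n_gen_fun subV 0 (1 - fluid_open g); rewrite derive1n0 => ->.
rewrite (@eq_EX _ _ _ (fun d => (1 - fluid_open g) ^+ d)); last first.
  by move=> d; rewrite ffactn0 mul1r subn0.
have -> : 1 - EX piV (fun d => (1 - fluid_open g) ^+ d) =
    fluid_open g * EX piV (fun d => psi d (fluid_open g)).
  rewrite -EXZ//; last exact: expb_psi.
  rewrite -[X in X - _](EX_cst subV 1) -EXB//; [|exact: expb_cst|exact: expb_pow].
  by apply: eq_EX => d; rewrite psi_mul.
rewrite /fluid_rate /fluid_open; field.
by rewrite !gt_eqF.
Qed.

(** A vertex of degree d >= 1 reveals at least one half-edge and at most d. *)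
Lemma fluid_rate_bnd : exists m : R, 0 < m /\
  forall g, 0 <= g <= 1 -> m <= fluid_rate g <= 1.
Proof.
have [d [d0 ad]] := exists_pos_deg subV muV0.
exists (prob_at piV d / muV); split; first by rewrite divr_gt0.
move=> g /fluid_open_bnd q01; have eb := expb_psi q01.
have q1 : fluid_open g <= 1 by case/andP: q01.
rewrite /fluid_rate; apply/andP; split.
  rewrite ler_pM2r ?invr_gt0//; apply: le_trans (EX_ge_term subV d eb _).
    rewrite ler_peMr ?prob_at_ge0//; case: (d) d0 => // d' _.
    by rewrite psiS lerDl mulr_ge0 ?psi_ge0// subr_ge0.
  by move=> k; exact: psi_ge0.
rewrite ler_pdivrMr// mul1r -EX_mean//; apply: EX_le => //; first exact: expb_natr.
by move=> k; exact: psi_le.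
Qed.

Definition open_lip : R := 2 * EX piU (fun d => d%:R ^+ 2) / muU.

Lemma open_lip_ge0 : 0 <= open_lip.
Proof.
rewrite /open_lip divr_ge0 ?(ltW muU0)// mulr_ge0// EX_ge0//; exact: expb_sq.
Qed.

Lemma fluid_open_lip g g' : 0 <= g <= 1 -> 0 <= g' <= 1 ->
  `|fluid_open g - fluid_open g'| <= open_lip * `|g - g'|.
Proof.
move=> g01 g01'; rewrite /fluid_open -mulrBl normrM (@ger0_norm _ muU^-1); last first.
  by rewrite invr_ge0 ltW.
rewrite /open_lip mulrAC ler_pM2r ?invr_gt0//.
have eb := expb_dbern g01 (ex_intro _ 1 surv_norm).
have eb' := expb_dbern g01' (ex_intro _ 1 surv_norm).
rewrite /fluid_Gamma -EXB//.
apply: (le_trans (EX_norm subU _)); first by apply: expbD => //; exact: expbN.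
rewrite mulrAC -EXZ//; last exact: expb_sq.
apply: EX_le => //.
- by apply: (@expb_le _ _ _ _ (expbD eb (expbN eb'))) => k; rewrite normr_id.
- by apply: expbM; [exact: expb_cst|exact: expb_sq].
move=> d; rewrite -mulrBr normrM normr_nat.
apply: (@le_trans _ _ (d%:R * (2 * d%:R * `|g - g'|))).
  rewrite ler_wpM2l//; apply: (le_trans (bern_lip _ g01 g01' surv_norm)).
  by rewrite ler_wpM2r// ler_wpM2l// ler_nat leq_pred.
by rewrite expr2; nra.
Qed.

Definition rate_lip : R := EX piV (fun d => d%:R ^+ 2) * open_lip / muV.

Lemma rate_lip_ge0 : 0 <= rate_lip.
Proof.
rewrite /rate_lip divr_ge0 ?(ltW muV0)// mulr_ge0 ?open_lip_ge0// EX_ge0//; exact: expb_sq.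
Qed.

Lemma fluid_rate_lip g g' : 0 <= g <= 1 -> 0 <= g' <= 1 ->
  `|fluid_rate g - fluid_rate g'| <= rate_lip * `|g - g'|.
Proof.
move=> g01 g01'; rewrite /fluid_rate -mulrBl normrM (@ger0_norm _ muV^-1); last first.
  by rewrite invr_ge0 ltW.
rewrite /rate_lip mulrAC ler_pM2r ?invr_gt0//.
have q01 := fluid_open_bnd g01; have q01' := fluid_open_bnd g01'.
have eb := expb_psi q01; have eb' := expb_psi q01'.
rewrite -EXB//.
apply: (le_trans (EX_norm subV _)); first by apply: expbD => //; exact: expbN.
rewrite -mulrA mulrC -EXZ//; last exact: expb_sq.
apply: EX_le => //.
- by apply: (@expb_le _ _ _ _ (expbD eb (expbN eb'))) => k; rewrite normr_id.
- by apply: expbM; [exact: expb_cst|exact: expb_sq].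
move=> d; apply: (le_trans (psi_lip _ q01 q01')); rewrite mulrC.
by rewrite ler_wpM2r ?exprn_ge0// fluid_open_lip.
Qed.

Definition matched_curv : R := 4 * (C * C)%:R * EX piU (fun d => d%:R ^+ 2).

Lemma fluid_matched_taylor g g' : 0 <= g <= 1 -> 0 <= g' <= 1 ->
  `|fluid_matched g' - fluid_matched g - fluid_Gamma g * (g' - g)|
    <= matched_curv * (g' - g) ^+ 2.
Proof.
move=> g01 g01'.
have lb : exists c : R, forall k, `|leftover k| <= c.
  by exists (C * C)%:R => k; exact: leftover_norm.
have e1 := expb_bern id g01 lb; have e2 := expb_bern id g01' lb.
have e3 := expb_dbern g01 (ex_intro _ 1 surv_norm).
rewrite /fluid_matched /fluid_Gamma.
rewrite [X in `|X|](_ : _ = - (EX piU (fun d => bern d leftover g')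
   - EX piU (fun d => bern d leftover g) - (- (g' - g)) * EX piU (fun d => d%:R * bern d.-1 surv g))); last by ring.
rewrite normrN -EXZ// -EXB// -EXB//; last 2 first.
- by apply: expbD => //; exact: expbN.
- by apply: expbM => //; exact: expb_cst.
have e4 : expb (fun k => bern k leftover g' - bern k leftover g -
    - (g' - g) * (k%:R * bern k.-1 surv g)).
  apply: expbD; first by apply: expbD => //; exact: expbN.
  by apply: expbN; apply: expbM => //; exact: expb_cst.
apply: (le_trans (EX_norm subU e4)).
rewrite /matched_curv mulrAC -EXZ//; last exact: expb_sq.
apply: EX_le => //.
- by apply: (@expb_le _ _ _ _ e4) => k; rewrite normr_id.
- by apply: expbM; [exact: expb_cst|exact: expb_sq].
move=> d; rewrite mulrAC.
apply: le_trans (bern_taylor d g01 g01' leftover_norm).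
rewrite le_eqVlt; apply/orP; left; apply/eqP; congr (`|_ - _|).
rewrite mulNr -mulrN -mulrN; congr (_ * (_ * _)).
by rewrite -mulN1r -bernZ; apply: eq_bern => k; rewrite leftover_diff mulN1r.
Qed.

Lemma fluid_matched0 : fluid_matched 0 = 0.
Proof.
rewrite /fluid_matched (@eq_EX _ _ _ (fun=> Ec)); last first.
  move=> d; have -> : Ec = leftover 0.
    by rewrite /leftover /mean_capacity; apply: eq_bigr => c _; rewrite addn0.
  by elim: d => [//|d IH] /=; rewrite mul0r add0r subr0 mul1r.
by rewrite EX_cst// subrr.
Qed.

End Model.

(** * Solving the differential equation *)

Section RealAnalysis.
Variable R : realType.

Lemma continuous_sumr (r : seq nat) (f : nat -> R -> R) :
  (forall k, continuous (f k)) -> continuous (fun g => \sum_(k <- r) f k g).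
Proof.
move=> fc; elim: r => [|k r IH] x.
  rewrite (_ : (fun g => _) = fun=> 0); first exact: cst_continuous.
  by apply/funext => g; rewrite big_nil.
rewrite (_ : (fun g => _) = (fun g => f k g + \sum_(k <- r) f k g)).
  by apply: continuousD; [exact: fc|exact: IH].
by apply/funext => g; rewrite big_cons.
Qed.

Lemma lipschitz_continuous (f : R -> R) (K : R) : 0 <= K ->
  (forall x y, `|f x - f y| <= K * `|x - y|) -> continuous f.
Proof.
move=> K0 H x; apply/cvgrPdist_lt => e e0.
have K1 : 0 < K + 1 by rewrite ltr_wpDl.
near=> y; apply: (le_lt_trans (H x y)).
apply: (@le_lt_trans _ _ ((K + 1) * `|x - y|)); first by rewrite ler_wpM2r// lerDl.
rewrite mulrC -ltr_pdivlMr//; near: y.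
by exists (e / (K + 1)) => //=; rewrite divr_gt0.
Unshelve. all: by end_near. Qed.

Definition clamp (x : R) : R := Num.max 0 (Num.min 1 x).

Lemma clamp01 x : 0 <= clamp x <= 1.
Proof. by rewrite /clamp le_max lexx /= ge_max ler01 ge_min lexx. Qed.

Lemma clamp_id x : 0 <= x <= 1 -> clamp x = x.
Proof. by move=> /andP[x0 x1]; rewrite /clamp (min_idPr x1) (max_idPr x0). Qed.

Lemma clamp_lip x y : `|clamp x - clamp y| <= `|x - y|.
Proof.
have h1 : x - y <= `|x - y| by exact: ler_norm.
have h2 : y - x <= `|x - y| by rewrite distrC ler_norm.
have cE z : [\/ clamp z = 0 /\ z <= 0, clamp z = 1 /\ 1 <= z | clamp z = z /\ 0 <= z <= 1].
  have [z0|z0] := leP z 0.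
    by constructor 1; rewrite /clamp (min_idPr _) ?(max_idPl _)// (le_trans z0).
  have [z1|z1] := leP z 1; last first.
    by constructor 2; rewrite /clamp (min_idPl _) ?(max_idPr _) ?ltW.
  have z01 : 0 <= z <= 1 by rewrite (ltW z0) z1.
  by constructor 3; rewrite clamp_id// andbT ltW.
rewrite ler_norml; case: (cE x) => -[-> ?]; case: (cE y) => -[-> ?]; lra.
Qed.

Lemma within_continuous_eps (f : R -> R) (a b : R) :
  {within `[a, b], continuous f} -> forall x : R, a <= x <= b -> forall e : R, 0 < e ->
  exists d : R, 0 < d /\ forall y : R, a <= y <= b -> `|x - y| < d -> `|f x - f y| < e.
Proof.
move=> /subspace_continuousP fc x xab e e0.
have /fc /cvgrPdist_lt /(_ e e0) : `[a, b]%classic x by rewrite /= in_itv.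
move=> [d /= d0 H]; exists d; split => // y yab xy.
by apply: H => //=; rewrite in_itv.
Qed.

End RealAnalysis.

(** * The solution as the inverse of a primitive, and its uniqueness *)

Section PrimitiveInverse.
Variables (R : realType) (F : R -> R) (m K : R).
Hypothesis m0 : 0 < m.
Hypothesis K0 : 0 <= K.
Hypothesis Fb : forall g : R, 0 <= g <= 1 -> m <= F g <= 1.
Hypothesis Flip : forall g g' : R, 0 <= g <= 1 -> 0 <= g' <= 1 -> `|F g - F g'| <= K * `|g - g'|.

(** Clamping extends 1/F to the whole line with the same bounds and Lipschitz constant, so that no
    one-sided derivative is needed at 0 or 1. *)
Definition slowness (g : R) : R := (F (clamp g))^-1.

Lemma F_gt0 g : 0 <= g <= 1 -> 0 < F g.
Proof. by move=> /Fb /andP[mF _]; exact: lt_le_trans mF. Qed.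

Lemma slowness_ge1 g : 1 <= slowness g.
Proof.
have /andP[_ h] := Fb (clamp01 g); rewrite -[leLHS]invr1 lef_pV2 ?posrE//.
exact: F_gt0 (clamp01 g).
Qed.

Lemma slowness_le g : slowness g <= m^-1.
Proof.
have /andP[h _] := Fb (clamp01 g); rewrite lef_pV2 ?posrE//.
exact: F_gt0 (clamp01 g).
Qed.

Lemma slowness_lip g g' : `|slowness g - slowness g'| <= K / m ^+ 2 * `|g - g'|.
Proof.
have h := clamp01 g; have h' := clamp01 g'.
have f0 := F_gt0 h; have f0' := F_gt0 h'.
rewrite /slowness.
have -> : (F (clamp g))^-1 - (F (clamp g'))^-1 =
    (F (clamp g') - F (clamp g)) * ((F (clamp g))^-1 * (F (clamp g'))^-1).
  by field; rewrite !gt_eqF.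
rewrite normrM (_ : K / m ^+ 2 * _ = K * `|g - g'| * (m^-1 * m^-1)); last first.
  by rewrite expr2 invfM; ring.
apply: ler_pM => //.
  rewrite distrC; apply: (le_trans (Flip h h')).
  by rewrite ler_wpM2l// clamp_lip.
rewrite ger0_norm; last by rewrite mulr_ge0// invr_ge0 ltW.
have /andP[mF _] := Fb h; have /andP[mF' _] := Fb h'.
by apply: ler_pM; rewrite ?lef_pV2 ?posrE// invr_ge0 ltW.
Qed.

Lemma slowness_continuous : continuous slowness.
Proof.
apply: (@lipschitz_continuous _ _ (K / m ^+ 2)); last exact: slowness_lip.
by rewrite divr_ge0// exprn_ge0// ltW.
Qed.

Lemma exists_primitive : exists Phi : R -> R, Phi 0 = 0 /\
  forall x : R, -1 < x -> is_derive x (1 : R) Phi (slowness x).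
Proof.
(* Integrating from -1 makes 0 an interior point, so that the primitive is differentiable there in
   the two-sided sense. *)
pose P (x : R) : R := (\int[@lebesgue_measure R]_(t in `[-1, x]) slowness t)%R.
exists (fun x => P x - P 0); split; first by rewrite subrr.
move=> x x1.
have xx1 : x < x + 1 by rewrite ltrDl.
have ig : (@lebesgue_measure R).-integrable `[-1, (x + 1)] (EFin \o slowness).
  apply: continuous_compact_integrable; first exact: segment_compact.
  by apply: continuous_subspaceT; exact: slowness_continuous.
have cx : {for x, continuous slowness} by exact: slowness_continuous.
have [|d dE] := @continuous_FTC1 R slowness (BLeft (-1)) x (x + 1) xx1 ig _ cx.
  by rewrite /Order.lt/= ?ltW.
have hd : is_derive x (1 : R) P (slowness x).
  by apply: DeriveDef; [exact: d|rewrite -derive1E; exact: dE].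
rewrite -[slowness x]subr0.
by apply: is_deriveB.
Qed.

Section WithPrimitive.
Variable Phi : R -> R.
Hypothesis Phi0 : Phi 0 = 0.
Hypothesis dPhi : forall x : R, -1 < x -> is_derive x (1 : R) Phi (slowness x).

Lemma Phi_continuous x : -1 < x -> {for x, continuous Phi}.
Proof.
move=> /dPhi dx; apply: differentiable_continuous.
by apply/derivable1_diffP; exact: ex_derive.
Qed.

Lemma Phi_within a b : -1 < a -> {within `[a, b], continuous Phi}.
Proof.
move=> a1; apply: continuous_in_subspaceT => x; rewrite inE/= in_itv/= => /andP[ax _].
exact/Phi_continuous/(lt_le_trans a1).
Qed.

Lemma Phi_MVT x y : 0 <= x -> x <= y -> exists2 c, x <= c <= y &
  Phi y - Phi x = slowness c * (y - x).
Proof.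
move=> x0 xy; have x1 : -1 < x by apply: lt_le_trans x0; rewrite ltrN10.
have [||c] := @MVT_segment R Phi slowness x y xy.
- move=> z; rewrite in_itv/= => /andP[xz _].
  exact/dPhi/(lt_trans x1).
- exact: Phi_within.
by rewrite in_itv/= => cxy E; exists c.
Qed.

(** The derivative of [Phi] is at least 1 because F <= 1. This gives the injectivity of [Phi], the
    Lipschitz bound on its inverse, and later the passage from errors on [Phi] to errors on the
    position. *)
Lemma Phi_expand x y : 0 <= x -> x <= y -> y - x <= Phi y - Phi x.
Proof.
move=> x0 xy; have [c _ ->] := Phi_MVT x0 xy.
by rewrite ler_peMl ?subr_ge0// slowness_ge1.
Qed.

Lemma Phi_expand_norm x y : 0 <= x -> 0 <= y -> `|y - x| <= `|Phi y - Phi x|.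
Proof.
wlog xy : x y / x <= y.
  move=> W x0 y0; have [xy|/ltW yx] := leP x y; first exact: W.
  by rewrite distrC [leRHS]distrC; exact: W.
move=> x0 y0; rewrite ger0_norm ?subr_ge0//.
exact: le_trans (Phi_expand x0 xy) (ler_norm _).
Qed.

Lemma Phi_inj x y : 0 <= x -> 0 <= y -> Phi x = Phi y -> x = y.
Proof.
move=> x0 y0 E; have := Phi_expand_norm x0 y0.
by rewrite E subrr normr0 normr_le0 subr_eq0 => /eqP.
Qed.

Lemma Phi_taylor x y : 0 <= x -> x <= y ->
  `|Phi y - Phi x - slowness x * (y - x)| <= K / m ^+ 2 * (y - x) ^+ 2.
Proof.
move=> x0 xy; have [c /andP[xc cy] ->] := Phi_MVT x0 xy.
rewrite -mulrBl normrM expr2 mulrA (ger0_norm (_ : 0 <= y - x)) ?subr_ge0//.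
rewrite ler_wpM2r ?subr_ge0//; apply: (le_trans (slowness_lip _ _)).
rewrite ler_wpM2l ?divr_ge0 ?exprn_ge0 ?(ltW m0)//.
by rewrite ger0_norm ?subr_ge0// lerD2r.
Qed.

Lemma Phi_surj s : 0 <= s <= 1 -> exists g, 0 <= g <= 1 /\ Phi g = s.
Proof.
move=> /andP[s0 s1].
have P1 : 1 <= Phi 1 by have := Phi_expand (lexx 0) ler01; rewrite Phi0 !subr0.
have [||c] := @IVT R Phi 0 1 s ler01.
- by apply: Phi_within; rewrite ltrN10.
- rewrite Phi0 (min_idPl _) ?(le_trans ler01 P1)// s0/=.
  by rewrite (max_idPr _) ?(le_trans ler01 P1)// (le_trans s1).
by rewrite in_itv/= => c01 cs; exists c.
Qed.

(* [Phi], a primitive of 1/F, is the time at which the solution reaches a given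
   value; times are clamped to [0, 1] to make the inverse total. *)
Definition fluid_time s : R := xget 0 [set g | 0 <= g <= 1 /\ Phi g = clamp s].

Lemma fluid_timeP s : 0 <= fluid_time s <= 1 /\ Phi (fluid_time s) = clamp s.
Proof.
rewrite /fluid_time; have [g gP] := Phi_surj (clamp01 s).
exact: (@xgetPex _ 0 [set g | 0 <= g <= 1 /\ Phi g = clamp s] (ex_intro _ g gP)).
Qed.

Lemma fluid_timeK g s : 0 <= g <= 1 -> Phi g = clamp s -> fluid_time s = g.
Proof.
move=> /andP[g0 _] gs; have [/andP[h0 _] hs] := fluid_timeP s.
by apply: Phi_inj => //; rewrite hs gs.
Qed.

Lemma fluid_time_lip s s' : `|fluid_time s - fluid_time s'| <= 1 * `|s - s'|.
Proof.
have [/andP[h0 _] hs] := fluid_timeP s; have [/andP[h0' _] hs'] := fluid_timeP s'.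
rewrite mul1r; apply: (le_trans (Phi_expand_norm h0' h0)).
by rewrite hs hs' clamp_lip.
Qed.

Lemma fluid_time_continuous : continuous fluid_time.
Proof. exact: (lipschitz_continuous ler01 fluid_time_lip). Qed.

Lemma fluid_time0 : fluid_time 0 = 0.
Proof. by apply: fluid_timeK; rewrite ?lexx ?ler01// clamp_id ?lexx ?ler01. Qed.

Lemma fluid_time_le s : 0 <= s <= 1 -> fluid_time s <= s.
Proof.
move=> s01; have [/andP[h0 _] hs] := fluid_timeP s.
by have := Phi_expand (lexx 0) h0; rewrite hs clamp_id// Phi0 !subr0.
Qed.

Lemma fluid_time_ge0 s : 0 <= fluid_time s.
Proof. by have [/andP[]] := fluid_timeP s. Qed.

Lemma fluid_time_derive (s : R) : 0 < s < 1 ->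
  is_derive s (1 : R) fluid_time (F (fluid_time s)).
Proof.
move=> /andP[s0 s1].
have s01 : 0 <= s <= 1 by rewrite !ltW.
have [/andP[h0 h1] hs] := fluid_timeP s; rewrite (clamp_id s01) in hs.
set g := fluid_time s in h0 h1 hs *.
(* For y strictly between 0 and [fluid_time 1] one has 0 < Phi y < 1: clamping is inactive near s,
   and the inverse function theorem applies. *)
have [/andP[e0 e1] e] := fluid_timeP 1.
rewrite clamp_id ?ler01 ?lexx// in e; set g1 := fluid_time 1 in e0 e1 e.
have g0 : 0 < g.
  rewrite lt_def h0 andbT; apply: contraTneq s0 => gg.
  by rewrite -hs gg Phi0 ltxx.
have gg1 : g < g1.
  rewrite ltNge; apply/negP => g1g; have := Phi_expand e0 g1g.
  by rewrite hs e; lra.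
have gm : -1 < g by lra.
have -> : F g = (slowness g)^-1 by rewrite /slowness invrK clamp_id// h0.
rewrite -{1}hs; apply: is_derive_inverse.
- near=> y.
  have y0 : 0 < y by near: y; apply: lt_nbhsr.
  have y1 : y < g1 by near: y; apply: lt_nbhsl.
  have yP := Phi_expand (lexx 0) (ltW y0); have yP1 := Phi_expand (ltW y0) (ltW y1).
  rewrite Phi0 e in yP yP1.
  apply: fluid_timeK; first by rewrite !ltW//; lra.
  by rewrite clamp_id//; lra.
- near=> y; apply: Phi_continuous.
  by near: y; apply: lt_nbhsr.
- exact: dPhi.
- by rewrite gt_eqF// (lt_le_trans ltr01)// slowness_ge1.
Unshelve. all: by end_near. Qed.

(** A continuation argument. Nothing prevents [H] a priori from leaving [0, 1[, where alone [f] is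
    known. Let T be the supremum of the times up to which [H] agrees with [fluid_time]. If T < 1
    then H(T) < 1; just after T, positivity of [f] near H(T) keeps [H] above H(T), hence inside [0,
    1[, where Phi(H(s)) has derivative 1. *)
Lemma fluid_time_unique (f H : R -> R) :
  (forall g : R, 0 <= g < 1 -> {for g, continuous f}) ->
  (forall g : R, 0 <= g < 1 -> f g = F g) ->
  {within `[0, 1], continuous H} -> H 0 = 0 ->
  (forall s : R, s \in `]0, 1[ -> is_derive s (1 : R) H (f (H s))) ->
  {in `[0, 1], H =1 fluid_time}.
Proof.
move=> fc fF Hc H0 dH.
have He := within_continuous_eps Hc.
pose S := [set t : R | 0 <= t <= 1 /\ forall s, 0 <= s <= t -> H s = fluid_time s].
have S0 : S 0.
  split; first by rewrite lexx ler01.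
  move=> s; rewrite -eq_le => /eqP <-; by rewrite H0 fluid_time0.
have supS : has_sup S by split; [exists 0|exists 1 => t [/andP[]]].
set T := sup S.
have T0 : 0 <= T by apply: ub_le_sup => //; case: supS.
have T1 : T <= 1 by apply: ge_sup; [exists 0|move=> t [/andP[]]].
have ltT s : 0 <= s -> s < T -> H s = fluid_time s.
  move=> s0 sT; have Ts : 0 < T - s by rewrite subr_gt0.
  have [t [tS tE] st] := sup_adherent Ts supS.
  by apply: tE; rewrite s0/=; move: st; rewrite -/T; lra.
have atT : H T = fluid_time T.
  have [T00|Tn0] := eqVneq T 0; first by rewrite T00 H0 fluid_time0.
  have Tp : 0 < T by rewrite lt_def Tn0.
  apply: contrapT => /eqP; rewrite -subr_eq0 -normr_gt0 => e0.
  set e := `|H T - fluid_time T| in e0.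
  have T01 : 0 <= T <= 1 by rewrite T0.
  have e3 : 0 < e / 3 by rewrite divr_gt0.
  have [d [d0 Hd]] := He T T01 (e / 3) e3.
  (* At T - r the two functions agree, and between T - r and T each moves by at most e / 3, too
     little for a gap e at T. *)
  pose r := Num.min T (Num.min (d / 2) (e / 3)).
  have r0 : 0 < r by rewrite !lt_min Tp !divr_gt0.
  have rT : r <= T by rewrite ge_min lexx.
  have rd : r <= d / 2 by rewrite !ge_min lexx orbT.
  have re : r <= e / 3 by rewrite !ge_min lexx !orbT.
  have sP : `|T - (T - r)| = r by rewrite opprB addrC subrK gtr0_norm.
  have h1 : 0 <= T - r <= 1 by lra.
  have h2 : r < d by lra.
  have {}Hd := Hd (T - r) h1; rewrite sP in Hd; have {}Hd := Hd h2.
  have E : H (T - r) = fluid_time (T - r) by apply: ltT; lra.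
  rewrite E in Hd.
  have := fluid_time_lip T (T - r); rewrite sP mul1r => hl.
  have : e <= `|H T - fluid_time (T - r)| + `|fluid_time T - fluid_time (T - r)|.
    rewrite /e -[X in `|X|](subrKA (fluid_time (T - r))).
    by rewrite (le_trans (ler_normD _ _))// lerD2l distrC.
  lra.
have leT s : 0 <= s <= T -> H s = fluid_time s.
  move=> /andP[s0]; rewrite le_eqVlt => /orP[/eqP ->//|]; exact: ltT.
have TE : T = 1.
  apply/eqP; rewrite eq_le T1 /= leNgt; apply/negP => T1'.
  set g := fluid_time T in atT.
  have T01 : 0 <= T <= 1 by rewrite T0.
  have g0 : 0 <= g by exact: fluid_time_ge0.
  have g1 : g < 1 by apply: le_lt_trans T1'; exact: fluid_time_le.
  have gP : Phi g = T by have [_ ->] := fluid_timeP T; rewrite clamp_id.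
  have g01 : 0 <= g < 1 by rewrite g0.
  have fg0 : 0 < f g by rewrite fF// F_gt0// g0 ltW.
  have [d /= d0 fd] : \forall y \near g, 0 < f y.
    by have /cvgr_gt := fc g g01; apply.
  pose d' := Num.min d (1 - g).
  have d'0 : 0 < d' by rewrite lt_min d0 subr_gt0.
  have d'd : d' <= d by rewrite ge_min lexx.
  have d'g : d' <= 1 - g by rewrite ge_min lexx orbT.
  have [e [e0 Hd]] := He T T01 d' d'0.
  pose r := Num.min (e / 2) (1 - T).
  have r0 : 0 < r by rewrite lt_min divr_gt0// subr_gt0.
  have re : r <= e / 2 by rewrite ge_min lexx.
  have r1 : r <= 1 - T by rewrite ge_min lexx orbT.
  have near_g s : T <= s <= T + r -> `|g - H s| < d'.
    by move=> /andP[Ts sr]; rewrite -atT; apply: Hd; [lra|rewrite ler0_norm; lra].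
  have Hwithin s : s <= T + r -> {within `[T, s], continuous H}.
    move=> sr; apply: continuous_subspaceW Hc => z /=; rewrite !in_itv/=; lra.
  (* The mean value theorem yields the lower bound: the derivative f(H(c)) is positive because H(c)
     is within d of g. *)
  have Hpos s : T < s <= T + r -> g <= H s /\ H s < 1.
    move=> /andP[Ts sr].
    have := near_g s; rewrite (ltW Ts) sr => /(_ isT) hs.
    split; last by have := ler_norm (H s - g); rewrite distrC; lra.
    have D1 z : z \in `]T, s[ -> is_derive z (1 : R) H ((f \o H) z).
      rewrite in_itv/= => /andP[Tz zs]; apply: dH; rewrite in_itv/=.
      apply/andP; split; first exact: le_lt_trans Tz.
      by apply: (lt_le_trans zs); apply: (le_trans sr); rewrite -lerBrDl.
    have W1 : {within `[T, s], continuous H} by exact: Hwithin.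
    have [c cP E] := MVT_segment (ltW Ts) D1 W1.
    move: cP; rewrite in_itv/= => /andP[Tc cs]; rewrite atT in E.
    have : 0 < f (H c).
      apply: fd; rewrite /ball/=; apply: lt_le_trans d'd; apply: near_g; lra.
    move=> fc0; rewrite -subr_ge0 E mulr_ge0 ?(ltW fc0)//; lra.
  have Hin s : T <= s <= T + r -> 0 <= H s < 1.
    rewrite le_eqVlt => /andP[/orP[/eqP <- _|Ts sr]]; first by rewrite atT g0.
    by have [|h1 h2] := Hpos s; [rewrite Ts sr|rewrite h2 (le_trans g0)].
  have PhiH s : T <= s <= T + r -> Phi (H s) = s.
    move=> /andP[Ts sr].
    have D1 z : z \in `]T, s[ -> is_derive z (1 : R) (Phi \o H) 1.
      rewrite in_itv/= => /andP[Tz zs].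
      have zr : T <= z <= T + r by rewrite (ltW Tz) (le_trans (ltW zs)).
      have /andP[z0 zlt1] := Hin z zr.
      have z1 : z \in `]0, 1[.
        rewrite in_itv/= (le_lt_trans T0 Tz) (lt_le_trans zs)// (le_trans sr)//.
        by rewrite addrC -lerBrDr.
      have Hm : -1 < H z by apply: lt_le_trans z0; rewrite ltrN10.
      have := @is_derive1_comp R Phi H z _ _ (dPhi Hm) (dH z z1).
      rewrite fF ?z0// /slowness clamp_id ?z0 ?(ltW zlt1)//.
      by rewrite mulVf// gt_eqF// F_gt0// z0 ltW.
    have W1 : {within `[T, s], continuous (Phi \o H)}.
      apply/subspace_continuousP => z; rewrite /= in_itv/= => zin.
      have /andP[z0 _] : 0 <= H z < 1.
        by apply: Hin; case/andP: zin => -> zs; rewrite (le_trans zs).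
      have /subspace_continuousP/(_ z) := Hwithin s sr; rewrite /= in_itv/= => /(_ zin) cz.
      by apply: (cvg_comp _ _ cz); apply: Phi_continuous; apply: lt_le_trans z0; rewrite ltrN10.
    have [c _ E] := MVT_segment Ts D1 W1.
    by move: E; rewrite /= atT gP mul1r => /addIr.
  have : T + r <= T.
    apply: ub_le_sup; first by case: supS.
    split; first lra.
    move=> s /andP[s0 sr]; have [sT|Ts] := leP s T; first by apply: leT; rewrite s0.
    have Tsr : T <= s <= T + r by rewrite (ltW Ts).
    apply/esym/fluid_timeK; first by have := Hin s Tsr; lra.
    by rewrite PhiH// clamp_id//; lra.
  by rewrite gerDl leNgt r0.
by move=> s; rewrite in_itv/= => s01; apply: leT; rewrite TE.
Qed.

End WithPrimitive.
End PrimitiveInverse.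

(** * Independent degrees *)

Section SumFamilies.
Variable R : realType.
Local Open Scope ereal_scope.

Lemma esumZ (T : choiceType) (c : R) (f : T -> R) : (0 <= c)%R ->
  (forall x, (0 <= f x)%R) ->
  \esum_(x in [set: T]) (c * f x)%:E = c%:E * \esum_(x in [set: T]) (f x)%:E.
Proof.
move=> c0 f0.
(* One inequality suffices: the converse is this one for the inverse of c. *)
have le (c' : R) (g : T -> R) : (0 <= c')%R -> (forall x, (0 <= g x)%R) ->
    \esum_(x in [set: T]) (c' * g x)%:E <= c'%:E * \esum_(x in [set: T]) (g x)%:E.
  move=> c'0 g0; rewrite [leLHS]/esum; apply: ge_ereal_sup => _ [F [finF _] <-].
  rewrite (eq_fsbigr (fun x => c'%:E * (g x)%:E)); last by move=> x _; rewrite EFinM.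
  rewrite -ge0_mule_fsumr//.
  apply: lee_wpmul2l; first by rewrite lee_fin.
  by apply: esum_ge; exists F.
apply/eqP; rewrite eq_le le//=.
have [->|cn0] := eqVneq c 0%R.
  by rewrite mul0e esum_ge0// => x _; rewrite mul0r.
have cp : (0 < c)%R by rewrite lt_def cn0.
have := le (c^-1)%R (fun x => c * f x)%R; rewrite invr_ge0 c0 => /(_ isT).
move=> /(_ (fun x => mulr_ge0 c0 (f0 x))).
under eq_esum => x _ do rewrite mulrA mulVf// mul1r.
move=> h; apply: (le_trans (lee_wpmul2l _ h)); first by rewrite lee_fin.
by rewrite muleA -EFinM divff// mul1e.
Qed.

Lemma esum_pair (T1 T2 : choiceType) (f : T1 -> R) (g : T2 -> R) (b : R) :
  (forall x, (0 <= f x)%R) -> (forall y, (0 <= g y)%R) ->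
  \esum_(y in [set: T2]) (g y)%:E = b%:E ->
  \esum_(z in [set: T1 * T2]) (f z.1 * g z.2)%:E =
  b%:E * \esum_(x in [set: T1]) (f x)%:E.
Proof.
move=> f0 g0 gb; have b0 : (0 <= b)%R.
  by rewrite -lee_fin -gb; apply: esum_ge0 => y _; rewrite lee_fin.
rewrite -esumZ//.
have -> : [set: T1 * T2] = [set: T1] `*`` (fun=> [set: T2]).
  by apply/seteqP; split.
rewrite -(@esum_esum R T1 T2 [set: T1] (fun=> [set: T2]) (fun x y => (f x * g y)%:E)); last first.
  by move=> x y _ _; rewrite lee_fin mulr_ge0.
by apply: eq_esum => x _; rewrite esumZ// gb -EFinM mulrC.
Qed.

Lemma esum_ffun n (a : 'I_n -> nat -> R) (A : 'I_n -> R) :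
  (forall i k, (0 <= a i k)%R) ->
  (forall i, \esum_(k in [set: nat]) (a i k)%:E = (A i)%:E) ->
  \esum_(d in [set: {ffun 'I_n -> nat}]) (\prod_(i < n) a i (d i))%:E =
  (\prod_(i < n) A i)%:E.
Proof.
elim: n a A => [|n IH] a A a0 aA.
  have -> : [set: {ffun 'I_0 -> nat}] = [set [ffun=> 0%N]].
    by apply/seteqP; split => // d _; apply/ffunP => -[].
  by rewrite esum_set1 !big_ord0.
pose e (z : {ffun 'I_n -> nat} * nat) : {ffun 'I_n.+1 -> nat} :=
  [ffun i => if unlift ord0 i is Some j then z.1 j else z.2].
have e0 z : e z ord0 = z.2 by rewrite ffunE unlift_none.
have eS z j : e z (lift ord0 j) = z.1 j by rewrite ffunE liftK.
rewrite (reindex_esum [set: {ffun 'I_n -> nat} * nat] _ e); last first.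
  split => //.
    move=> [d k] [d' k'] _ _ E; congr (_, _); last first.
      by have := congr1 (fun h : {ffun _ -> nat} => h ord0) E; rewrite !e0.
    apply/ffunP => j.
    by have := congr1 (fun h : {ffun _ -> nat} => h (lift ord0 j)) E; rewrite !eS.
  move=> d _; exists ([ffun j => d (lift ord0 j)], d ord0) => //.
  apply/ffunP => i; rewrite ffunE; case: unliftP => [j ->|->] //=.
  by rewrite ffunE.
transitivity (\esum_(z in [set: {ffun 'I_n -> nat} * nat])
    ((\prod_(i < n) a (lift ord0 i) (z.1 i)) * a ord0 z.2)%:E).
  apply: eq_esum => z _; rewrite big_ord_recl e0 mulrC; congr (_ * _)%:E.
  by apply: eq_bigr => i _; rewrite eS.
pose w (d : {ffun 'I_n -> nat}) := (\prod_(i < n) a (lift ord0 i) (d i))%R.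
have w0 d : (0 <= w d)%R by exact: prodr_ge0.
rewrite (esum_pair w0 (a0 ord0) (aA ord0)) /w.
by rewrite (IH (fun i => a (lift ord0 i)) (fun i => A (lift ord0 i)))// -EFinM big_ord_recl.
Qed.

End SumFamilies.

Section IndependentDegrees.
Variables (R : realType) (pi : probability nat R).
Hypothesis subG : sub_gaussian pi.
Variable n : nat.
Local Notation degs := {ffun 'I_n -> nat}.
Implicit Types (f : nat -> R) (F : degs -> R).

Definition deg_weight (d : degs) : R := \prod_(i < n) prob_at pi (d i).

(** Expectation over i.i.d. degrees, used for nonnegative [F] only: it is a supremum of finite sums,
    possibly infinite, and no integrability has to be carried along. *)
Definition Edeg F : \bar R := (\esum_(d in [set: degs]) (deg_weight d * F d)%:E)%E.

Lemma deg_weight_ge0 d : 0 <= deg_weight d.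
Proof. by apply: prodr_ge0 => i _; exact: prob_at_ge0. Qed.

Lemma Edeg_le F F' : (forall d, F d <= F' d) -> (Edeg F <= Edeg F')%E.
Proof. by move=> FF'; apply: le_esum => d _; rewrite lee_fin ler_wpM2l ?deg_weight_ge0. Qed.

Lemma eq_Edeg F F' : F =1 F' -> Edeg F = Edeg F'.
Proof. by move=> FF'; apply: eq_esum => d _; rewrite FF'. Qed.

Lemma Edeg_ge0 F : (forall d, 0 <= F d) -> (0 <= Edeg F)%E.
Proof. by move=> F0; apply: esum_ge0 => d _; rewrite lee_fin mulr_ge0 ?deg_weight_ge0. Qed.

Lemma EdegD F F' : (forall d, 0 <= F d) -> (forall d, 0 <= F' d) ->
  Edeg (fun d => F d + F' d) = (Edeg F + Edeg F')%E.
Proof.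
move=> F0 F'0; rewrite /Edeg -esumD; last 2 first.
- by move=> d _; rewrite lee_fin mulr_ge0 ?deg_weight_ge0.
- by move=> d _; rewrite lee_fin mulr_ge0 ?deg_weight_ge0.
by apply: eq_esum => d _; rewrite -EFinD mulrDr.
Qed.

Lemma EdegZ c F : 0 <= c -> (forall d, 0 <= F d) ->
  Edeg (fun d => c * F d) = (c%:E * Edeg F)%E.
Proof.
move=> c0 F0; rewrite /Edeg -esumZ//; last by move=> d; rewrite mulr_ge0 ?deg_weight_ge0.
by apply: eq_esum => d _; rewrite mulrCA.
Qed.

Lemma Edeg_prod (g : 'I_n -> nat -> R) : (forall i k, 0 <= g i k) ->
  (forall i, expb (g i)) ->
  Edeg (fun d => \prod_(i < n) g i (d i)) = (\prod_(i < n) EX pi (g i))%:E.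
Proof.
move=> g0 gb; rewrite /Edeg /deg_weight.
under eq_esum => d _ do rewrite -big_split/=.
apply: (@esum_ffun _ _ (fun i k => prob_at pi k * g i k) (fun i => EX pi (g i))).
- by move=> i k; rewrite mulr_ge0 ?prob_at_ge0.
- by move=> i; rewrite EX_esum.
Qed.

Lemma Edeg_cst c : 0 <= c -> Edeg (fun=> c) = c%:E.
Proof.
move=> c0; transitivity (Edeg (fun d => c * \prod_(i < n) 1)).
  by apply: eq_Edeg => d; rewrite big1 ?mulr1.
rewrite EdegZ//; last by move=> d; rewrite prodr_ge0.
rewrite (Edeg_prod (g := fun _ _ => 1))//; last by move=> i; exact: expb_cst.
by rewrite big1 ?mule1// => i _; rewrite EX1.
Qed.

Lemma Edeg1 f i : (forall k, 0 <= f k) -> expb f ->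
  Edeg (fun d => f (d i)) = (EX pi f)%:E.
Proof.
move=> f0 fb; pose g j k := if j == i then f k else 1.
transitivity (Edeg (fun d => \prod_(j < n) g j (d j))).
  apply: eq_Edeg => d; rewrite (bigD1 i)//= /g eqxx big1 ?mulr1// => j /negbTE -> //.
rewrite Edeg_prod; last 2 first.
- by move=> j k; rewrite /g; case: (j == i).
- by move=> j; rewrite /g; case: (j == i) => //; exact: expb_cst.
rewrite (bigD1 i)//= [X in _ * X]big1 ?mulr1.
  by congr (_%:E); apply: eq_EX => k; rewrite /g eqxx.
move=> j /negbTE ji; rewrite -(EX1 subG).
by apply: eq_EX => k; rewrite /g ji.
Qed.

Lemma Edeg2 f i j : i != j -> (forall k, 0 <= f k) -> expb f ->
  Edeg (fun d => f (d i) * f (d j)) = (EX pi f ^+ 2)%:E.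
Proof.
move=> ij f0 fb; pose g l k := if (l == i) || (l == j) then f k else 1.
transitivity (Edeg (fun d => \prod_(l < n) g l (d l))).
  apply: eq_Edeg => d; rewrite (bigD1 i)//= (bigD1 j)/= 1?eq_sym// /g !eqxx orbT.
  by rewrite big1 ?mulr1// => l /andP[/negbTE -> /negbTE ->].
rewrite Edeg_prod; last 2 first.
- by move=> l k; rewrite /g; case: (_ || _).
- by move=> l; rewrite /g; case: (_ || _) => //; exact: expb_cst.
rewrite (bigD1 i)//= (bigD1 j)/= 1?eq_sym// [X in _ * (_ * X)]big1 ?mulr1.
  by rewrite expr2; congr (_ * _)%:E; apply: eq_EX => k; rewrite /g eqxx ?orbT.
move=> l /andP[/negbTE li /negbTE lj]; rewrite -(EX1 subG).
by apply: eq_EX => k; rewrite /g li lj.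
Qed.

Lemma Edeg_sum (I : Type) (r : seq I) (P : pred I) (F : I -> degs -> R) :
  (forall i d, P i -> 0 <= F i d) ->
  Edeg (fun d => \sum_(i <- r | P i) F i d) = (\sum_(i <- r | P i) Edeg (F i))%E.
Proof.
move=> F0; elim: r => [|i r IH].
  rewrite big_nil; transitivity (Edeg (fun=> 0)); last exact: (Edeg_cst (lexx 0)).
  by apply: eq_Edeg => d; rewrite big_nil.
rewrite big_cons -IH; case: ifPn => Pi.
  rewrite -EdegD; last 2 first.
  - by move=> d; exact: F0.
  - by move=> d; apply: sumr_ge0 => j Pj; exact: F0.
  by apply: eq_Edeg => d; rewrite big_cons Pi.
by apply: eq_Edeg => d; rewrite big_cons (negbTE Pi).
Qed.

(** Independence turns each product over distinct indices into the squared mean, leaving #|A|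
    variances. *)
Lemma Edeg_variance f (A : pred 'I_n) : (forall k, 0 <= f k) -> expb f ->
  (Edeg (fun d => (\sum_(i | A i) f (d i) - #|A|%:R * EX pi f) ^+ 2)%R <=
   (n%:R * EX pi (fun k => f k ^+ 2))%R%:E)%E.
Proof.
move=> f0 fb; set m := EX pi f; set v := EX pi _; set k : R := #|A|%:R.
have m0 : 0 <= m by exact: EX_ge0.
have k0 : 0 <= k by [].
have fb2 : expb (fun k => f k ^+ 2) by exact: expbX.
have v0 : 0 <= v by apply: EX_ge0 => // j; rewrite sqr_ge0.
pose S (d : degs) : R := \sum_(i | A i) f (d i).
have S0 d : 0 <= S d by apply: sumr_ge0.
have ES : Edeg S = (k * m)%:E.
  rewrite /S Edeg_sum//; under eq_bigr do rewrite Edeg1//.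
  by rewrite sumEFin sumr_const -[_ *+ _]mulr_natl.
have ES2 : Edeg (fun d => S d ^+ 2) = (k * v + (k * k - k) * m ^+ 2)%:E.
  transitivity (Edeg (fun d => \sum_(i | A i) \sum_(j | A j) f (d i) * f (d j))).
    by apply: eq_Edeg => d; rewrite expr2 /S mulr_suml; apply: eq_bigr => i _; rewrite mulr_sumr.
  rewrite Edeg_sum; last by move=> i d _; apply: sumr_ge0 => j _; rewrite mulr_ge0.
  have E i : A i -> Edeg (fun d => \sum_(j | A j) f (d i) * f (d j)) =
      (v + (k - 1) * m ^+ 2)%:E.
    move=> Ai; rewrite Edeg_sum; last by move=> j d _; rewrite mulr_ge0.
    rewrite (bigD1 i)//= (eq_bigr (fun=> (m ^+ 2)%:E)); last first.
      by move=> j /andP[_ ji]; rewrite Edeg2// eq_sym.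
    rewrite sumEFin sumr_const EFinD; congr (_ + _)%E.
      rewrite (@Edeg1 (fun k => f k * f k)); [|by move=> j; exact: mulr_ge0|exact: expbM].
      by congr (_%:E); apply: eq_EX => j; rewrite expr2.
    congr (_%:E); rewrite -[_ *+ _]mulr_natl; congr (_ * _).
    have := cardD1 i A; rewrite /in_mem /= Ai => cA.
    rewrite /k cA natrD addrAC subrr add0r; congr (_%:R); apply: eq_card => j.
    by rewrite !inE andbC.
  rewrite (eq_bigr _ E) sumEFin sumr_const -[_ *+ _]mulr_natl; congr (_%:E).
  by rewrite -/k; ring.
(* The negative cross term is moved to the left, since [Edeg] is additive on nonnegative functions;
   finiteness of the other terms then allows solving for the variance. *)
have key : (Edeg (fun d => (S d - k * m) ^+ 2)%R + (2 * k * m)%R%:E * Edeg S =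
    Edeg (fun d => S d ^+ 2)%R + (k ^+ 2 * m ^+ 2)%R%:E)%E.
  rewrite -EdegZ ?mulr_ge0// -(Edeg_cst (_ : 0 <= k ^+ 2 * m ^+ 2)) ?mulr_ge0 ?sqr_ge0//.
  rewrite -!EdegD//; try by move=> d; rewrite ?sqr_ge0// ?mulr_ge0 ?sqr_ge0.
  by apply: eq_Edeg => d; ring.
move: key; rewrite ES ES2 -EFinM -EFinD -/k.
move: (Edeg_ge0 (F := fun d => (S d - k * m) ^+ 2) (fun d => sqr_ge0 _)).
case: (Edeg _) => [e||]// e0 [E]; rewrite lee_fin.
have kn : k <= n%:R by rewrite ler_nat -[leqRHS]card_ord max_card.
have : k * v <= n%:R * v by rewrite ler_wpM2r.
have : 0 <= k * m ^+ 2 by rewrite mulr_ge0 ?sqr_ge0.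
lra.
Qed.

Lemma Edeg_markov F (c : R) : 0 < c -> (forall d, 0 <= F d) ->
  (Edeg (fun d => (c < F d)%R%:R)%R <= (c^-1)%R%:E * Edeg F)%E.
Proof.
move=> c0 F0; rewrite -EdegZ//; last by rewrite invr_ge0 ltW.
apply: Edeg_le => d.
case: ltP => [cF|_]; last by rewrite mulr_ge0// invr_ge0 ltW.
by rewrite mulrC ler_pdivlMr// mul1r ltW.
Qed.

End IndependentDegrees.

(** * Comparison with the fluid limit for fixed degrees *)

Section Abel.
Variable R : realType.

Lemma summation_by_parts (w z : nat -> R) t :
  \sum_(0 <= j < t) w j * z j = w t * (\sum_(0 <= i < t) z i) -
  \sum_(0 <= j < t) (w j.+1 - w j) * \sum_(0 <= i < j.+1) z i.
Proof.
elim: t => [|t IH]; first by rewrite !big_geq// mulr0 subrr.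
by rewrite !big_nat_recr//= IH; ring.
Qed.

Lemma abel_le (w z : nat -> R) t :
  `|\sum_(0 <= j < t) w j * z j| <= `|w t| * `|\sum_(0 <= i < t) z i| +
  \sum_(0 <= j < t) `|w j.+1 - w j| * `|\sum_(0 <= i < j.+1) z i|.
Proof.
rewrite summation_by_parts; apply: (le_trans (ler_normB _ _)); rewrite normrM lerD2l.
apply: (le_trans (ler_norm_sum _ _ _)); apply: ler_sum => j _.
by rewrite normrM.
Qed.

(** Cutting at K changes nothing unless D > K, where the loss is at most D <= D^2 / K. *)
Lemma psi_trunc D K (q : R) : (0 < K)%N -> 0 <= q <= 1 ->
  `|psi D q - \sum_(0 <= k < K) (k < D)%N%:R * (1 - q) ^+ k| <= D%:R ^+ 2 / K%:R.
Proof.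
move=> K0 q01; have /andP[q0 q1] := q01.
have KR : 0 < K%:R :> R by rewrite ltr0n.
have [DK|KD] := leqP D K.
  rewrite (_ : \sum_(0 <= k < K) _ = psi D q) ?subrr ?normr0 ?divr_ge0 ?sqr_ge0//.
  rewrite (@big_cat_nat _ _ _ D)//= [X in _ + X]big1_seq ?addr0.
    by apply: eq_big_nat => k /andP[_ kD]; rewrite kD /= mul1r.
  move=> k; rewrite mem_index_iota => /andP[_ /andP[Dk _]].
  by rewrite ltnNge Dk /= mul0r.
have -> : \sum_(0 <= k < K) (k < D)%N%:R * (1 - q) ^+ k = psi K q.
  by apply: eq_big_nat => k /andP[_ kK]; rewrite (ltn_trans kK KD) /= mul1r.
rewrite /psi (@big_cat_nat _ _ _ K)//=; last by rewrite ltnW.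
rewrite addrAC subrr add0r ger0_norm; last first.
  by apply: sumr_ge0 => k _; rewrite exprn_ge0// subr_ge0.
apply: (@le_trans _ _ D%:R).
  apply: (@le_trans _ _ (\sum_(K <= k < D) 1)).
    by apply: ler_sum => k _; rewrite exprn_ile1// ?subr_ge0//; lra.
  by rewrite sumr_const_nat ler_nat leq_subr.
rewrite ler_pdivlMr// expr2 ler_wpM2l// ler_nat ltnW//.
Qed.

End Abel.

(** A degree enters [psi] only through the indicators k < D, so after truncation at K finitely many
    such fluctuations describe the degrees for all values of q at once. *)
Definition tail_fluct (R : realType) (pi : probability nat R) (D : nat -> nat) k j : R :=
  \sum_(0 <= i < j) ((k < D i)%N%:R - EX pi (fun d => (k < d)%N%:R)).

Section Pathwise.
Variables (R : realType) (q w : R -> R) (Kq W Kw : R).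
Hypothesis q01 : forall g : R, 0 <= g <= 1 -> 0 <= q g <= 1.
Hypothesis qlip : forall g g' : R, 0 <= g <= 1 -> 0 <= g' <= 1 ->
  `|q g - q g'| <= Kq * `|g - g'|.
Hypothesis Kq0 : 0 <= Kq.
Hypothesis w0 : forall g : R, 0 <= w g <= W.
Hypothesis wlip : forall g g' : R, `|w g - w g'| <= Kw * `|g - g'|.
Hypothesis Kw0 : 0 <= Kw.
Variables (b : nat -> bool) (D : nat -> nat) (L t : nat).
Hypothesis L0 : (0 < L)%N.
Hypothesis SL : (\sum_(0 <= j < t) D j <= L)%N.

Local Notation x := (pos b D).
Local Notation sc i := (i%:R / L%:R : R).
Local Notation n := (\sum_(0 <= j < t) D j)%N.

Let W0 : 0 <= W. Proof. by have /andP[h1 h2] := w0 0; exact: le_trans h2. Qed.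
Let LR : 0 < L%:R :> R. Proof. by rewrite ltr0n. Qed.

Lemma pos_le_n j : (j <= t)%N -> (x j <= n)%N.
Proof. by move=> jt; rewrite (leq_trans (pos_le b D jt))// pos_le_sum. Qed.

Lemma sc01 i : (i <= L)%N -> 0 <= sc i <= 1.
Proof. by move=> iL; rewrite divr_ge0//= ler_pdivrMr// mul1r ler_nat. Qed.

Lemma scpos j : (j <= t)%N -> 0 <= sc (x j) <= 1.
Proof. by move=> jt; apply: sc01; exact: leq_trans (pos_le_n jt) SL. Qed.

Definition scan_coef j y i : R := w (sc y) * psi (D j - (i - y)).-1 (q (sc y)).

Lemma scan_coef_le j i : (j <= t)%N ->
  `|scan_coef j (x j) i| <= W * (D j)%:R.
Proof.
move=> jt; have qq := q01 (scpos jt); have /andP[ww1 ww2] := w0 (sc (x j)).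
have /andP[qq0 qq1] := qq.
rewrite normrM !ger0_norm ?psi_ge0// ler_pM ?psi_ge0//.
apply: (le_trans (psi_le _ qq)); rewrite ler_nat.
by rewrite (leq_trans (leq_pred _))// leq_subr.
Qed.

(** An arrival of degree D makes at most D reveals, each of weight at most W D: this is where third
    powers of degrees come from. *)
Lemma sum_scan_coef_sqr :
  \sum_(0 <= i < n) block_weight D scan_coef b t i ^+ 2 <=
  W ^+ 2 * \sum_(0 <= j < t) (D j)%:R ^+ 3.
Proof.
rewrite (@sum_block_weight _ _ _ _ _ _ (fun c _ => c ^+ 2)) ?pos_le_n//; last first.
  by move=> i; rewrite expr0n.
rewrite mulr_sumr big_seq [leRHS]big_seq; apply: ler_sum => j.
rewrite mem_index_iota => /andP[_ jt].
apply: (@le_trans _ _ (\sum_(x j <= i < x j.+1) (W * (D j)%:R) ^+ 2)).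
  apply: ler_sum => i _; rewrite -real_normK ?num_real// lerXn2r ?nnegrE ?mulr_ge0//.
  by rewrite scan_coef_le// ltnW.
rewrite sumr_const_nat -[leLHS]mulr_natl.
have : (x j.+1 - x j)%:R <= (D j)%:R :> R by rewrite ler_nat leq_subLR posS_le.
move=> h; rewrite (_ : W ^+ 2 * _ = (D j)%:R * (W * (D j)%:R) ^+ 2); last by ring.
by rewrite ler_wpM2r// sqr_ge0.
Qed.

Definition scan_noise : R :=
  \sum_(0 <= i < n) block_weight D scan_coef b t i * (q (sc i) - (b i)%:R).

(** [step_identity] is used with q frozen at the start of each arrival, while the noise has the
    current q. The change costs Kq D / L per reveal, with weight at most W D and at most D
    reveals. *)
Lemma scan_identity :
  `|\sum_(0 <= j < t) w (sc (x j)) * ((x j.+1)%:R - (x j)%:R) -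
    \sum_(0 <= j < t) w (sc (x j)) * psi (D j) (q (sc (x j))) - scan_noise|
  <= W * Kq * (\sum_(0 <= j < t) (D j)%:R ^+ 3) / L%:R.
Proof.
rewrite /scan_noise.
rewrite (@sum_block_weight _ _ _ _ _ _ (fun c i => c * (q (sc i) - (b i)%:R)))//; last 2 first.
- exact: pos_le_n.
- by move=> i; rewrite mul0r.
rewrite -!sumrB; apply: (le_trans (ler_norm_sum _ _ _)).
rewrite -mulrA mulr_suml mulr_sumr big_seq [leRHS]big_seq; apply: ler_sum => j.
rewrite mem_index_iota => /andP[_ jt].
rewrite (_ : (x j.+1)%:R - (x j)%:R = psi (D j) (q (sc (x j))) +
    \sum_(x j <= i < x j.+1) psi (D j - (i - x j)).-1 (q (sc (x j))) *
      (q (sc (x j)) - (b i)%:R)); last exact: step_identity.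
have cancel a c : a + c - a = c :> R by ring.
rewrite mulrDr cancel mulr_sumr -sumrB.
apply: (le_trans (ler_norm_sum _ _ _)).
apply: (@le_trans _ _ (\sum_(x j <= i < x j.+1) (W * (D j)%:R * (Kq * ((D j)%:R / L%:R))))).
  rewrite big_seq [leRHS]big_seq; apply: ler_sum => i.
  rewrite mem_index_iota => /andP[xi ix].
  rewrite (_ : _ - _ = scan_coef j (x j) i * (q (sc (x j)) - q (sc i))); last first.
    by rewrite /scan_coef; ring.
  have iL : (i <= L)%N by apply: leq_trans SL; exact: leq_trans (ltnW ix) (pos_le_n jt).
  rewrite normrM; apply: ler_pM => //; first by rewrite scan_coef_le// ltnW.
  apply: (le_trans (qlip (scpos (ltnW jt)) (sc01 iL))); rewrite ler_wpM2l//.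
  rewrite -mulrBl normrM (@ger0_norm _ L%:R^-1) ?invr_ge0// ler_wpM2r ?invr_ge0//.
  rewrite distrC ger0_norm ?subr_ge0 ?ler_nat//.
  rewrite lerBlDl -natrD ler_nat ltnW// (leq_trans ix)//; exact: posS_le.
rewrite sumr_const_nat -[leLHS]mulr_natl.
have : (x j.+1 - x j)%:R <= (D j)%:R :> R by rewrite ler_nat leq_subLR posS_le.
move=> h; rewrite (_ : W * Kq * _ = (D j)%:R * (W * (D j)%:R * (Kq * ((D j)%:R / L%:R)))); last by ring.
by rewrite ler_wpM2r// !mulr_ge0// invr_ge0.
Qed.

Lemma potential_increment (Phi : R -> R) :
  (forall y z : R, 0 <= y -> y <= z -> `|Phi z - Phi y - w y * (z - y)| <= Kw * (z - y) ^+ 2) ->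
  `|Phi (sc (x t)) - Phi 0 -
     L%:R^-1 * \sum_(0 <= j < t) w (sc (x j)) * ((x j.+1)%:R - (x j)%:R)| <=
  Kw * (\sum_(0 <= j < t) (D j)%:R ^+ 2) / L%:R ^+ 2.
Proof.
move=> Ptaylor.
have -> : Phi (sc (x t)) - Phi 0 = \sum_(0 <= j < t) (Phi (sc (x j.+1)) - Phi (sc (x j))).
  by rewrite telescope_sumr// mul0r.
rewrite [X in `|_ - X|]mulr_sumr -sumrB; apply: (le_trans (ler_norm_sum _ _ _)).
rewrite -mulrA mulr_suml mulr_sumr big_seq [leRHS]big_seq; apply: ler_sum => j.
rewrite mem_index_iota => /andP[_ jt].
have xx : (x j)%:R <= (x j.+1)%:R :> R by rewrite ler_nat pos_leS.
have y0 : 0 <= sc (x j) by rewrite divr_ge0.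
have yz : sc (x j) <= sc (x j.+1) by rewrite ler_pM2r ?invr_gt0.
have := Ptaylor _ _ y0 yz; rewrite -mulrBl => h.
rewrite (_ : L%:R^-1 * _ = w (sc (x j)) * (((x j.+1)%:R - (x j)%:R) / L%:R)); last by ring.
apply: (le_trans h); rewrite ler_wpM2l// exprMn exprVn ler_wpM2r ?invr_ge0 ?exprn_ge0//.
rewrite lerXn2r ?nnegrE ?subr_ge0// lerBlDl -natrD ler_nat; exact: posS_le.
Qed.

(** The weights depend on the earlier degrees and on the pairing, so the sum is not treated as one
    of independent terms. Truncating [psi] and summing by parts leaves the partial sums of the tail
    indicators, multiplied by the variation of the weights, at most of order D / L per arrival. *)
Lemma degree_average_le (pi : probability nat R) (sub : sub_gaussian pi) (K : nat) :
  (0 < K)%N ->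
  `|\sum_(0 <= j < t) w (sc (x j)) *
      (psi (D j) (q (sc (x j))) - EX pi (fun d => psi d (q (sc (x j)))))| <=
  \sum_(0 <= k < K) (W * `|tail_fluct pi D k t| + (Kw + W * K%:R * Kq) / L%:R *
      \sum_(0 <= j < t) (D j)%:R * `|tail_fluct pi D k j.+1|) +
  W / K%:R * (\sum_(0 <= j < t) (D j)%:R ^+ 2 + t%:R * EX pi (fun d => d%:R ^+ 2)).
Proof.
move=> K0; set Z := tail_fluct pi D; set v := EX pi (fun d => d%:R ^+ 2).
pose tail k := EX pi (fun d => (k < d)%N%:R).
pose tr (D0 : nat) (q0 : R) : R := \sum_(0 <= k < K) (k < D0)%N%:R * (1 - q0) ^+ k.
pose qq j := q (sc (x j)); pose ww j := w (sc (x j)).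
have KR : 0 < K%:R :> R by rewrite ltr0n.
have eb k : expb (fun d => (k < d)%N%:R : R).
  by apply: expb_le (expb_cst 1) => d; rewrite normr1 normr_nat; case: (k < d)%N.
have Etr q0 : 0 <= q0 <= 1 -> `|EX pi (fun d => psi d q0) -
    \sum_(0 <= k < K) tail k * (1 - q0) ^+ k| <= v / K%:R.
  move=> q0P.
  have eb' k : expb (fun d => (k < d)%N%:R * (1 - q0) ^+ k).
    by apply: expbM => //; exact: expb_cst.
  have -> : \sum_(0 <= k < K) tail k * (1 - q0) ^+ k = EX pi (tr ^~ q0).
    rewrite /tr EX_sum//; apply: eq_bigr => k _.
    by rewrite mulrC -EXZ//; apply: eq_EX => d; rewrite mulrC.
  have etr : expb (tr ^~ q0) by apply: expb_sum.
  rewrite -EXB//; last exact: expb_psi.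
  have ed : expb (fun d => psi d q0 - tr d q0).
    by apply: expbD; [exact: expb_psi|exact: expbN].
  apply: (le_trans (EX_norm sub ed)); rewrite mulrC -EXZ//; last exact: expb_sq.
  apply: EX_le => //.
  - by apply: (@expb_le _ _ _ _ ed) => k; rewrite normr_id.
  - by apply: expbM; [exact: expb_cst|exact: expb_sq].
  by move=> d; rewrite mulrC; exact: psi_trunc.
pose main j := \sum_(0 <= k < K) (ww j * (1 - qq j) ^+ k) * ((k < D j)%N%:R - tail k).
have approx j : (j < t)%N ->
    `|ww j * (psi (D j) (qq j) - EX pi (fun d => psi d (qq j))) - main j| <=
    W / K%:R * ((D j)%:R ^+ 2 + v).
  move=> jt; have qP : 0 <= qq j <= 1 by apply: q01; apply: scpos; rewrite ltnW.
  have -> : main j = ww j * (tr (D j) (qq j) - \sum_(0 <= k < K) tail k * (1 - qq j) ^+ k).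
    by rewrite /main /tr -sumrB mulr_sumr; apply: eq_bigr => k _; ring.
  rewrite -mulrBr normrM; have /andP[ww0 ww1] := w0 (sc (x j)).
  rewrite (_ : W / K%:R * _ = W * ((D j)%:R ^+ 2 / K%:R + v / K%:R)); last by ring.
  apply: ler_pM => //; first by rewrite ger0_norm.
  have := psi_trunc (D j) K0 qP; have := Etr _ qP; rewrite -/(tr _ _).
  set A := psi _ _; set B := EX _ _; set A' := tr _ _; set B' := \sum_(_ <= _ < _) _.
  move=> h1 h2; rewrite (_ : A - B - (A' - B') = (A - A') - (B - B')); last by ring.
  by apply: (le_trans (ler_normB _ _)); exact: lerD.
have -> : \sum_(0 <= j < t) w (sc (x j)) *
      (psi (D j) (q (sc (x j))) - EX pi (fun d => psi d (q (sc (x j))))) =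
   \sum_(0 <= j < t) main j + \sum_(0 <= j < t)
    (ww j * (psi (D j) (qq j) - EX pi (fun d => psi d (qq j))) - main j).
  by rewrite -big_split; apply: eq_bigr => j _; rewrite /= addrC subrK.
apply: (le_trans (ler_normD _ _)); apply: lerD; last first.
  apply: (le_trans (ler_norm_sum _ _ _)).
  apply: (@le_trans _ _ (\sum_(0 <= j < t) W / K%:R * ((D j)%:R ^+ 2 + v))).
    rewrite big_seq [leRHS]big_seq; apply: ler_sum => j.
    by rewrite mem_index_iota => /andP[_]; exact: approx.
  by rewrite -mulr_sumr big_split/= sumr_const_nat subn0 -[v *+ t]mulr_natl.
rewrite /main exchange_big/=; apply: (le_trans (ler_norm_sum _ _ _)).
rewrite big_seq [leRHS]big_seq; apply: ler_sum => k; rewrite mem_index_iota => /andP[_ kK].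
apply: (le_trans (abel_le _ _ _)).
have pw01 j : (j <= t)%N -> 0 <= (1 - qq j) ^+ k <= 1.
  move=> /scpos /q01 /andP[h0 h1]; rewrite exprn_ge0 ?exprn_ile1// ?subr_ge0//.
  by rewrite lerBlDr lerDl.
apply: lerD.
  rewrite ler_wpM2r// normrM; have /andP[ww0 ww1] := w0 (sc (x t)).
  have /andP[p0 p1] := pw01 t (leqnn t).
  by rewrite !ger0_norm// -[W]mulr1 ler_pM.
rewrite mulr_sumr big_seq [leRHS]big_seq; apply: ler_sum => j.
rewrite mem_index_iota => /andP[_ jt]; rewrite -/(Z k j.+1) mulrA ler_wpM2r//.
have /andP[ww0 ww1] := w0 (sc (x j.+1)).
have /andP[p0 p1] := pw01 j (ltnW jt).
have dx : `|sc (x j.+1) - sc (x j)| <= (D j)%:R / L%:R.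
  rewrite -mulrBl normrM (@ger0_norm _ L%:R^-1) ?invr_ge0// ler_wpM2r ?invr_ge0//.
  rewrite ger0_norm ?subr_ge0 ?ler_nat ?pos_leS//.
  by rewrite lerBlDl -natrD ler_nat; exact: posS_le.
have h1 : `|ww j.+1 - ww j| <= Kw * ((D j)%:R / L%:R).
  by apply: (le_trans (wlip _ _)); rewrite ler_wpM2l.
have h2 : `|(1 - qq j.+1) ^+ k - (1 - qq j) ^+ k| <= K%:R * (Kq * ((D j)%:R / L%:R)).
  have /andP[a0 a1] := q01 (scpos jt); have /andP[a0' a1'] := q01 (scpos (ltnW jt)).
  apply: (le_trans (pow_lip _ _ _)); rewrite ?subr_ge0 ?a1 ?a1' ?lerBlDr ?lerDl//.
  apply: ler_pM => //; first by rewrite ler_nat ltnW.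
  rewrite (_ : 1 - _ - _ = qq j - qq j.+1); last by rewrite /qq; ring.
  rewrite distrC; apply: (le_trans (qlip (scpos jt) (scpos (ltnW jt)))).
  by rewrite ler_wpM2l.
rewrite (_ : _ - _ = ww j.+1 * ((1 - qq j.+1) ^+ k - (1 - qq j) ^+ k) +
   (ww j.+1 - ww j) * (1 - qq j) ^+ k); last by ring.
apply: (le_trans (ler_normD _ _)); rewrite !normrM.
rewrite (_ : _ / L%:R * (D j)%:R = W * (K%:R * (Kq * ((D j)%:R / L%:R))) + Kw * ((D j)%:R / L%:R) * 1); last by ring.
by apply: lerD; apply: ler_pM => //; rewrite ger0_norm.
Qed.

Definition match_noise : R :=
  \sum_(0 <= i < n) (i < x t)%N%:R * (q (sc i) - (b i)%:R).

(** The sum of q over the reveals is a Riemann sum for L / mu times the increment of [Lam]; the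
    quadratic errors KL / L^2 of at most L steps add up to KL / mu after scaling. *)
Lemma matched_le (Lam : R -> R) (mu KL : R) : 0 < mu -> 0 <= KL -> Lam 0 = 0 ->
  (forall y z : R, 0 <= y <= 1 -> 0 <= z <= 1 ->
    `|Lam z - Lam y - mu * q y * (z - y)| <= KL * (z - y) ^+ 2) ->
  `|(\sum_(0 <= i < x t) b i)%N%:R - L%:R / mu * Lam (sc (x t)) + match_noise| <= KL / mu.
Proof.
move=> mu0 KL0 Lam0 LT.
have xn := pos_le_n (leqnn t).
have -> : match_noise = \sum_(0 <= i < x t) (q (sc i) - (b i)%:R).
  rewrite /match_noise (@big_cat_nat _ _ _ (x t))//= [X in _ + X]big1_seq ?addr0.
    by apply: eq_big_nat => i /andP[_ ix]; rewrite ix mul1r.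
  by move=> i; rewrite mem_index_iota => /andP[_ /andP[xi _]]; rewrite ltnNge xi /= mul0r.
rewrite sumrB natr_sum.
have -> : Lam (sc (x t)) = \sum_(0 <= i < x t) (Lam (sc i.+1) - Lam (sc i)).
  by rewrite telescope_sumr// mul0r Lam0 subr0.
set B := \sum_(0 <= i < x t) (b i)%:R.
rewrite (_ : B - _ + _ = - (L%:R / mu) * (\sum_(0 <= i < x t) (Lam (sc i.+1) - Lam (sc i)) -
    (mu / L%:R) * \sum_(0 <= i < x t) q (sc i))); last first.
  by field; rewrite !gt_eqF.
have Lmu0 : 0 <= L%:R / mu by rewrite divr_ge0// ltW.
rewrite mulr_sumr -sumrB normrM normrN (ger0_norm Lmu0).
apply: (@le_trans _ _ (L%:R / mu * (KL / L%:R))); last first.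
  by rewrite le_eqVlt; apply/orP; left; apply/eqP; field; rewrite !gt_eqF.
rewrite ler_wpM2l//; apply: (le_trans (ler_norm_sum _ _ _)).
apply: (@le_trans _ _ (\sum_(0 <= i < x t) KL * (1 / L%:R) ^+ 2)).
  rewrite big_seq [leRHS]big_seq; apply: ler_sum => i; rewrite mem_index_iota => /andP[_ ix].
  have iL : (i < L)%N by rewrite (leq_trans ix)// (leq_trans xn).
  have dE : sc i.+1 - sc i = 1 / L%:R by rewrite -mulrBl -[i.+1%:R]natr1 addrAC subrr add0r.
  have := LT _ _ (sc01 (ltnW iL)) (sc01 iL); rewrite dE.
  rewrite (_ : mu * q (sc i) * (1 / L%:R) = mu / L%:R * q (sc i))//; ring.
rewrite sumr_const_nat subn0 -[leLHS]mulr_natl.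
have xL : (x t)%:R <= L%:R :> R by rewrite ler_nat (leq_trans xn).
rewrite (_ : KL / L%:R = L%:R * (KL * (1 / L%:R) ^+ 2)); last by field; rewrite gt_eqF.
by rewrite ler_wpM2r// mulr_ge0// sqr_ge0.
Qed.

End Pathwise.

Section HalfEdgeSums.
Variables (R : realType) (N T : nat) (dU : 'I_N -> nat) (dV : 'I_T -> nat).
Variable omega : 'I_N -> nat.

Local Notation Uh := (Uhalf dU dV).
Definition owner (x : Uh) : option 'I_N := tag x.

Lemma sum_halves (f : option 'I_N -> R) :
  \sum_(h : Uh) f (owner h) =
  \sum_(i < N) (dU i)%:R * f (Some i) + (total_deg dV - total_deg dU)%:R * f None.
Proof.
transitivity (\sum_(x : option 'I_N) \sum_(j < ext_deg dU (total_deg dV) x) f x).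
  by rewrite (sig_big_dep _ (fun=> xpredT) (fun x _ => f x)).
under eq_bigr => x _ do rewrite sumr_const card_ord -[_ *+ _]mulr_natl.
rewrite (bigD1 None)//= addrC; congr (_ + _).
rewrite (reindex_omap Some id)/=; last by case.
by apply: eq_bigl => i; rewrite eqxx.
Qed.

Lemma card_owner u : #|[set h : Uh | owner h == Some u]%SET| = dU u.
Proof.
have : #|[set h : Uh | owner h == Some u]%SET|%:R = (dU u)%:R :> R.
  rewrite -sum1_card natr_sum big_mkcond /=.
  transitivity (\sum_(h : Uh) (owner h == Some u)%:R : R).
    by apply: eq_bigr => h _; rewrite inE; case: (_ == _).
  rewrite (sum_halves (fun x => (x == Some u)%:R)) mulr0 addr0.
  rewrite (bigD1 u)//= eqxx mulr1 big1 ?addr0// => i iu.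
  by rewrite (_ : (Some i == Some u) = false) ?mulr0//; apply/negbTE; apply: contra iu => /eqP[->].
by move=> /eqP; rewrite eqr_nat => /eqP.
Qed.

Lemma card_siblings (h : Uh) :
  #|siblings owner h| = if owner h is Some u then (dU u).-1 else 0%N.
Proof.
rewrite /siblings; case E: (owner h) => [u|]; last by rewrite cards0.
rewrite -(card_owner u) (cardsD1 h [set h | owner h == Some u]%SET) inE E eqxx add1n /=.
by apply: eq_card => y; rewrite !inE.
Qed.

Definition open_sum (g : R) : R :=
  \sum_(u < N) (dU u)%:R * bern (dU u).-1 (fun k => (k < omega u)%N%:R) g.

(** The auxiliary vertex is never open: it counts in the denominator only. *)
Lemma mean_openE g : mean_open owner omega g = open_sum g / #|Uh|%:R.
Proof.
rewrite /mean_open /avg cardsT; congr (_ / _).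
pose f (x : option 'I_N) : R := if x is Some u
  then bern (dU u).-1 (fun k => (k < omega u)%N%:R) g else 0.
transitivity (\sum_(h : Uh) f (owner h)).
  apply: eq_big => h; first by rewrite inE.
  move=> _; rewrite /open_prob card_siblings /cap_of /f; case: (owner h) => [u|] //=.
by rewrite (sum_halves f) /f mulr0 addr0.
Qed.

Lemma avg_siblings_sqr :
  avg [set: Uh]%SET (fun h => (#|siblings owner h|.+1)%:R ^+ 2 : R) <=
  (\sum_(u < N) (dU u)%:R ^+ 3 + (total_deg dV - total_deg dU)%:R) / #|Uh|%:R.
Proof.
rewrite /avg cardsT ler_wpM2r ?invr_ge0//.
pose f (x : option 'I_N) : R := if x is Some u then (dU u).-1.+1%:R ^+ 2 else 1.
rewrite (_ : \sum_(x in _) _ = \sum_(h : Uh) f (owner h)); last first.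
  apply: eq_big => h; first by rewrite inE.
  by move=> _; rewrite card_siblings /f; case: (owner h) => [u|] //=; rewrite expr1n.
rewrite (sum_halves f) /f mulr1 lerD2r; apply: ler_sum => u _.
case: (dU u) => [|k] /=; first by rewrite mul0r.
by rewrite -exprS.
Qed.

End HalfEdgeSums.

Definition deg_seq T (dV : 'I_T -> nat) (j : nat) : nat := nth 0%N [seq dV v | v <- enum 'I_T] j.

Lemma mkseq_deg_seq T (dV : 'I_T -> nat) t : (t <= T)%N ->
  take t [seq dV v | v <- enum 'I_T] = mkseq (deg_seq dV) t.
Proof.
have sz : size [seq dV v | v <- enum 'I_T] = T by rewrite size_map size_enum_ord.
move=> tT; apply: (@eq_from_nth _ 0%N); first by rewrite size_mkseq size_takel ?sz.
move=> i; rewrite size_takel ?sz// => it.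
by rewrite nth_take// nth_mkseq.
Qed.

Lemma sum_deg_seq (R : realType) T (dV : 'I_T -> nat) (f : nat -> R) t : (t <= T)%N ->
  \sum_(0 <= j < t) f (deg_seq dV j) = \sum_(v < T | (v < t)%N) f (dV v).
Proof.
move=> tT; rewrite big_mkord (big_ord_widen _ (fun j => f (deg_seq dV j)) tT).
apply: eq_bigr => v _; congr (f _); rewrite /deg_seq.
by rewrite (nth_map v) ?size_enum_ord// nth_ord_enum.
Qed.

(** * Deterministic typical degrees, random pairing *)

Section GoodDegrees.
Variables (R : realType) (piV : probability nat R).
Hypothesis subV : sub_gaussian piV.
Variables (q w Phi Lam : R -> R) (Kq W Kw KL muU muV s Gs : R).
Hypothesis q01 : forall g : R, 0 <= g <= 1 -> 0 <= q g <= 1.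
Hypothesis qlip : forall g g' : R, 0 <= g <= 1 -> 0 <= g' <= 1 ->
  `|q g - q g'| <= Kq * `|g - g'|.
Hypothesis Kq0 : 0 <= Kq.
Hypothesis w0 : forall g : R, 0 <= w g <= W.
Hypothesis wlip : forall g g' : R, `|w g - w g'| <= Kw * `|g - g'|.
Hypothesis Kw0 : 0 <= Kw.
Hypothesis Phi_taylor : forall y z : R, 0 <= y -> y <= z ->
  `|Phi z - Phi y - w y * (z - y)| <= Kw * (z - y) ^+ 2.
Hypothesis Phi_expand : forall y z : R, 0 <= y -> 0 <= z -> `|z - y| <= `|Phi z - Phi y|.
Hypothesis Phi0 : Phi 0 = 0.
Hypothesis w_rate : forall g : R, 0 <= g <= 1 -> w g * EX piV (fun d => psi d (q g)) = muV.
Hypothesis muU0 : 0 < muU.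
Hypothesis muV0 : 0 < muV.
Hypothesis KL0 : 0 <= KL.
Hypothesis Lam0 : Lam 0 = 0.
Hypothesis Lam_taylor : forall y z : R, 0 <= y <= 1 -> 0 <= z <= 1 ->
    `|Lam z - Lam y - muU * q y * (z - y)| <= KL * (z - y) ^+ 2.
Hypothesis s0 : 0 <= s.
Hypothesis s1 : s < 1.
Hypothesis Gs01 : 0 <= Gs <= 1.
Hypothesis PhiGs : Phi Gs = s.

Lemma Lam_lip y z : 0 <= y <= 1 -> 0 <= z <= 1 -> `|Lam z - Lam y| <= (muU + KL) * `|z - y|.
Proof.
move=> y01 z01; have := Lam_taylor y01 z01; have /andP[qq0 qq1] := q01 y01.
have h1 : `|muU * q y * (z - y)| <= muU * `|z - y|.
  by rewrite normrM ger0_norm ?mulr_ge0 ?(ltW muU0)// ler_wpM2r// ler_piMr// ltW.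
have h2 : KL * (z - y) ^+ 2 <= KL * `|z - y|.
  rewrite ler_wpM2l// -real_normK ?num_real// expr2 ler_piMr//.
  by rewrite ler_norml; case/andP: y01; case/andP: z01; lra.
move=> h; rewrite -[X in `|X|](subrK (muU * q y * (z - y))).
by apply: (le_trans (ler_normD _ _)); lra.
Qed.

Variables (N T : nat) (dU : 'I_N -> nat) (dV : 'I_T -> nat) (omega : 'I_N -> nat).
Variables (t K : nat) (L0 e z B tau : R).
Hypothesis tT : (t <= T)%N.
Hypothesis K0 : (0 < K)%N.
Hypothesis B1 : 1 <= B.
Hypothesis e0 : 0 < e.
Hypothesis es : 8 * e <= 1 - s.
Hypothesis eL0 : 1 <= e * L0.
Hypothesis NL0 : N%:R * muU = L0.
Hypothesis hU1 : `|(total_deg dU)%:R - L0| <= e * L0.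
Hypothesis hV1 : `|(total_deg dV)%:R - L0| <= e * L0.
Hypothesis hU2 : \sum_(u < N) (dU u)%:R ^+ 3 <= B * L0.
Hypothesis hV3 : \sum_(0 <= j < t) (deg_seq dV j)%:R ^+ 3 <= B * L0.
Hypothesis hopen : forall g : R, 0 <= g <= 1 ->
  `|open_sum dU omega g - N%:R * (muU * q g)| <= z * L0.
Hypothesis z0 : 0 <= z.
Hypothesis hV2 : `|\sum_(0 <= j < t) (deg_seq dV j)%:R - t%:R * muV| <= e * L0.
Hypothesis hV4 : forall k, (k < K)%N -> `|tail_fluct piV (deg_seq dV) k t| <= e * L0.
Hypothesis hV5 : forall k, (k < K)%N ->
  \sum_(0 <= j < t) tail_fluct piV (deg_seq dV) k j.+1 ^+ 2 <= e ^+ 2 * L0 ^+ 3.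
Hypothesis ht : `|t%:R * muV - s * L0| <= e * L0.
Hypothesis tau0 : 0 < tau.

Local Notation Uh := (Uhalf dU dV).
Local Notation L := #|Uh|.
Local Notation D := (deg_seq dV).
Local Notation n := (\sum_(0 <= j < t) D j)%N.
Local Notation hits rho := (hit (@owner N T dU dV) omega rho).

(** In order: second-order terms of [potential_increment] and [scan_identity]; degree fluctuations
    after summation by parts; truncation of [psi] at K; and the distance between t mu_V / L and
    s. *)
Definition drift_error : R :=
  4 * (Kw + W * Kq) * B * e +
  2 * (K%:R * W * e + K%:R * (Kw + W * K%:R * Kq) * (2 * e * (B + 1))) +
  2 * (W / K%:R) * (B + 2 * EX piV (fun d => d%:R ^+ 2) / muV) + 4 * e.

(** Relative to N: the Riemann sum error, the replacement of L / mu_U by N, and the drift error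
    through the Lipschitz constant mu_U + KL of [Lam]. *)
Definition total_error : R := KL * e + (muU + KL) * e + (muU + KL) * drift_error.

Definition noise_gain : R := 2 * (muU + KL) / muU.

Let L0p : 0 < L0. Proof. by move: eL0 e0 => h1 h2; rewrite -(pmulr_rgt0 _ h2); lra. Qed.
Let e8 : 8 * e <= 1. Proof. by move: es s0; lra. Qed.
Let W0 : 0 <= W. Proof. by have /andP[h1 h2] := w0 0; exact: le_trans h2. Qed.

Let LE : L%:R = Num.max (total_deg dU)%:R (total_deg dV)%:R :> R.
Proof. by rewrite card_Uhalf natr_max. Qed.

Let LL0 : `|L%:R - L0| <= e * L0.
Proof.
by rewrite LE; case: (leP (total_deg dU)%:R ((total_deg dV)%:R : R)).
Qed.

Let L_ge : (1 - e) * L0 <= L%:R. Proof. by move: LL0; rewrite ler_norml => /andP[]; lra. Qed.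
Let L_le : L%:R <= (1 + e) * L0. Proof. by move: LL0; rewrite ler_norml => /andP[]; lra. Qed.
Let eLp : 0 < e * L0. Proof. exact: mulr_gt0. Qed.
Let L_half : L0 <= 2 * L%:R.
Proof. by have := ler_wpM2r (ltW L0p) e8; move: L_ge eLp; lra. Qed.
Let L_two : L%:R <= 2 * L0.
Proof. by have := ler_wpM2r (ltW L0p) e8; move: L_le eLp; lra. Qed.
Let LRp : 0 < L%:R :> R. Proof. by move: L_half L0p; lra. Qed.
Let Lp : (0 < L)%N. Proof. by rewrite -(ltr0n R). Qed.

Let nR : n%:R = \sum_(0 <= j < t) (D j)%:R :> R. Proof. by rewrite natr_sum. Qed.

Let n_le : n%:R <= (s + 2 * e) * L0.
Proof.
rewrite nR; move: hV2 ht; rewrite !ler_norml => /andP[_ h1] /andP[_ h2]; lra.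
Qed.

(** At most n reveals are made, n <= (s + 2 e) L0 and L >= (1 - e) L0. This gap keeps 1 / (L - i) of
    order 1 / L0 in [zeta], and it is why s < 1 is assumed. *)
Let gap : (1 - s) / 2 * L0 <= L%:R - n%:R.
Proof.
have h : 3 * e * L0 <= (1 - s) / 2 * L0 by rewrite ler_wpM2r ?(ltW L0p)//; move: es e0; lra.
move: n_le L_ge h; lra.
Qed.

Let nL : (n + 2 <= L)%N.
Proof.
rewrite -(ler_nat R) natrD; have h : 4 * (e * L0) <= (1 - s) / 2 * L0.
  by rewrite mulrA ler_wpM2r ?(ltW L0p)//; move: es; lra.
by move: gap h eL0; lra.
Qed.

Let nL' : (n <= L)%N. Proof. by rewrite (leq_trans _ nL)// leq_addr. Qed.

Lemma drift_bound rho : `|(pos (hits rho) D t)%:R / L%:R - Gs| <=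
  L%:R^-1 * `|scan_noise q w (hits rho) D L t| + drift_error.
Proof.
set b := hits rho; set g := (pos b D t)%:R / L%:R.
have g01 : 0 <= g <= 1 by exact: (scpos R b Lp nL' (leqnn t)).
have /andP[g0 _] := g01; have /andP[Gs0 _] := Gs01.
apply: (le_trans (Phi_expand Gs0 g0)); rewrite PhiGs.
have S3 : 0 <= \sum_(0 <= j < t) (D j)%:R ^+ 3 :> R by apply: sumr_ge0 => j _; rewrite exprn_ge0.
have S2 : \sum_(0 <= j < t) (D j)%:R ^+ 2 <= \sum_(0 <= j < t) (D j)%:R ^+ 3 :> R.
  by apply: ler_sum => j _; case: (D j) => [|k]; rewrite ?expr0n// ler_weXn2l ?ler1n.
have S20 : 0 <= \sum_(0 <= j < t) (D j)%:R ^+ 2 :> R by apply: sumr_ge0 => j _; rewrite exprn_ge0.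
have P := potential_increment Kw0 b D t Lp Phi_taylor.
have I := scan_identity q01 qlip Kq0 w0 b Lp nL'.
have A := degree_average_le q01 qlip Kq0 w0 wlip Kw0 b Lp nL' subV K0.
rewrite Phi0 subr0 -/g in P.
set sumw := \sum_(0 <= j < t) w _ * (_ - _) in P I.
set sumpsi := \sum_(0 <= j < t) w _ * psi _ _ in I.
set Zn := scan_noise _ _ _ _ _ _ in I *.
have M : \sum_(0 <= j < t) w ((pos b D j)%:R / L%:R) *
      (psi (D j) (q ((pos b D j)%:R / L%:R)) - EX piV (fun d => psi d (q ((pos b D j)%:R / L%:R))))
    = sumpsi - t%:R * muV.
  rewrite /sumpsi -[t in t%:R * muV]subn0 mulr_natl -sumr_const_nat -sumrB.
  rewrite big_seq [RHS]big_seq; apply: eq_bigr => j; rewrite mem_index_iota => /andP[_ jt].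
  by rewrite mulrBr w_rate//; exact: (scpos R b Lp nL' (ltnW jt)).
rewrite M in A.
set A1 := \sum_(0 <= k < K) _ in A; set A2 := W / K%:R * _ in A.
have Linv : L%:R^-1 <= 2 / L0 by rewrite -[2 / L0]invrK invf_div lef_pV2 ?posrE ?divr_gt0//; move: L_half; lra.
have Li0 : 0 <= L%:R^-1 :> R by rewrite invr_ge0.
have tle : t%:R * muV <= 2 * L0.
  move: ht; rewrite ler_norml => /andP[_ h].
  have := ler_wpM2r (ltW L0p) e8; have := ler_wpM2r (ltW L0p) (ltW s1); move: eLp; lra.
have A1b : A1 <= (K%:R * W * e + K%:R * (Kw + W * K%:R * Kq) * (2 * e * (B + 1))) * L0.
  have one k : (k < K)%N -> W * `|tail_fluct piV D k t| +
     (Kw + W * K%:R * Kq) / L%:R * (\sum_(0 <= j < t) (D j)%:R * `|tail_fluct piV D k j.+1|) <=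
     (W * e + (Kw + W * K%:R * Kq) * (2 * e * (B + 1))) * L0.
    move=> kK; have c0 : 0 <= Kw + W * K%:R * Kq by rewrite addr_ge0// !mulr_ge0.
    have am : \sum_(0 <= j < t) (D j)%:R * `|tail_fluct piV D k j.+1| <= e * (B + 1) * L0 ^+ 2.
      (* Young's inequality with weight e L0 balances the two sums: the first is at most e B L0^2,
         the second at most e L0^2. *)
      apply: (@le_trans _ _ (\sum_(0 <= j < t) ((e * L0) * (D j)%:R ^+ 2 +
         (e * L0)^-1 * tail_fluct piV D k j.+1 ^+ 2))).
        apply: ler_sum => j _; set x := (D j)%:R; set y := `|_|.
        rewrite -(real_normK (num_real (tail_fluct _ _ _ _))) -/y.
        have l0 : 0 < e * L0 by rewrite mulr_gt0.
        rewrite -(ler_pM2l l0) mulrDr mulVKf ?gt_eqF//.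
        have := sqr_ge0 (e * L0 * x - y); have := sqr_ge0 (e * L0 * x); have := sqr_ge0 y.
        by rewrite !expr2; lra.
      rewrite big_split/= -!mulr_sumr.
      have l0 : 0 < e * L0 by rewrite mulr_gt0.
      have h1 : e * L0 * \sum_(0 <= j < t) (D j)%:R ^+ 2 <= e * L0 * (B * L0).
        by rewrite ler_wpM2l ?(ltW l0)//; exact: le_trans (le_trans S2 hV3) _.
      have h2 : (e * L0)^-1 * \sum_(0 <= j < t) tail_fluct piV D k j.+1 ^+ 2 <= e * L0 ^+ 2.
        rewrite mulrC ler_pdivrMr//; apply: (le_trans (hV5 kK)).
        by rewrite !expr2 exprS expr2; lra.
      by rewrite expr2 in h2 *; lra.
    apply: (@le_trans _ _ (W * (e * L0) + (Kw + W * K%:R * Kq) * (2 / L0 * (e * (B + 1) * L0 ^+ 2)))).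
      apply: lerD; first by rewrite ler_wpM2l// hV4.
      rewrite -mulrA ler_wpM2l// ler_pM//.
      by apply: sumr_ge0 => j _; rewrite mulr_ge0.
    rewrite le_eqVlt; apply/orP; left; apply/eqP; field; rewrite gt_eqF//.
  rewrite /A1; apply: (@le_trans _ _ (\sum_(0 <= k < K) (W * e + (Kw + W * K%:R * Kq) * (2 * e * (B + 1))) * L0)).
    rewrite big_seq [leRHS]big_seq; apply: ler_sum => k; rewrite mem_index_iota => /andP[_]; exact: one.
  rewrite sumr_const_nat subn0 -[leLHS]mulr_natl le_eqVlt; apply/orP; left; apply/eqP; ring.
have v0 : 0 <= EX piV (fun d => d%:R ^+ 2) by apply: EX_ge0 => //; exact: expb_sq.
have KR : 0 < K%:R :> R by rewrite ltr0n.
have A2b : A2 <= W / K%:R * ((B + 2 * EX piV (fun d => d%:R ^+ 2) / muV) * L0).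
  rewrite /A2 ler_wpM2l ?divr_ge0// mulrDl; apply: lerD; first exact: le_trans S2 hV3.
  rewrite (_ : 2 * _ / _ * L0 = (2 * L0 / muV) * EX piV (fun d => d%:R ^+ 2)); last by ring.
  by rewrite ler_wpM2r// ler_pdivlMr.
have E1 : Kw * (\sum_(0 <= j < t) (D j)%:R ^+ 2) / L%:R ^+ 2 +
    L%:R^-1 * (W * Kq * (\sum_(0 <= j < t) (D j)%:R ^+ 3) / L%:R) <=
    4 * (Kw + W * Kq) * B * e.
  have Li2 : L%:R^-1 ^+ 2 <= (4 / L0) * e.
    apply: (@le_trans _ _ ((2 / L0) ^+ 2)); first by rewrite lerXn2r ?nnegrE ?divr_ge0 ?(ltW L0p).
    rewrite (_ : (2 / L0) ^+ 2 = 4 / L0 * L0^-1); last by rewrite expr2; ring.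
    rewrite ler_wpM2l ?divr_ge0 ?(ltW L0p)// -[L0^-1]mul1r ler_pdivrMr//.
  have W' : 0 <= W * Kq by rewrite mulr_ge0.
  rewrite (_ : _ + _ = (Kw * (\sum_(0 <= j < t) (D j)%:R ^+ 2) + W * Kq * (\sum_(0 <= j < t) (D j)%:R ^+ 3)) * L%:R^-1 ^+ 2); last first.
    by rewrite exprVn expr2 invfM; ring.
  apply: (@le_trans _ _ (((Kw + W * Kq) * (B * L0)) * (4 / L0 * e))).
    apply: ler_pM => //.
    - by rewrite addr_ge0// mulr_ge0.
    - by rewrite mulrDl; apply: lerD; rewrite ler_wpM2l//; exact: le_trans S2 hV3.
  rewrite le_eqVlt; apply/orP; left; apply/eqP; field; rewrite gt_eqF//.
have E3 : `|L%:R^-1 * (t%:R * muV) - s| <= 4 * e.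
  rewrite (_ : _ - s = L%:R^-1 * ((t%:R * muV - s * L0) - s * (L%:R - L0))); last by field; rewrite gt_eqF.
  rewrite normrM (ger0_norm Li0).
  apply: (@le_trans _ _ (2 / L0 * (2 * (e * L0)))); last first.
    by rewrite le_eqVlt; apply/orP; left; apply/eqP; field; rewrite gt_eqF.
  apply: ler_pM => //; apply: (le_trans (ler_normB _ _)).
  rewrite mulr2n mulrDl !mul1r; apply: lerD => //.
  rewrite normrM (ger0_norm s0); apply: le_trans LL0; rewrite ler_piMl// ltW//.
(* Taylor error of [Phi], error of the scan identity, martingale noise, fluctuation of the degrees,
   and time discretisation. *)
have -> : Phi g - s = (Phi g - L%:R^-1 * sumw) + L%:R^-1 * (sumw - sumpsi - Zn) +
   L%:R^-1 * Zn + L%:R^-1 * (sumpsi - t%:R * muV) + (L%:R^-1 * (t%:R * muV) - s) by ring.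
apply: (le_trans (ler_normD _ _)); apply: (le_trans (lerD (ler_normD _ _) (lexx _))).
apply: (le_trans (lerD (lerD (ler_normD _ _) (lexx _)) (lexx _))).
apply: (le_trans (lerD (lerD (lerD (ler_normD _ _) (lexx _)) (lexx _)) (lexx _))).
rewrite !(normrM L%:R^-1) (ger0_norm Li0).
have I' := ler_wpM2l Li0 I.
have A' : L%:R^-1 * `|sumpsi - t%:R * muV| <=
   2 * (K%:R * W * e + K%:R * (Kw + W * K%:R * Kq) * (2 * e * (B + 1))) +
   2 * (W / K%:R) * (B + 2 * EX piV (fun d => d%:R ^+ 2) / muV).
  apply: (@le_trans _ _ (2 / L0 * ((K%:R * W * e + K%:R * (Kw + W * K%:R * Kq) * (2 * e * (B + 1))) * L0 +
     W / K%:R * ((B + 2 * EX piV (fun d => d%:R ^+ 2) / muV) * L0)))).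
    by apply: ler_pM => //; apply: (le_trans A); exact: lerD.
  rewrite le_eqVlt; apply/orP; left; apply/eqP; field.
  by rewrite !gt_eqF.
rewrite /drift_error; move: P I' A' E1 E3; lra.
Qed.

Lemma matched_bound rho :
  `|(\sum_(0 <= i < pos (hits rho) D t) hits rho i)%N%:R - N%:R * Lam Gs| <=
  `|match_noise q (hits rho) D L t| + noise_gain * `|scan_noise q w (hits rho) D L t| +
  N%:R * total_error.
Proof.
set b := hits rho; set g : R := (pos b D t)%:R / L%:R.
have g01 : 0 <= g <= 1 by exact: (scpos R b Lp nL' (leqnn t)).
have h1 := matched_le b Lp nL' muU0 KL0 Lam0 Lam_taylor.
have h2 := drift_bound rho; rewrite -/b -/g in h1 h2.
set Mt := (\sum_(0 <= i < _) _)%N%:R in h1 *.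
set Zm := match_noise _ _ _ _ _ in h1 *; set Zn := scan_noise _ _ _ _ _ _ in h2 *.
have zero01 : 0 <= (0 : R) <= 1 by rewrite lexx ler01.
have Lg : `|Lam g| <= muU + KL.
  have := Lam_lip zero01 g01; rewrite Lam0 !subr0 => /le_trans; apply.
  rewrite ler_piMr ?addr_ge0 ?(ltW muU0)//; case/andP: g01 => gg0 gg1.
  by rewrite ger0_norm.
have LG := Lam_lip Gs01 g01.
have NR : N%:R = L0 / muU by rewrite -NL0 mulfK// gt_eqF.
have N0 : 0 <= N%:R :> R by [].
have muKL : 0 <= muU + KL by rewrite addr_ge0// ltW.
have p1 : `|(L%:R / muU - N%:R) * Lam g| <= e * N%:R * (muU + KL).
  rewrite normrM; apply: ler_pM => //.
  rewrite NR -mulrBl normrM (@ger0_norm _ muU^-1) ?invr_ge0 ?(ltW muU0)//.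
  by rewrite mulrA ler_wpM2r ?invr_ge0 ?(ltW muU0).
have p2 : `|N%:R * (Lam g - Lam Gs)| <= N%:R * ((muU + KL) * (L%:R^-1 * `|Zn| + drift_error)).
  rewrite normrM (ger0_norm N0) ler_wpM2l//; apply: (le_trans LG).
  by rewrite ler_wpM2l.
have p3 : KL / muU <= KL * e * N%:R.
  rewrite NR -mulrA ler_wpM2l// mulrA -[leLHS]mul1r ler_wpM2r ?invr_ge0 ?(ltW muU0)//.
have p4 : N%:R * ((muU + KL) * (L%:R^-1 * `|Zn|)) <= noise_gain * `|Zn|.
  rewrite !mulrA ler_wpM2r// /noise_gain NR.
  rewrite (_ : L0 / muU * (muU + KL) / L%:R = (muU + KL) / muU * (L0 / L%:R)); last by ring.
  rewrite (_ : 2 * (muU + KL) / muU = (muU + KL) / muU * 2); last by ring.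
  by rewrite ler_wpM2l ?divr_ge0 ?(ltW muU0)// ler_pdivrMr.
rewrite (_ : Mt - _ = (Mt - L%:R / muU * Lam g + Zm) - Zm +
   (L%:R / muU - N%:R) * Lam g + N%:R * (Lam g - Lam Gs)); last by ring.
apply: (le_trans (ler_normD _ _)); apply: (le_trans (lerD (ler_normD _ _) (lexx _))).
apply: (le_trans (lerD (lerD (ler_normB _ _) (lexx _)) (lexx _))).
rewrite /total_error; move: h1 p1 p2 p3 p4; lra.
Qed.

(** A Chebyshev bound at level tau N / 2 for the two noises, whence the 8 = 4 * 2. The second factor
    comes from the squared weights; the last one is 1 plus the summed squared bias of the guess q,
    divided by L0 and using 1 / L0 <= e. *)
Definition sampling_error : R :=
  (8 * muU ^+ 2 / tau ^+ 2) * (4 + 2 * noise_gain ^+ 2 * W ^+ 2 * B) *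
  ((1 + 192 * (B + 1) / (1 - s)) * e + 2 * (2 * z + 2 * e) ^+ 2).

(** The first term is the distance between [mean_open] and q, coming from [hopen] and from L against
    L0; the second is the concentration error, kept of order 1 / L0 by [gap]. *)
Let zeta i : (i < n)%N ->
  samp i [set: Uh]%SET (fun rho => (succ_rate R (@owner N T dU dV) omega rho - q (i%:R / L%:R)) ^+ 2)
  <= (2 * z + 2 * e) ^+ 2 + 96 * (B + 1) / ((1 - s) * L0).
Proof.
move=> iN; have iL : (i + 2 <= L)%N by apply: leq_trans nL; rewrite leq_add2r ltnW.
have g01 : 0 <= (i%:R / L%:R : R) <= 1.
  by rewrite divr_ge0//= ler_pdivrMr// mul1r ler_nat (leq_trans _ iL)// leq_addr.
have qq := q01 g01; have /andP[qq0 qq1] := qq.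
apply: (le_trans (succ_rate_concentration (@owner N T dU dV) omega iL qq)).
have Linv : L%:R^-1 <= 2 / L0 by rewrite -[2 / L0]invrK invf_div lef_pV2 ?posrE ?divr_gt0//; move: L_half; lra.
have Li0 : 0 <= L%:R^-1 :> R by rewrite invr_ge0.
apply: lerD.
  rewrite -real_normK ?num_real// lerXn2r ?nnegrE ?addr_ge0 ?mulr_ge0 ?(ltW e0)//.
  rewrite mean_openE; set g := i%:R / L%:R in g01 qq qq0 qq1 *.
  have h := hopen g01; have L0n : L0 != 0 by rewrite gt_eqF.
  rewrite (_ : _ - q g = (open_sum dU omega g - N%:R * (muU * q g)) * L%:R^-1 - q g * (L%:R - L0) * L%:R^-1); last first.
    by rewrite mulrA NL0; field; rewrite gt_eqF.
  apply: (le_trans (ler_normB _ _)); rewrite !normrM (ger0_norm Li0) (ger0_norm qq0).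
  apply: lerD.
    apply: (@le_trans _ _ (z * L0 * (2 / L0))); first by apply: ler_pM.
    by rewrite le_eqVlt; apply/orP; left; apply/eqP; field.
  apply: (@le_trans _ _ (1 * (e * L0) * (2 / L0))).
    by apply: ler_pM => //; [rewrite mulr_ge0|apply: ler_pM].
  by rewrite le_eqVlt; apply/orP; left; apply/eqP; field.
have s1' : 0 < 1 - s by rewrite subr_gt0.
have S : avg [set: Uh]%SET (fun h => (#|siblings (@owner N T dU dV) h|.+1)%:R ^+ 2 : R) <= 2 * B + 2.
  apply: (le_trans (avg_siblings_sqr _ _ _)); rewrite ler_pdivrMr//.
  have h1 : (total_deg dV - total_deg dU)%:R <= L%:R :> R.
    by rewrite ler_nat card_Uhalf (leq_trans (leq_subr _ _))// leq_maxr.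
  have h2 : B * L0 <= B * (2 * L%:R) by rewrite ler_wpM2l//; move: B1; lra.
  by move: hU2 h1 h2 LRp; lra.
have i_le : i%:R <= n%:R :> R by rewrite ler_nat ltnW.
have M : (1 - s) / 2 * L0 <= (L - i)%:R.
  rewrite natrB; last by rewrite (leq_trans _ iL)// leq_addr.
  by move: gap i_le; lra.
have M0 : 0 < (1 - s) / 2 * L0 by rewrite mulr_gt0// divr_gt0.
apply: (@le_trans _ _ (24 / ((1 - s) / 2 * L0) * (2 * B + 2))).
  apply: ler_pM => //.
  - rewrite /avg divr_ge0//; apply: sumr_ge0 => h _; rewrite exprn_ge0//.
  - rewrite ler_wpM2l// lef_pV2 ?posrE//; exact: lt_le_trans M.
rewrite le_eqVlt; apply/orP; left; apply/eqP; field.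
by rewrite !gt_eqF.
Qed.

Lemma good_degrees_bound : 2 * total_error <= tau ->
  samp n [set: Uh]%SET (fun rho => ((tau * N%:R <
    `|(\sum_(0 <= i < pos (hits rho) D t) hits rho i)%N%:R - N%:R * Lam Gs|)%R)%:R)
  <= sampling_error.
Proof.
move=> te.
pose Zm rho := match_noise q (hits rho) D L t.
pose Zn rho := scan_noise q w (hits rho) D L t.
have NR : N%:R = L0 / muU by rewrite -NL0 mulfK// gt_eqF.
have N0 : 0 < N%:R :> R by rewrite NR divr_gt0.
have tN : 0 < tau * N%:R by rewrite mulr_gt0.
pose c := 8 / (tau * N%:R) ^+ 2.
have c0 : 0 <= c by rewrite divr_ge0// exprn_ge0// ltW.
apply: (@le_trans _ _ (samp n [set: Uh]%SET (fun rho => c * (Zm rho ^+ 2 + noise_gain ^+ 2 * Zn rho ^+ 2)))).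
  apply: le_samp => rho _; case: ltP => [h|_]; last first.
    by apply: mulr_ge0 => //; apply: addr_ge0; [exact: sqr_ge0|apply: mulr_ge0; exact: sqr_ge0].
  have := le_trans (ltW h) (matched_bound rho); rewrite -/(Zm rho) -/(Zn rho) => {}h.
  (* The deterministic errors account for at most half of the deviation, so the noises must produce
     the other half. *)
  have h' : tau * N%:R / 2 <= `|Zm rho| + noise_gain * `|Zn rho|.
    have := ler_wpM2l (ltW N0) te; lra.
  have sq : (tau * N%:R / 2) ^+ 2 <= (`|Zm rho| + noise_gain * `|Zn rho|) ^+ 2.
    by rewrite lerXn2r ?nnegrE ?divr_ge0 ?(ltW tN)// (le_trans _ h')// divr_ge0// ltW.
  rewrite -(real_normK (num_real (Zm rho))) -(real_normK (num_real (Zn rho))).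
  rewrite /c mulrAC ler_pdivlMr ?exprn_gt0// mul1r.
  have := sqr_ge0 (`|Zm rho| - noise_gain * `|Zn rho|); rewrite expr_div_n in sq.
  rewrite -exprMn; move: sq; rewrite ler_pdivrMr ?exprn_gt0//.
  set X := (tau * N%:R) ^+ 2; set x := `|Zm rho|; set y := noise_gain * `|Zn rho|.
  rewrite !expr2; lra.
rewrite sampZ sampD sampZ.
pose qs i := q (i%:R / L%:R).
have nn : (n <= #|Uh|)%N := nL'.
pose Sg := \sum_(0 <= i < n) samp i [set: Uh]%SET (fun rho => (succ_rate R (@owner N T dU dV) omega rho - qs i) ^+ 2).
have hm : samp n [set: Uh]%SET (fun rho => Zm rho ^+ 2) <= 2 * n%:R * (1 + Sg).
  apply: (@predictable_sqr R N Uh (@owner N T dU dV) omega n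
    (fun b i => (i < pos b D t)%N%:R) qs n%:R nn).
  - move=> i b b' bb'; rewrite ltnNge (pos_local_le D t bb') -ltnNge//.
  - move=> rho _; apply: (@le_trans _ _ (\sum_(0 <= i < n) 1)).
      by apply: ler_sum => i _; case: (_ < _)%N; rewrite ?expr0n ?expr1n.
    by rewrite sumr_const_nat subn0.
have hn : samp n [set: Uh]%SET (fun rho => Zn rho ^+ 2) <= 2 * (W ^+ 2 * (B * L0)) * (1 + Sg).
  apply: (@predictable_sqr R N Uh (@owner N T dU dV) omega n
    (fun b i => block_weight D (scan_coef q w D L) b t i) qs _ nn).
  - exact: block_weight_predictable.
  - move=> rho _; apply: (le_trans (sum_scan_coef_sqr q01 w0 _ Lp nL')).
    by rewrite ler_wpM2l ?sqr_ge0.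
have s1' : 0 < 1 - s by rewrite subr_gt0.
pose z2 := (2 * z + 2 * e) ^+ 2.
have z20 : 0 <= z2 by exact: sqr_ge0.
have nL2 : n%:R <= 2 * L0 by apply: le_trans L_two; rewrite ler_nat.
have BS : 0 <= 96 * (B + 1) / ((1 - s) * L0).
  by rewrite divr_ge0 ?mulr_ge0 ?(ltW L0p) ?(ltW s1')//; move: B1; lra.
have SgB : Sg <= 2 * L0 * z2 + 192 * (B + 1) / (1 - s).
  apply: (@le_trans _ _ (\sum_(0 <= i < n) (z2 + 96 * (B + 1) / ((1 - s) * L0)))).
    rewrite /Sg big_seq [leRHS]big_seq; apply: ler_sum => i.
    by rewrite mem_index_iota => /andP[_]; exact: zeta.
  rewrite sumr_const_nat subn0 -[leLHS]mulr_natl.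
  apply: (@le_trans _ _ (2 * L0 * (z2 + 96 * (B + 1) / ((1 - s) * L0)))).
    by rewrite ler_wpM2r// addr_ge0.
  rewrite le_eqVlt; apply/orP; left; apply/eqP; field.
  by rewrite !gt_eqF.
have Sg0 : 0 <= Sg.
  by apply: sumr_ge0 => i _; apply: samp_ge0 => rho _; exact: sqr_ge0.
have ng0 : 0 <= noise_gain ^+ 2 by exact: sqr_ge0.
set X := samp n _ _ in hm *; set Y := samp n _ _ in hn *.
have hX : X <= 4 * L0 * (1 + Sg).
  by apply: (le_trans hm); rewrite ler_wpM2r ?addr_ge0//; lra.
have hXY : X + noise_gain ^+ 2 * Y <= (4 + 2 * noise_gain ^+ 2 * W ^+ 2 * B) * L0 * (1 + Sg).
  have := ler_wpM2l ng0 hn; lra.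
have cst0 : 0 <= 4 + 2 * noise_gain ^+ 2 * W ^+ 2 * B.
  have B0 : 0 <= B by move: B1; lra.
  apply: addr_ge0 => //; apply: mulr_ge0 => //; apply: mulr_ge0; last exact: sqr_ge0.
  by apply: mulr_ge0.
apply: (le_trans (ler_wpM2l c0 hXY)).
have L0i : L0^-1 <= e by rewrite -[L0^-1]mul1r ler_pdivrMr.
have last : L0^-1 * (1 + Sg) <= (1 + 192 * (B + 1) / (1 - s)) * e + 2 * z2.
  have cc : 0 <= 1 + 192 * (B + 1) / (1 - s).
    by rewrite addr_ge0// divr_ge0 ?(ltW s1')//; move: B1; lra.
  apply: (@le_trans _ _ (L0^-1 * ((1 + 192 * (B + 1) / (1 - s)) + 2 * L0 * z2))).
    by rewrite ler_wpM2l ?invr_ge0 ?(ltW L0p)//; move: SgB; lra.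
  rewrite mulrDr (_ : L0^-1 * (2 * L0 * z2) = 2 * z2); last by field; rewrite gt_eqF.
  by rewrite lerD2r mulrC ler_wpM2l.
rewrite /c /sampling_error -/z2.
rewrite (_ : 8 / _ * _ = (8 * muU ^+ 2 / tau ^+ 2) *
   (4 + 2 * noise_gain ^+ 2 * W ^+ 2 * B) * (L0^-1 * (1 + Sg))); last first.
  by rewrite NR; field; rewrite !gt_eqF.
apply: ler_wpM2l last; apply: mulr_ge0 => //.
by apply: divr_ge0; [apply: mulr_ge0 => //; exact: sqr_ge0|exact: sqr_ge0].
Qed.

Lemma good_degrees_pairing_prob : 2 * total_error <= tau ->
  (\sum_(f in pairings dU dV) greedy_prob f omega R (take t (enum 'I_T)) finset.set0
     [pred m | tau * N%:R < `|m%:R - N%:R * Lam Gs|]) / #|pairings dU dV|%:R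
  <= sampling_error.
Proof.
move=> te; rewrite (@average_greedy_prob R N T dU dV omega _ t n)//; last first.
  by rewrite (mkseq_deg_seq dV tT) sumnE /mkseq big_map /index_iota subn0.
apply: le_trans (good_degrees_bound te); rewrite le_eqVlt; apply/orP; left; apply/eqP.
by apply: eq_samp => rho _; rewrite (mkseq_deg_seq dV tT) position_mkseq.
Qed.

End GoodDegrees.

(** * Typical degrees *)

Lemma le_of_indicator (R : realType) (c y x : R) : (c < y)%R%:R <= x -> x < 1 -> y <= c.
Proof. by case: ltP => // _ h1 h2; move: (le_lt_trans h1 h2); rewrite ltxx. Qed.

Section DegreeTails.
Variables (R : realType) (pi : probability nat R).
Hypothesis subG : sub_gaussian pi.
Variable n : nat.
Local Notation degs := {ffun 'I_n -> nat}.

Lemma Edeg_chebyshev (f : nat -> R) (A : pred 'I_n) (c : R) :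
  (forall k, 0 <= f k) -> expb f -> 0 < c ->
  (Edeg pi (fun d : degs => (c < `|\sum_(i | A i) f (d i) - #|A|%:R * EX pi f|)%R%:R)%R <=
   (n%:R * EX pi (fun k => f k ^+ 2) / c ^+ 2)%R%:E)%E.
Proof.
move=> f0 fb c0; have c2 : 0 < c ^+ 2 by rewrite exprn_gt0.
apply: (@le_trans _ _ (Edeg pi (fun d : degs => (c ^+ 2 < (\sum_(i | A i) f (d i) - #|A|%:R * EX pi f) ^+ 2)%R%:R)%R)).
  apply: Edeg_le => d; set x := _ - _.
  have [cx|_] := ltP c `|x|; last by case: (_ < _).
  by rewrite -(real_normK (num_real x)) ltrXn2r// ltW.
apply: (le_trans (Edeg_markov pi c2 _)); first by move=> d; exact: sqr_ge0.
rewrite [X in (_ <= X%:E)%E]mulrC EFinM; apply: lee_wpmul2l; first by rewrite lee_fin invr_ge0 ltW.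
exact: Edeg_variance.
Qed.

Lemma Edeg_sum_tail (f : nat -> R) (c : R) :
  (forall k, 0 <= f k) -> expb f -> 0 < c ->
  (Edeg pi (fun d : degs => (c < \sum_(i < n) f (d i))%R%:R)%R <=
   (n%:R * EX pi f / c)%R%:E)%E.
Proof.
move=> f0 fb c0.
apply: (le_trans (Edeg_markov pi c0 _)); first by move=> d; exact: sumr_ge0.
rewrite [X in (_ <= X%:E)%E]mulrC EFinM; apply: lee_wpmul2l; first by rewrite lee_fin invr_ge0 ltW.
rewrite (@Edeg_sum _ _ subG _ _ _ _ (fun i (d : degs) => f (d i)))//.
under eq_bigr => i _ do rewrite Edeg1//.
by rewrite sumEFin lee_fin sumr_const card_ord -[leLHS]mulr_natl.
Qed.

Lemma Edeg_sum_le (I : eqType) (r : seq I) (F : I -> degs -> R) (c : R) :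
  (forall i d, 0 <= F i d) -> (forall i, i \in r -> (Edeg pi (F i) <= c%:E)%E) ->
  (Edeg pi (fun d => \sum_(i <- r) F i d)%R <= ((size r)%:R * c)%R%:E)%E.
Proof.
move=> F0; elim: r => [|i r IH] H.
  rewrite (@eq_Edeg _ _ _ _ (fun=> 0)); last by move=> d; rewrite big_nil.
  by rewrite Edeg_cst// mul0r.
rewrite (@eq_Edeg _ _ _ _ (fun d => F i d + \sum_(j <- r) F j d)); last first.
  by move=> d; rewrite big_cons.
rewrite EdegD//; last by move=> d; exact: sumr_ge0.
rewrite /= -[(size r).+1%:R]nat1r mulrDl mul1r EFinD; apply: leeD.
  by apply: H; rewrite inE eqxx.
by apply: IH => j jr; apply: H; rewrite inE jr orbT.
Qed.

End DegreeTails.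

Section OpenHalfEdges.
Variables (R : realType) (piU : probability nat R) (C : nat) (p : nat -> R).
Hypothesis subU : sub_gaussian piU.
Hypothesis muU0 : 0 < mean piU.
Hypothesis C1 : (1 <= C)%N.
Hypothesis p0 : forall c : nat, (1 <= c <= C)%N -> 0 <= p c.
Hypothesis pC : forall c : nat, (C < c)%N -> p c = 0.
Hypothesis p1 : \sum_(1 <= c < C.+1) p c = 1.
Local Notation muU := (mean piU).

Definition open_deg (c : nat) (g : R) (d : nat) : R :=
  d%:R * bern d.-1 (fun k => (k < c)%N%:R) g.

Let ind01 c k : `|(k < c)%N%:R : R| <= 1.
Proof. by rewrite normr_nat; case: (_ < _)%N. Qed.

Lemma open_deg_ge0 c g d : 0 <= g <= 1 -> 0 <= open_deg c g d.
Proof. by move=> g01; rewrite mulr_ge0// bern_ge0. Qed.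

Lemma open_deg_le c g d : 0 <= g <= 1 -> open_deg c g d <= d%:R.
Proof.
move=> g01; rewrite ler_piMr//; apply: (le_trans (ler_norm _)).
by apply: bern_norm_le => // k; exact: ind01.
Qed.

Lemma expb_open_deg c g : 0 <= g <= 1 -> expb (open_deg c g).
Proof. by move=> g01; apply: expb_dbern => //; exists 1 => k; exact: ind01. Qed.

Lemma bern_sum_fun a (r : seq nat) (h : nat -> nat -> R) g :
  bern a (fun k => \sum_(c <- r) h c k) g = \sum_(c <- r) bern a (h c) g.
Proof.
elim: r => [|c r IH].
  by rewrite big_nil (@eq_bern _ _ _ (fun=> 0)) ?bern_cst// => k; rewrite big_nil.
rewrite big_cons -IH -bernD; apply: eq_bern => k; exact: big_cons.
Qed.

(** Splits by capacity, in parallel with [open_sum_classes]: within a class the capacity is fixed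
    and the degrees are i.i.d., so Chebyshev applies to each class. *)
Lemma fluid_Gamma_classes g : 0 <= g <= 1 ->
  fluid_Gamma piU p g = \sum_(1 <= c < C.+1) p c * EX piU (open_deg c g).
Proof.
move=> g01; have eb c : expb (fun d => p c * open_deg c g d).
  by apply: expbM; [exact: expb_cst|exact: expb_open_deg].
transitivity (EX piU (fun d => \sum_(1 <= c < C.+1) p c * open_deg c g d)).
  apply: eq_EX => d; rewrite (eq_bern _ _ (surv_indic C1 pC p1)) bern_sum_fun mulr_sumr.
  by apply: eq_bigr => c _; rewrite bernZ mulrCA.
by rewrite EX_sum//; apply: eq_bigr => c _; rewrite EXZ//; exact: expb_open_deg.
Qed.

Variables (N : nat) (omega : 'I_N -> nat).
Hypothesis omegaC : forall u, (1 <= omega u <= C)%N.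

Lemma open_sum_classes (dU : 'I_N -> nat) g : open_sum dU omega g =
  \sum_(1 <= c < C.+1) \sum_(u < N | omega u == c) open_deg c g (dU u).
Proof.
under [RHS]eq_bigr => c _ do rewrite big_mkcond.
rewrite exchange_big/=; apply: eq_bigr => u _.
rewrite -big_mkcond/= (eq_bigl (fun c => c == omega u)); last by move=> c; rewrite eq_sym.
by rewrite big_nat1_eq ltnS omegaC.
Qed.

Lemma open_sum_lip (dU : 'I_N -> nat) (g g' : R) : 0 <= g <= 1 -> 0 <= g' <= 1 ->
  `|open_sum dU omega g - open_sum dU omega g'| <=
  2 * (\sum_(u < N) (dU u)%:R ^+ 2) * `|g - g'|.
Proof.
move=> g01 g01'; rewrite /open_sum -sumrB mulr_sumr mulr_suml.
apply: (le_trans (ler_norm_sum _ _ _)); apply: ler_sum => u _.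
rewrite -mulrBr normrM normr_nat.
apply: (@le_trans _ _ ((dU u)%:R * (2 * (dU u).-1%:R * `|g - g'|))).
  by rewrite ler_wpM2l//; apply: bern_lip => // k; exact: ind01.
rewrite (_ : 2 * (dU u)%:R ^+ 2 * _ = (dU u)%:R * (2 * (dU u)%:R * `|g - g'|)); last by ring.
by rewrite ler_wpM2l// ler_wpM2r// ler_wpM2l// ler_nat leq_pred.
Qed.

Variables (K : nat) (e B : R).
Hypothesis K0 : (0 < K)%N.
Hypothesis e0 : 0 < e.
Local Notation L0 := (N%:R * muU).
Local Notation cls c := #|[set u : 'I_N | omega u == c]%SET|.

(* A sum of indicators of undesirable events: a value < 1 excludes all of them,
   and its expectation is the union bound. *)
Definition bad_Udegrees (d : {ffun 'I_N -> nat}) : R :=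
  (e * L0 < `|\sum_(u < N) (d u)%:R - N%:R * muU|)%R%:R +
  (B * L0 < \sum_(u < N) (d u)%:R ^+ 3)%R%:R +
  \sum_(1 <= c < C.+1) \sum_(0 <= k < K.+1)
    (e * L0 < `|\sum_(u < N | omega u == c) open_deg c (k%:R / K%:R) (d u) -
                (cls c)%:R * EX piU (open_deg c (k%:R / K%:R))|)%R%:R.

Lemma bad_Udegrees_ge0 d : 0 <= bad_Udegrees d.
Proof. by rewrite !addr_ge0// sumr_ge0// => c _; rewrite sumr_ge0. Qed.

Let grid01 k : (k <= K)%N -> 0 <= (k%:R / K%:R : R) <= 1.
Proof. by move=> kK; rewrite divr_ge0//= ler_pdivrMr ?ltr0n// mul1r ler_nat. Qed.

Lemma Edeg_bad_Udegrees : (0 < N)%N -> 0 < B ->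
  (Edeg piU bad_Udegrees <= (EX piU (fun d => d%:R ^+ 3) / (B * muU) +
    (1 + (C * K.+1)%:R) * (EX piU (fun d => d%:R ^+ 2) / (e ^+ 2 * muU ^+ 2)) / N%:R)%:E)%E.
Proof.
move=> N0 B0; have NR : 0 < N%:R :> R by rewrite ltr0n.
have L0p : 0 < L0 by rewrite mulr_gt0.
have eL : 0 < e * L0 by rewrite mulr_gt0.
have BL : 0 < B * L0 by rewrite mulr_gt0.
set v := EX piU (fun d => d%:R ^+ 2); set m3 := EX piU _.
have v0 : 0 <= v by apply: EX_ge0 => //; exact: expb_sq.
have vE : N%:R * v / (e * L0) ^+ 2 = v / (e ^+ 2 * muU ^+ 2) / N%:R.
  by field; rewrite !gt_eqF.
rewrite /bad_Udegrees EdegD; last 2 first.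
- by move=> d; rewrite addr_ge0.
- by move=> d; rewrite sumr_ge0// => c _; rewrite sumr_ge0.
rewrite EdegD; last 2 first.
- by move=> d.
- by move=> d.
rewrite (_ : m3 / _ + _ = v / (e ^+ 2 * muU ^+ 2) / N%:R + m3 / (B * muU) +
   (C * K.+1)%:R * (v / (e ^+ 2 * muU ^+ 2) / N%:R)); last first.
  by rewrite -mulrA mulrDl mul1r addrA [X in X + _]addrC.
rewrite !EFinD; apply: leeD; first apply: leeD.
- rewrite -vE.
  have := @Edeg_chebyshev R piU subU N (fun k => k%:R) xpredT (e * L0) (fun k => ler0n _ _) (expb_natr _) eL.
  rewrite EX_mean// (eq_card (B := 'I_N)) ?card_ord//.
- have := @Edeg_sum_tail R piU subU N (fun k => k%:R ^+ 3) (B * L0) (fun k => exprn_ge0 _ (ler0n _ _)) (expbX 3 (expb_natr _)) BL.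
  move=> /le_trans; apply; rewrite lee_fin le_eqVlt; apply/orP; left; apply/eqP.
  by rewrite -/m3; field; rewrite !gt_eqF.
set y := v / _ / _.
have -> : (C * K.+1)%:R * y = (size (index_iota 1 C.+1))%:R * ((size (index_iota 0 K.+1))%:R * y).
  by rewrite !size_iota subn1 subn0 mulrA -natrM.
apply: Edeg_sum_le => // [c d|c _]; first exact: sumr_ge0.
apply: Edeg_sum_le => // k.
rewrite mem_index_iota ltnS => /andP[_ kK]; have g01 := grid01 kK.
have od0 d : 0 <= open_deg c (k%:R / K%:R) d by exact: open_deg_ge0.
have := @Edeg_chebyshev R piU subU N (open_deg c (k%:R / K%:R)) (fun u => omega u == c) (e * L0) od0 (expb_open_deg c g01) eL.
rewrite -(cardsE (fun u => omega u == c)) => /le_trans; apply.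
rewrite /y -vE lee_fin ler_wpM2r ?invr_ge0 ?exprn_ge0 ?(ltW eL)// ler_wpM2l//.
apply: EX_le => //.
- by apply: expbX; exact: expb_open_deg.
- exact: expb_sq.
by move=> d; rewrite lerXn2r ?nnegrE// open_deg_le.
Qed.

Lemma good_Udegrees d : bad_Udegrees d < 1 ->
  `|(total_deg d)%:R - L0| <= e * L0 /\ \sum_(u < N) (d u)%:R ^+ 3 <= B * L0.
Proof.
move=> good; have S0 : 0 <= \sum_(1 <= c < C.+1) \sum_(0 <= k < K.+1)
    (e * L0 < `|\sum_(u < N | omega u == c) open_deg c (k%:R / K%:R) (d u) -
                (cls c)%:R * EX piU (open_deg c (k%:R / K%:R))|)%R%:R :> R.
  by rewrite sumr_ge0// => c _; rewrite sumr_ge0.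
split; apply: le_of_indicator good; rewrite /bad_Udegrees.
  by rewrite natr_sum -addrA lerDl addr_ge0.
by rewrite -addrA addrCA lerDl addr_ge0.
Qed.

(** Uniformity in g is obtained from finitely many events: g is moved to a point of the grid of mesh
    1/K, both functions being Lipschitz, and there the classes are compared one by one. *)
Lemma open_sum_close (d : {ffun 'I_N -> nat}) : (0 < N)%N -> bad_Udegrees d < 1 ->
  (forall c, (1 <= c <= C)%N -> `|(cls c)%:R - N%:R * p c| <= e * N%:R) ->
  forall g, 0 <= g <= 1 ->
  `|open_sum d omega g - N%:R * fluid_Gamma piU p g| <=
  (2 * C%:R * e + (2 * B + open_lip piU) / K%:R) * L0.
Proof.
move=> N0 good frac g g01; have NR : 0 < N%:R :> R by rewrite ltr0n.
have KR : 0 < K%:R :> R by rewrite ltr0n.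
have L0p : 0 < L0 by rewrite mulr_gt0.
have /andP[g0 g1] := g01.
(* The grid point just below g. *)
pose k := Num.truncn (g * K%:R); pose h : R := k%:R / K%:R.
have gK0 : 0 <= g * K%:R by rewrite mulr_ge0.
have /andP[k1 k2] := truncn_itv gK0; rewrite -/k in k1 k2.
have kK : (k <= K)%N by rewrite -(ler_nat R); apply: (le_trans k1); rewrite ler_piMl.
have h01 : 0 <= h <= 1 by exact: grid01.
have gh : `|g - h| <= K%:R^-1.
  rewrite ger0_norm; last by rewrite subr_ge0 /h ler_pdivrMr.
  by rewrite lerBlDr -[K%:R^-1]mul1r /h -mulrDl ler_pdivlMr// addrC natr1 ltW.
have [_ S3] := good_Udegrees good.
have S2 : \sum_(u < N) (d u)%:R ^+ 2 <= B * L0.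
  apply: le_trans S3; apply: ler_sum => u _.
  by case: (d u) => [|m]; rewrite ?expr0n// ler_weXn2l ?ler1n.
have cl c : (1 <= c < C.+1)%N ->
   `|\sum_(u < N | omega u == c) open_deg c h (d u) - (cls c)%:R * EX piU (open_deg c h)| <= e * L0.
  move=> cC; apply: le_of_indicator good; rewrite /bad_Udegrees.
  rewrite (bigD1_seq c) ?mem_index_iota ?iota_uniq//= (bigD1_seq k) ?mem_index_iota ?iota_uniq//=.
  rewrite addrA addrCA -addrA lerDl !addr_ge0// ?sumr_ge0// => i _; rewrite sumr_ge0//.
have E1 : `|open_sum d omega h - N%:R * fluid_Gamma piU p h| <= 2 * C%:R * e * L0.
  rewrite open_sum_classes fluid_Gamma_classes// mulr_sumr -sumrB.
  apply: (le_trans (ler_norm_sum _ _ _)).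
  apply: (@le_trans _ _ (\sum_(1 <= c < C.+1) (e * L0 + e * L0))); last first.
    by rewrite sumr_const_nat subn1 -[leLHS]mulr_natl/=; lra.
  rewrite big_seq [leRHS]big_seq; apply: ler_sum => c; rewrite mem_index_iota => cC.
  have m0 : 0 <= EX piU (open_deg c h).
    by apply: EX_ge0 => //; [exact: expb_open_deg|move=> m; exact: open_deg_ge0].
  have m1 : EX piU (open_deg c h) <= muU.
    rewrite -EX_mean//; apply: EX_le => //; [exact: expb_open_deg|exact: expb_natr|].
    by move=> m; exact: open_deg_le.
  set X := \sum_(u < N | _) _.
  rewrite (_ : X - _ = (X - (cls c)%:R * EX piU (open_deg c h)) +
     ((cls c)%:R - N%:R * p c) * EX piU (open_deg c h)); last by ring.
  apply: (le_trans (ler_normD _ _)); apply: lerD; first exact: cl.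
  rewrite normrM (ger0_norm m0) mulrA; apply: ler_pM => //.
  by apply: frac; rewrite -[(c <= C)%N]ltnS.
have E2 : `|open_sum d omega g - open_sum d omega h| <= 2 * B / K%:R * L0.
  apply: (le_trans (open_sum_lip _ g01 h01)).
  rewrite (_ : 2 * B / K%:R * L0 = 2 * (B * L0) * K%:R^-1); last by ring.
  by apply: ler_pM => //; rewrite ?mulr_ge0 ?sumr_ge0// ?ler_wpM2l.
have E3 : `|N%:R * fluid_Gamma piU p g - N%:R * fluid_Gamma piU p h| <= open_lip piU / K%:R * L0.
  have GE x : fluid_Gamma piU p x = muU * fluid_open piU p x.
    by rewrite /fluid_open mulrCA divff ?mulr1// gt_eqF.
  have := fluid_open_lip subU muU0 C1 p0 pC p1 g01 h01.
  rewrite !GE -mulrBr -mulrBr !normrM normr_nat (gtr0_norm muU0) mulrA => hl.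
  rewrite mulrC ler_pM2r//; apply: (le_trans hl).
  by rewrite ler_wpM2l// open_lip_ge0.
rewrite (_ : _ - _ = (open_sum d omega g - open_sum d omega h) +
   (open_sum d omega h - N%:R * fluid_Gamma piU p h) -
   (N%:R * fluid_Gamma piU p g - N%:R * fluid_Gamma piU p h)); last by ring.
apply: (le_trans (ler_normB _ _)); apply: (le_trans (lerD (ler_normD _ _) (lexx _))).
rewrite mulrDl (mulrDl (2 * B)) (mulrDl (2 * B / _)); move: E1 E2 E3; lra.
Qed.

End OpenHalfEdges.

Lemma card_ord_lt T j : (j <= T)%N -> #|(fun v : 'I_T => (v < j)%N)| = j.
Proof.
move=> jT; rewrite -sum1_card.
by rewrite -[RHS]card_ord -[RHS]sum1_card (big_ord_widen T (fun=> 1%N)).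
Qed.

Lemma tail_fluctE (R : realType) (pi : probability nat R) T (d : 'I_T -> nat) k j :
  (j <= T)%N -> tail_fluct pi (deg_seq d) k j =
  \sum_(v < T | (v < j)%N) (k < d v)%N%:R -
  #|(fun v : 'I_T => (v < j)%N)|%:R * EX pi (fun m => (k < m)%N%:R).
Proof.
move=> jT; rewrite /tail_fluct sumrB sumr_const_nat subn0 card_ord_lt// mulr_natl.
by rewrite (sum_deg_seq d (fun m => (k < m)%N%:R)).
Qed.

(** * Typical degrees of the arriving vertices *)

Section ArrivalDegrees.
Variables (R : realType) (piV : probability nat R).
Hypothesis subV : sub_gaussian piV.
Hypothesis muV0 : 0 < mean piV.
Local Notation muV := (mean piV).
Variables (T t K : nat) (e B : R).
Hypothesis tT : (t <= T)%N.
Hypothesis T0 : (0 < T)%N.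
Hypothesis e0 : 0 < e.
Hypothesis B0 : 0 < B.
Local Notation L0 := (T%:R * muV).
Local Notation degs := {ffun 'I_T -> nat}.

(** These are the two quantities left by summation by parts. The path of partial sums is controlled
    in square mean over j: the expected sum of squares is at most T^2, negligible against L0^3, so
    Markov's inequality is enough where one would expect a maximal inequality. *)
Definition bad_fluct (k : nat) (d : degs) : R :=
  (e * L0 < `|tail_fluct piV (deg_seq d) k t|)%R%:R +
  (e ^+ 2 * L0 ^+ 3 < \sum_(0 <= j < t) tail_fluct piV (deg_seq d) k j.+1 ^+ 2)%R%:R.

Definition bad_Vdegrees (d : degs) : R :=
  (e * L0 < `|\sum_(v < T) (d v)%:R - T%:R * muV|)%R%:R +
  (e * L0 < `|\sum_(v < T | (v < t)%N) (d v)%:R - t%:R * muV|)%R%:R +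
  (B * L0 < \sum_(v < T) (d v)%:R ^+ 3)%R%:R +
  \sum_(0 <= k < K) bad_fluct k d.

Lemma bad_fluct_ge0 k d : 0 <= bad_fluct k d.
Proof. by rewrite addr_ge0. Qed.

Lemma bad_Vdegrees_ge0 d : 0 <= bad_Vdegrees d.
Proof. by rewrite !addr_ge0// sumr_ge0// => k _; exact: bad_fluct_ge0. Qed.

Let TR : 0 < T%:R :> R. Proof. by rewrite ltr0n. Qed.
Let L0p : 0 < L0. Proof. exact: mulr_gt0. Qed.
Let eL : 0 < e * L0. Proof. exact: mulr_gt0. Qed.

Let tail0 k m : 0 <= (k < m)%N%:R :> R. Proof. by []. Qed.
Let tailb k : expb (fun m => (k < m)%N%:R : R).
Proof. by apply: expb_le (expb_cst 1) => m; rewrite normr1 normr_nat; case: (k < m)%N. Qed.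
Let tail2 k : EX piV (fun m => (k < m)%N%:R ^+ 2) <= 1.
Proof.
apply: (@le_trans _ _ (EX piV (fun=> 1))); last by rewrite EX1.
apply: EX_le => //; [exact: (expbX 2 (tailb k))|exact: expb_cst|].
by move=> m; case: (k < m)%N; rewrite ?expr1n ?expr0n.
Qed.

Lemma Edeg_bad_fluct k : (Edeg piV (bad_fluct k) <=
  (((e ^+ 2 * muV ^+ 2)^-1 + (e ^+ 2 * muV ^+ 3)^-1) / T%:R)%R%:E)%E.
Proof.
rewrite /bad_fluct EdegD; [|by move=> d|by move=> d].
rewrite mulrDl EFinD; apply: leeD.
  have := @Edeg_chebyshev R piV subV T (fun m => (k < m)%N%:R) (fun v => (v < t)%N) (e * L0) (tail0 k) (tailb k) eL.
  rewrite (@eq_Edeg _ _ _ _ (fun d : degs => (e * L0 < `|tail_fluct piV (deg_seq d) k t|)%R%:R)); last first.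
    by move=> d; rewrite tail_fluctE.
  move=> /le_trans; apply; rewrite lee_fin.
  apply: (@le_trans _ _ (T%:R * 1 / (e * L0) ^+ 2)).
    by rewrite ler_wpM2r ?invr_ge0 ?sqr_ge0// ler_wpM2l.
  by rewrite le_eqVlt; apply/orP; left; apply/eqP; field; rewrite !gt_eqF.
have c0 : 0 < e ^+ 2 * L0 ^+ 3 by rewrite mulr_gt0// exprn_gt0.
apply: (le_trans (Edeg_markov piV c0 _)).
  by move=> d; apply: sumr_ge0 => j _; exact: sqr_ge0.
apply: (@le_trans _ _ ((e ^+ 2 * L0 ^+ 3)^-1%:E * ((T * T)%:R)%:E)%E); last first.
  rewrite -EFinM lee_fin natrM le_eqVlt; apply/orP; left; apply/eqP.
  by field; rewrite !gt_eqF.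
apply: lee_wpmul2l; first by rewrite lee_fin invr_ge0 ltW.
apply: (@le_trans _ _ ((size (index_iota 0 t))%:R * T%:R)%:E); last first.
  by rewrite size_iota subn0 -natrM lee_fin ler_nat leq_mul.
apply: Edeg_sum_le => // [j d|j]; first exact: sqr_ge0.
rewrite mem_index_iota => /andP[_ jt].
have jT : (j.+1 <= T)%N by exact: leq_trans jt tT.
have := @Edeg_variance R piV subV T (fun m => (k < m)%N%:R) (fun v => (v < j.+1)%N) (tail0 k) (tailb k).
rewrite (@eq_Edeg _ _ _ _ (fun d : degs => tail_fluct piV (deg_seq d) k j.+1 ^+ 2)); last first.
  by move=> d; rewrite tail_fluctE.
by move=> /le_trans; apply; rewrite lee_fin ler_piMr.
Qed.

Lemma Edeg_bad_Vdegrees :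
  (Edeg piV bad_Vdegrees <= (EX piV (fun d => d%:R ^+ 3) / (B * muV) +
    (2 * (EX piV (fun d => d%:R ^+ 2) / (e ^+ 2 * muV ^+ 2)) +
     K%:R * ((e ^+ 2 * muV ^+ 2)^-1 + (e ^+ 2 * muV ^+ 3)^-1)) / T%:R)%R%:E)%E.
Proof.
have BL : 0 < B * L0 by rewrite mulr_gt0.
set v := EX piV (fun d => d%:R ^+ 2); set m3 := EX piV _.
have vE : T%:R * v / (e * L0) ^+ 2 = v / (e ^+ 2 * muV ^+ 2) / T%:R.
  by field; rewrite !gt_eqF.
rewrite /bad_Vdegrees EdegD; last 2 first.
- by move=> d; rewrite !addr_ge0.
- by move=> d; rewrite sumr_ge0// => k _; exact: bad_fluct_ge0.
rewrite EdegD; [|by move=> d; rewrite addr_ge0|by move=> d].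
rewrite EdegD; [|by move=> d|by move=> d].
set y := v / _; set z := _^-1 + _.
rewrite (_ : m3 / _ + _ = y / T%:R + y / T%:R + m3 / (B * muV) + K%:R * (z / T%:R)); last by ring.
rewrite !EFinD; apply: leeD; [apply: leeD; [apply: leeD|]|].
- rewrite /y -vE.
  have := @Edeg_chebyshev R piV subV T (fun k => k%:R) xpredT (e * L0) (fun k => ler0n _ _) (expb_natr _) eL.
  by rewrite EX_mean// (eq_card (B := 'I_T)) ?card_ord.
- rewrite /y -vE.
  have := @Edeg_chebyshev R piV subV T (fun k => k%:R) (fun v => (v < t)%N) (e * L0) (fun k => ler0n _ _) (expb_natr _) eL.
  by rewrite EX_mean// card_ord_lt.
- have := @Edeg_sum_tail R piV subV T (fun k => k%:R ^+ 3) (B * L0) (fun k => exprn_ge0 _ (ler0n _ _)) (expbX 3 (expb_natr _)) BL.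
  move=> /le_trans; apply; rewrite lee_fin le_eqVlt; apply/orP; left; apply/eqP.
  by rewrite -/m3; field; rewrite !gt_eqF.
have -> : K%:R * (z / T%:R) = (size (index_iota 0 K))%:R * (z / T%:R) by rewrite size_iota subn0.
apply: Edeg_sum_le => // [k d|k _]; first exact: bad_fluct_ge0.
exact: Edeg_bad_fluct.
Qed.

Lemma good_Vdegrees (d : degs) : bad_Vdegrees d < 1 ->
  [/\ `|(total_deg d)%:R - L0| <= e * L0,
      `|\sum_(0 <= j < t) (deg_seq d j)%:R - t%:R * muV| <= e * L0,
      \sum_(0 <= j < t) (deg_seq d j)%:R ^+ 3 <= B * L0 &
      forall k, (k < K)%N -> `|tail_fluct piV (deg_seq d) k t| <= e * L0 /\
        \sum_(0 <= j < t) tail_fluct piV (deg_seq d) k j.+1 ^+ 2 <= e ^+ 2 * L0 ^+ 3].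
Proof.
move=> good; have S0 : 0 <= \sum_(0 <= k < K) bad_fluct k d.
  by rewrite sumr_ge0// => k _; exact: bad_fluct_ge0.
have i0 (b : bool) : 0 <= b%:R :> R by [].
split.
- rewrite /total_deg natr_sum; apply: le_of_indicator good; rewrite /bad_Vdegrees.
  by rewrite -!addrA lerDl !addr_ge0.
- rewrite (sum_deg_seq d (fun m => m%:R))//; apply: le_of_indicator good; rewrite /bad_Vdegrees.
  by rewrite -!addrA addrCA lerDl !addr_ge0.
- rewrite (sum_deg_seq d (fun m => m%:R ^+ 3))//.
  apply: (@le_trans _ _ (\sum_(v < T) (d v)%:R ^+ 3)).
    rewrite big_mkcond/=; apply: ler_sum => v _; by case: ifP.
  apply: le_of_indicator good; rewrite /bad_Vdegrees.
  by rewrite -!addrA addrCA [X in _ + X]addrCA addrCA lerDl !addr_ge0.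
move=> k kK; have bk : bad_fluct k d < 1.
  apply: le_lt_trans good; rewrite /bad_Vdegrees.
  rewrite (bigD1_seq k) ?mem_index_iota ?iota_uniq//= addrCA lerDl !addr_ge0//.
  by rewrite sumr_ge0// => i _; exact: bad_fluct_ge0.
split; apply: le_of_indicator bk; rewrite /bad_fluct ?lerDl// ?lerDr//.
Qed.

End ArrivalDegrees.

(** * The law of the matching size *)

Section GreedyMonotone.
Variables (R : realType) (N T : nat).

Lemma mean_bnd (I : finType) (A : {set I}) (x : I -> R) (c : R) : 0 <= c ->
  (forall i, i \in A -> 0 <= x i <= c) -> 0 <= (\sum_(i in A) x i) / #|A|%:R <= c.
Proof.
move=> c0 xc; rewrite divr_ge0 ?sumr_ge0//=; last by move=> i /xc /andP[].
have [A0|A0] := eqVneq #|A| 0%N; first by rewrite A0 invr0 mulr0.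
rewrite ler_pdivrMr ?ltr0n ?lt0n// mulrC mulr_natl -sumr_const.
by apply: ler_sum => i /xc /andP[].
Qed.

Variables (dU : 'I_N -> nat) (dV : 'I_T -> nat) (omega : 'I_N -> nat).
Variable f : {ffun Vhalf dU dV -> Uhalf dU dV}.

Lemma greedy_prob_indic vs (M : {set Vhalf dU dV}) (Q : pred nat) (b : bool) :
  (forall k, (k <= size vs)%N -> Q (#|M| + k)%N -> b) ->
  0 <= greedy_prob f omega R vs M Q <= b%:R.
Proof.
elim: vs M => [|v vs IH] M Qb /=.
  rewrite ler0n ler_nat; have := Qb 0%N isT; rewrite addn0.
  by case: (Q _) => // ->.
case: ifP => _; first by apply: IH => k kv; apply: Qb; rewrite leqW.
apply: mean_bnd => // e _; apply: IH => k kv.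
rewrite cardsU1 -addnA addnCA; case: (_ \notin _) => /=.
  by rewrite add1n addnS -addnS; exact: (Qb k.+1).
by rewrite add0n; apply: Qb; rewrite leqW.
Qed.

(** Each arrival adds at most one edge. This compares two stopping times of the same run and serves
    to reach s = 1. *)
Lemma greedy_prob_cat_le vs1 vs2 (M : {set Vhalf dU dV}) (Q Q' : pred nat) :
  (forall m k, (k <= size vs2)%N -> Q (m + k)%N -> Q' m) ->
  greedy_prob f omega R (vs1 ++ vs2) M Q <= greedy_prob f omega R vs1 M Q'.
Proof.
move=> QQ'; elim: vs1 M => [|v vs1 IH] M /=.
  by have /andP[] := @greedy_prob_indic vs2 M Q (Q' #|M|) (fun k => @QQ' _ k).
case: ifP => _; first exact: IH.
by rewrite ler_wpM2r ?invr_ge0//; apply: ler_sum => e _; exact: IH.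
Qed.

End GreedyMonotone.

Section GreedyLawBounds.
Variables (R : realType) (N T : nat) (piU piV : probability nat R).
Hypothesis subU : sub_gaussian piU.
Hypothesis subV : sub_gaussian piV.
Variable omega : 'I_N -> nat.

Definition pairing_prob (dU : 'I_N -> nat) (dV : 'I_T -> nat) (t : nat) (Q : pred nat) : R :=
  (\sum_(f in pairings dU dV) greedy_prob f omega R (take t (enum 'I_T)) finset.set0 Q)
    / #|pairings dU dV|%:R.

Lemma pairing_prob_bnd dU dV t Q : 0 <= pairing_prob dU dV t Q <= 1.
Proof. by apply: mean_bnd => // f _; exact: (@greedy_prob_indic _ _ _ _ _ _ _ _ _ _ true). Qed.

Lemma pairing_prob_le dU dV t t' (Q Q' : pred nat) : (t <= t')%N -> (t' <= T)%N ->
  (forall m k, (k <= t' - t)%N -> Q (m + k)%N -> Q' m) ->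
  pairing_prob dU dV t' Q <= pairing_prob dU dV t Q'.
Proof.
move=> tt' t'T QQ'; rewrite /pairing_prob ler_wpM2r ?invr_ge0//.
apply: ler_sum => f _.
have -> : take t' (enum 'I_T) = take t (enum 'I_T) ++ take (t' - t) (drop t (enum 'I_T)).
  by rewrite -[in LHS](subnKC tt') takeD.
apply: greedy_prob_cat_le => m k; rewrite size_take_min => kk; apply: QQ'.
by rewrite (leq_trans kk)// geq_minl.
Qed.

Lemma matching_size_law_le t t' (Q Q' : pred nat) : (t <= t')%N -> (t' <= T)%N ->
  (forall m k, (k <= t' - t)%N -> Q (m + k)%N -> Q' m) ->
  (matching_size_law piU piV T omega t' Q <= matching_size_law piU piV T omega t Q')%E.
Proof.
move=> tt' t'T QQ'; apply: le_esum => d _; rewrite lee_fin ler_wpM2l//.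
  by rewrite mulr_ge0// prodr_ge0// => i _; exact: prob_at_ge0.
exact: pairing_prob_le.
Qed.

Lemma matching_size_law_ge0 t Q : (0 <= matching_size_law piU piV T omega t Q)%E.
Proof.
apply: esum_ge0 => d _; rewrite lee_fin mulr_ge0//; last first.
  by have /andP[] := pairing_prob_bnd d.1 d.2 t Q.
by rewrite mulr_ge0// prodr_ge0// => i _; exact: prob_at_ge0.
Qed.

Lemma esum_deg_weight (pi : probability nat R) n : sub_gaussian pi ->
  (\esum_(d in [set: {ffun 'I_n -> nat}]) (deg_weight pi d)%:E = 1%R%:E)%E.
Proof.
move=> subG; rewrite -(Edeg_cst subG n ler01) /Edeg.
by apply: eq_esum => d _; rewrite mulr1.
Qed.

(** A bound of the form FU + FV separates the two sides of the graph: in each term the weights of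
    the other side sum to 1. *)
Lemma matching_size_law_split t Q (FU : {ffun 'I_N -> nat} -> R)
    (FV : {ffun 'I_T -> nat} -> R) (a b : R) :
  (forall d, 0 <= FU d) -> (forall d, 0 <= FV d) ->
  (forall (d : {ffun 'I_N -> nat}) (d' : {ffun 'I_T -> nat}),
     pairing_prob d d' t Q <= FU d + FV d') ->
  (Edeg piU FU <= a%:E)%E -> (Edeg piV FV <= b%:E)%E ->
  (matching_size_law piU piV T omega t Q <= (a + b)%:E)%E.
Proof.
move=> FU0 FV0 H Ha Hb.
have wU0 (d : {ffun 'I_N -> nat}) : 0 <= deg_weight piU d by exact: deg_weight_ge0.
have wV0 (d : {ffun 'I_T -> nat}) : 0 <= deg_weight piV d by exact: deg_weight_ge0.
apply: (@le_trans _ _ (\esum_(d in [set: {ffun 'I_N -> nat} * {ffun 'I_T -> nat}])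
  (((deg_weight piU d.1 * FU d.1) * deg_weight piV d.2)%:E +
   (deg_weight piU d.1 * (deg_weight piV d.2 * FV d.2))%:E))%E).
  apply: le_esum => d _; rewrite -EFinD lee_fin.
  rewrite (_ : _ + _ = deg_weight piU d.1 * deg_weight piV d.2 * (FU d.1 + FV d.2)); last by ring.
  by apply: ler_wpM2l; [apply: mulr_ge0; [exact: wU0|exact: wV0]|exact: H].
rewrite esumD; last 2 first.
- by move=> d _; rewrite lee_fin !mulr_ge0.
- by move=> d _; rewrite lee_fin !mulr_ge0.
rewrite EFinD; apply: leeD.
  rewrite (@esum_pair _ _ _ (fun d => deg_weight piU d * FU d) (fun d => deg_weight piV d) 1)//.
  - by rewrite mul1e.
  - by move=> d; rewrite mulr_ge0.
  - exact: esum_deg_weight.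
(* [esum_pair] asks for a real value of the inner sum; the assumed bound makes it finite. *)
have bE : (\esum_(d in [set: {ffun 'I_T -> nat}]) (deg_weight piV d * FV d)%:E =
           (fine (Edeg piV FV))%:E)%E.
  rewrite fineK// fin_numE; have h0 := Edeg_ge0 piV FV0; apply/andP; split.
    by rewrite gt_eqF// (lt_le_trans _ h0)// ltNyr.
  by rewrite lt_eqF// (le_lt_trans Hb)// ltry.
rewrite (@esum_pair _ _ _ (fun d => deg_weight piU d) (fun d => deg_weight piV d * FV d) _ wU0 _ bE); last first.
  by move=> d; rewrite mulr_ge0.
by rewrite esum_deg_weight// mule1 -bE.
Qed.

End GreedyLawBounds.

Section FluidLimitTheorem.
Variables (R : realType) (piU piV : probability nat R) (C : nat) (p : nat -> R).
Hypothesis subU : sub_gaussian piU.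
Hypothesis subV : sub_gaussian piV.
Hypothesis muU0 : 0 < mean piU.
Hypothesis muV0 : 0 < mean piV.
Hypothesis C1 : (1 <= C)%N.
Hypothesis p0 : forall c : nat, (1 <= c <= C)%N -> 0 <= p c.
Hypothesis pC : forall c : nat, (C < c)%N -> p c = 0.
Hypothesis p1 : \sum_(1 <= c < C.+1) p c = 1.
Local Notation muU := (mean piU).
Local Notation muV := (mean piV).
Local Notation F := (fluid_rate piU piV p).
Local Notation q := (fluid_open piU p).
Local Notation Lam := (fluid_matched piU C p).

Variables (m : R) (Phi : R -> R).
Hypothesis m0 : 0 < m.
Hypothesis Fb : forall g : R, 0 <= g <= 1 -> m <= F g <= 1.
Hypothesis Phi0 : Phi 0 = 0.
Hypothesis dPhi : forall x : R, -1 < x -> is_derive x (1 : R) Phi (slowness F x).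
Local Notation G := (fluid_time Phi).

Local Notation Kq := (open_lip piU).
Local Notation Kw := (rate_lip piU piV / m ^+ 2).
Local Notation KL := (matched_curv piU C).

Let Flip (g g' : R) : 0 <= g <= 1 -> 0 <= g' <= 1 ->
  `|F g - F g'| <= rate_lip piU piV * `|g - g'|.
Proof. exact: (fluid_rate_lip subU subV muU0 muV0 C1 p0 pC p1). Qed.

Let K0 : 0 <= rate_lip piU piV. Proof. exact: rate_lip_ge0. Qed.

Let Kw0 : 0 <= Kw. Proof. by rewrite divr_ge0// exprn_ge0// ltW. Qed.

Let KL0 : 0 <= KL.
Proof. by rewrite mulr_ge0 ?mulr_ge0//; apply: EX_ge0 => //; exact: expb_sq. Qed.

Let w_bnd (g : R) : 0 <= slowness F g <= m^-1.
Proof. by rewrite (slowness_le m0 Fb) (le_trans ler01 (slowness_ge1 m0 Fb g)). Qed.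

Let w_rate (g : R) : 0 <= g <= 1 ->
  slowness F g * EX piV (fun d => psi d (q g)) = muV.
Proof.
move=> g01; have /andP[F0 _] := Fb g01.
have {}F0 : F g != 0 by rewrite gt_eqF// (lt_le_trans m0).
rewrite /slowness (clamp_id g01).
have -> : EX piV (fun d => psi d (q g)) = F g * muV by rewrite /fluid_rate divfK// gt_eqF.
by rewrite mulKf.
Qed.

Let Lam_taylor (y z : R) : 0 <= y <= 1 -> 0 <= z <= 1 ->
  `|Lam z - Lam y - muU * q y * (z - y)| <= KL * (z - y) ^+ 2.
Proof.
move=> y01 z01; rewrite /fluid_open mulrCA mulfV ?mulr1 ?gt_eqF//.
exact: (fluid_matched_taylor subU muU0 muV0 C1 p0 pC p1).
Qed.

Definition grid_error (K : nat) (e B : R) : R :=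
  2 * C%:R * e + (2 * B + open_lip piU) / K%:R.

Lemma matching_size_law_bound (N T : nat) (omega : 'I_N -> nat) (t K K' : nat)
    (s e B tau : R) :
  0 <= s -> s < 1 -> (0 < N)%N -> T%:R * muV = N%:R * muU ->
  (forall u, (1 <= omega u <= C)%N) ->
  (forall c, (1 <= c <= C)%N ->
    `|#|[set u | omega u == c]%SET|%:R - N%:R * p c| <= e * N%:R) ->
  (t <= T)%N -> `|t%:R * muV - s * (N%:R * muU)| <= e * (N%:R * muU) ->
  (0 < K)%N -> (0 < K')%N -> 1 <= B -> 0 < e -> 8 * e <= 1 - s ->
  1 <= e * (N%:R * muU) -> 0 < tau ->
  2 * total_error piV Kq m^-1 Kw KL muU muV K e B <= tau ->
  (matching_size_law piU piV T omega t
     [pred k : nat | (tau * N%:R < `|k%:R - N%:R * Lam (G s)|)%R] <=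
   (((EX piU (fun d => d%:R ^+ 3) / (B * muU) +
     (1 + (C * K'.+1)%:R) * (EX piU (fun d => d%:R ^+ 2) / (e ^+ 2 * muU ^+ 2)) / N%:R) +
    (EX piV (fun d => d%:R ^+ 3) / (B * muV) +
     (2 * (EX piV (fun d => d%:R ^+ 2) / (e ^+ 2 * muV ^+ 2)) +
      K%:R * ((e ^+ 2 * muV ^+ 2)^-1 + (e ^+ 2 * muV ^+ 3)^-1)) / T%:R +
     sampling_error m^-1 KL muU s e (grid_error K' e B) B tau)))%R%:E)%E.
Proof.
move=> s0 s1 N0 TN omC frac tT ht K00 K'0 B1 e0 es eL0 tau0 te.
have B0 : 0 < B by exact: lt_le_trans B1.
have NR : 0 < N%:R :> R by rewrite ltr0n.
have T0 : (0 < T)%N.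
  by rewrite -(ltr0n R) -(pmulr_lgt0 _ muV0) TN mulr_gt0.
have z0 : 0 <= grid_error K' e B.
  apply: addr_ge0; first by rewrite mulr_ge0// ltW.
  apply: divr_ge0 => //; apply: addr_ge0; first by rewrite mulr_ge0// ltW.
  exact: open_lip_ge0.
set se := sampling_error _ _ _ _ _ _ _ _.
have se0 : 0 <= se.
  have h : 0 <= 1 + 192 * (B + 1) / (1 - s).
    by rewrite addr_ge0// divr_ge0 ?subr_ge0 ?(ltW s1)// mulr_ge0// addr_ge0// ltW.
  have mV : 0 <= m^-1 by rewrite invr_ge0 ltW.
  rewrite /se /sampling_error; apply: mulr_ge0; last first.
    apply: addr_ge0; first by rewrite mulr_ge0// ltW.
    by rewrite mulr_ge0// sqr_ge0.
  apply: mulr_ge0; first by rewrite divr_ge0 ?sqr_ge0// mulr_ge0// sqr_ge0.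
  apply: addr_ge0 => //; rewrite mulr_ge0 ?(ltW B0)// mulr_ge0 ?sqr_ge0//.
  by rewrite mulr_ge0 ?sqr_ge0.
have [Gs01 PhiGs] := fluid_timeP m0 Fb Phi0 dPhi s.
rewrite clamp_id in PhiGs; last by rewrite s0 ltW.
apply: (matching_size_law_split subU subV (FU := bad_Udegrees piU C omega K' e B)
  (FV := fun d => bad_Vdegrees piV t K e B d + se)).
- by move=> d; exact: bad_Udegrees_ge0.
- by move=> d; rewrite addr_ge0//; exact: bad_Vdegrees_ge0.
- move=> d d'.
  have bU0 := bad_Udegrees_ge0 piU C omega K' e B d.
  have bV0 := bad_Vdegrees_ge0 piV t K e B d'.
  have bnd1 Q : pairing_prob R omega d d' t Q <= 1.
    by have /andP[] := pairing_prob_bnd R omega d d' t Q.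
  (* If a bad event occurs on either side, the bound is at least 1 and holds trivially; otherwise
     the deterministic estimate gives [se]. *)
  have [gU|gU] := ltP (bad_Udegrees piU C omega K' e B d) 1; last first.
    by apply: (le_trans (bnd1 _)); apply: (le_trans gU); rewrite lerDl addr_ge0.
  have [gV|gV] := ltP (bad_Vdegrees piV t K e B d') 1; last first.
    by apply: (le_trans (bnd1 _)); apply: (le_trans gV); rewrite addrCA lerDl addr_ge0.
  have [hU1 hU3] := good_Udegrees gU.
  have [hV1 hV2 hV3 hV45] := good_Vdegrees tT gV.
  rewrite TN in hV1 hV2 hV3 hV45.
  have hopen (g : R) : 0 <= g <= 1 ->
     `|open_sum d omega g - N%:R * (muU * q g)| <= grid_error K' e B * (N%:R * muU).
    move=> g01; rewrite /fluid_open [muU * _]mulrCA mulfV ?mulr1 ?gt_eqF//.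
    exact: (open_sum_close subU muU0 C1 p0 pC p1 omC K'0 N0 gU frac g01).
  apply: (@le_trans _ _ se); last by rewrite addrA lerDr addr_ge0.
  apply: (@good_degrees_pairing_prob R piV subV q (slowness F) Phi Lam Kq m^-1 Kw KL muU muV s (G s)
    _ _ _ w_bnd _ Kw0 _ _ Phi0 w_rate muU0 muV0 KL0 _ Lam_taylor s0 s1 Gs01 PhiGs
    N T d d' omega t K (N%:R * muU) e (grid_error K' e B) B tau tT K00 B1 e0 es eL0
    erefl hU1 hV1 hU3 hV3 hopen z0 hV2 _ _ ht tau0 te).
  + by move=> g g01; exact: (fluid_open_bnd subU muU0 C1 p0 pC p1 g01).
  + by move=> g g' g01 g01'; exact: (fluid_open_lip subU muU0 C1 p0 pC p1 g01 g01').
  + exact: open_lip_ge0.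
  + exact: (slowness_lip m0 K0 Fb Flip).
  + by move=> y z y0 yz; exact: (Phi_taylor m0 K0 Fb Flip dPhi y0 yz).
  + by move=> y z y0 z0'; exact: (Phi_expand_norm m0 Fb dPhi y0 z0').
  + exact: fluid_matched0.
  + by move=> k /hV45[].
  + by move=> k /hV45[].
- exact: Edeg_bad_Udegrees.
rewrite EdegD//; last by move=> d; exact: bad_Vdegrees_ge0.
rewrite EFinD; apply: leeD; first exact: Edeg_bad_Vdegrees.
by rewrite Edeg_cst.
Qed.

End FluidLimitTheorem.

(** * Choice of the parameters *)

Section SmallParameters.
Variable R : realType.

Lemma exists_small (l : seq (R * R)) : all (fun c => (0 <= c.1) && (0 < c.2)) l ->
  exists2 e : R, 0 < e & all (fun c => c.1 * e <= c.2) l.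
Proof.
elim: l => [|[a x] l IH] /=; first by exists 1.
move=> /andP[/andP[a0 x0] /[dup] lP /IH[e e0 el]].
have a1 : 0 < a + 1 by rewrite ltr_wpDl.
exists (Num.min e (x / (a + 1))); first by rewrite lt_min e0 divr_gt0.
apply/andP; split.
  apply: (@le_trans _ _ (a * (x / (a + 1)))); first by rewrite ler_wpM2l// ge_min lexx orbT.
  rewrite mulrA ler_pdivrMr// mulrC ler_wpM2l ?(ltW x0)// lerDl//.
apply/allP => c cl; have /andP[c0 _] := allP lP c cl.
apply: le_trans (allP el c cl); rewrite ler_wpM2l// ge_min lexx//.
Qed.

Lemma exists_large (a x : R) : 0 <= a -> 0 < x -> exists2 K : nat, (0 < K)%N & a / K%:R <= x.
Proof.
move=> a0 x0; exists (Num.truncn (a / x)).+1 => //.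
rewrite ler_pdivrMr ?ltr0n// mulrC -ler_pdivrMr//.
have ax0 : 0 <= a / x by rewrite divr_ge0// ltW.
by have /andP[_ /ltW] := truncn_itv ax0.
Qed.

(** The order matters: [B] is large against the third moments, [K] makes the truncation of [psi]
    small and [K'] the mesh of the grid, both given [B]; e comes last, as its coefficients in the
    errors involve [B] and [K]. *)
Lemma exists_parameters (piV : probability nat R) (Kq W Kw KL muU muV s tau eta Y zU : R) (C : nat) :
  sub_gaussian piV -> 0 <= Kq -> 0 <= W -> 0 <= Kw -> 0 <= KL -> 0 < muU -> 0 < muV ->
  s < 1 -> 0 < tau -> 0 < eta -> 0 <= Y -> 0 <= zU ->
  exists (B e : R) (K K' : nat),
    [/\ 1 <= B, Y / B <= eta, (0 < K)%N & (0 < K')%N] /\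
    [/\ 0 < e, 8 * e <= 1 - s,
      2 * total_error piV Kq W Kw KL muU muV K e B <= tau &
      sampling_error W KL muU s e (2 * C%:R * e + (2 * B + zU) / K'%:R) B tau <= eta].
Proof.
move=> subV Kq0 W0 Kw0 KL0 muU0 muV0 s1 tau0 eta0 Y0 zU0.
have ms : 0 < 1 - s by rewrite subr_gt0.
pose B := 1 + Y / eta.
have B1 : 1 <= B by rewrite lerDl divr_ge0// ltW.
have B0 : 0 < B by exact: lt_le_trans B1.
have YB : Y / B <= eta.
  by rewrite ler_pdivrMr// /B mulrDr mulr1 mulrC divfK ?gt_eqF// lerDr ltW.
pose v := EX piV (fun d => d%:R ^+ 2).
have v0 : 0 <= v by apply: EX_ge0 => //; exact: expb_sq.
have muKL : 0 <= muU + KL by rewrite addr_ge0// ltW.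
pose a2 := (muU + KL) * (2 * W * (B + 2 * v / muV)).
have a20 : 0 <= a2.
  apply: mulr_ge0 => //; apply: mulr_ge0; first by rewrite mulr_ge0.
  by rewrite addr_ge0 ?(ltW B0)// divr_ge0 ?(ltW muV0)// mulr_ge0.
have tau4 : 0 < tau / 4 by rewrite divr_gt0.
have [K K0 KP] := exists_large a20 tau4.
pose S := (8 * muU ^+ 2 / tau ^+ 2) * (4 + 2 * noise_gain KL muU ^+ 2 * W ^+ 2 * B).
have S0 : 0 <= S.
  apply: mulr_ge0.
    by apply: divr_ge0; [rewrite mulr_ge0 ?sqr_ge0|exact: sqr_ge0].
  apply: addr_ge0 => //; apply: mulr_ge0; last exact: ltW.
  by apply: mulr_ge0; [rewrite mulr_ge0 ?sqr_ge0|exact: sqr_ge0].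
pose z2 := 2 * B + zU.
have z20 : 0 <= z2 by rewrite addr_ge0// mulr_ge0// ltW.
have S8 : 0 <= (8 * S + 1) * z2 by rewrite mulr_ge0// addr_ge0// mulr_ge0.
(* The bound 1/2, together with the one imposed on e, gives y <= 1 below, so that y^2 <= y and the
   quadratic error becomes linear. *)
have min0 : 0 < Num.min (eta / 2) (1 / 2) by rewrite lt_min !divr_gt0.
have [K' K'0 K'P] := exists_large S8 min0.
have KK : 0 <= Kw + W * K%:R * Kq by rewrite addr_ge0// !mulr_ge0.
have KW : 0 <= Kw + W * Kq by rewrite addr_ge0// mulr_ge0.
have B10 : 0 <= B + 1 by rewrite addr_ge0// ltW.
(* The coefficient of e in [total_error]; the rest of it is a2 / K. *)
pose A1 := KL + (muU + KL) + (muU + KL) * (4 * (Kw + W * Kq) * B +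
   2 * (K%:R * W + K%:R * (Kw + W * K%:R * Kq) * (2 * (B + 1))) + 4).
have A10 : 0 <= A1.
  apply: addr_ge0; first exact: addr_ge0.
  apply: mulr_ge0 => //; apply: addr_ge0 => //; apply: addr_ge0.
    by apply: mulr_ge0; [exact: mulr_ge0|exact: ltW].
  apply: mulr_ge0 => //; apply: addr_ge0; first exact: mulr_ge0.
  by apply: mulr_ge0; exact: mulr_ge0.
pose c1 := 1 + 192 * (B + 1) / (1 - s).
have c10 : 0 <= c1.
  by apply: addr_ge0 => //; apply: divr_ge0; [exact: mulr_ge0|exact: ltW].
pose a3 : R := S * c1 + 8 * S * (2 * C%:R + 1).
have a30 : 0 <= a3.
  by apply: addr_ge0; [exact: mulr_ge0|apply: mulr_ge0; [exact: mulr_ge0|apply: addr_ge0 => //; exact: mulr_ge0]].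
have C20 : 0 <= 2 * C%:R + 1 :> R by apply: addr_ge0 => //; exact: mulr_ge0.
have [|e e0 /and5P[eA ea3 eC e8 _]] := @exists_small
  [:: (A1, tau / 4); (a3, eta / 2); (2 * C%:R + 1, 1 / 2); (8, 1 - s)].
  by apply/and5P; split => //=; apply/andP; split => //; exact: divr_gt0.
rewrite /= in eA ea3 eC e8.
exists B, e, K, K'; split; split => //.
  have -> : total_error piV Kq W Kw KL muU muV K e B = A1 * e + a2 / K%:R.
    by rewrite /total_error /drift_error -/v /A1 /a2; ring.
  by move: eA KP; lra.
have zK0 : 0 <= z2 / K'%:R by rewrite divr_ge0.
have [h1 h2] : 8 * S * (z2 / K'%:R) <= eta / 2 /\ z2 / K'%:R <= 1 / 2.
  have E : (8 * S + 1) * z2 / K'%:R = 8 * S * (z2 / K'%:R) + z2 / K'%:R by ring.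
  have m1 : 0 <= 8 * S * (z2 / K'%:R) by rewrite mulr_ge0// mulr_ge0.
  move: K'P; rewrite E le_min => /andP[k1 k2]; split; lra.
pose y := (2 * C%:R + 1) * e + z2 / K'%:R.
have y0 : 0 <= y by rewrite addr_ge0// mulr_ge0// ltW.
have y1 : y <= 1 by move: eC h2; rewrite /y; lra.
have yy : y ^+ 2 <= y by rewrite expr2 ler_piMr.
rewrite /sampling_error -/S -/c1.
rewrite (_ : 2 * (2 * _ + 2 * e) ^+ 2 = 8 * y ^+ 2); last by rewrite /y -/z2; ring.
apply: (@le_trans _ _ (S * (c1 * e + 8 * y))); first by rewrite ler_wpM2l// lerD2l ler_wpM2l.
rewrite (_ : S * _ = a3 * e + 8 * S * (z2 / K'%:R)); last by rewrite /a3 /y; ring.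
by move: ea3 h1; lra.
Qed.

End SmallParameters.

(** * Passage to the limit for s < 1 *)

Section Asymptotics.
Variables (R : realType) (piU piV : probability nat R) (C : nat) (p : nat -> R).
Hypothesis subU : sub_gaussian piU.
Hypothesis subV : sub_gaussian piV.
Hypothesis muU0 : 0 < mean piU.
Hypothesis muV0 : 0 < mean piV.
Hypothesis C1 : (1 <= C)%N.
Hypothesis p0 : forall c : nat, (1 <= c <= C)%N -> 0 <= p c.
Hypothesis pC : forall c : nat, (C < c)%N -> p c = 0.
Hypothesis p1 : \sum_(1 <= c < C.+1) p c = 1.
Local Notation muU := (mean piU).
Local Notation muV := (mean piV).
Local Notation F := (fluid_rate piU piV p).
Local Notation Lam := (fluid_matched piU C p).
Variables (m : R) (Phi : R -> R).
Hypothesis m0 : 0 < m.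
Hypothesis Fb : forall g : R, 0 <= g <= 1 -> m <= F g <= 1.
Hypothesis Phi0 : Phi 0 = 0.
Hypothesis dPhi : forall x : R, -1 < x -> is_derive x (1 : R) Phi (slowness F x).
Local Notation G := (fluid_time Phi).

Variables (N T : nat -> nat) (omega : forall n : nat, 'I_(N n) -> nat).
Hypothesis N_ge1 : forall n : nat, (1 <= N n)%N.
Hypothesis N_infty : N n @[n --> \oo] --> \oo.
Hypothesis T_def : forall n : nat, (T n)%:R = muU / muV * (N n)%:R.
Hypothesis omega_range : forall (n : nat) (u : 'I_(N n)), (1 <= @omega n u <= C)%N.
Hypothesis omega_frac : forall c : nat, (1 <= c <= C)%N ->
  #|[set u : 'I_(N n) | @omega n u == c]%SET|%:R / (N n)%:R @[n --> \oo] --> p c.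

Lemma N_large (A : R) : \forall n \near \oo, A <= (N n)%:R.
Proof.
have h : \forall n \near \oo, ((Num.truncn A).+1 <= N n)%N.
  exact: N_infty (nbhs_infty_ge _).
near=> n; have [A0|/ltW A0] := leP 0 A; last by rewrite (le_trans A0).
have /andP[_ /ltW /le_trans] := truncn_itv A0; apply; rewrite ler_nat.
by near: n.
Unshelve. all: by end_near. Qed.

Lemma omega_frac_near (e : R) : 0 < e -> \forall n \near \oo,
  forall c, (1 <= c <= C)%N ->
  `|#|[set u : 'I_(N n) | @omega n u == c]%SET|%:R - (N n)%:R * p c| <= e * (N n)%:R.
Proof.
move=> e0.
have H j : (j <= C)%N -> \forall n \near \oo, forall c, (1 <= c <= j)%N ->
  `|#|[set u : 'I_(N n) | @omega n u == c]%SET|%:R - (N n)%:R * p c| <= e * (N n)%:R.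
  elim: j => [|j IH] jC.
    by near=> n => c /andP[c1 c0]; move: (leq_trans c1 c0).
  have h1 := IH (ltnW jC).
  have := omega_frac (c := j.+1) jC => /cvgrPdist_le /(_ e e0) h2.
  near=> n => c /andP[c1]; rewrite leq_eqVlt => /orP[/eqP ->|cj]; last first.
    by have := (near h1 n) => /(_ _ c); apply => //; rewrite c1.
  have NR : 0 < (N n)%:R :> R by rewrite ltr0n N_ge1.
  have : `|p j.+1 - #|[set u | @omega n u == j.+1]%SET|%:R / (N n)%:R| <= e by near: n.
  rewrite -(ler_pM2r NR) -[X in _ * X <= _ -> _](gtr0_norm NR) -normrM mulrBl divfK ?gt_eqF//.
  by rewrite distrC mulrC.
exact: H.
Unshelve. all: by end_near. Qed.

Lemma matching_size_law_near (s tau eta : R) : 0 <= s -> s < 1 -> 0 < tau -> 0 < eta ->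
  \forall n \near \oo, (matching_size_law piU piV (T n) (@omega n) (Num.truncn (s * (T n)%:R))
     [pred k : nat | (tau * (N n)%:R < `|k%:R - (N n)%:R * Lam (G s)|)%R] <= eta%:E)%E.
Proof.
move=> s0 s1 tau0 eta0.
(* One quarter each for the third moments divided by [B], the terms in 1/N and in 1/T, and the
   sampling error. *)
have eta4 : 0 < eta / 4 by rewrite divr_gt0.
pose MU := EX piU (fun d => d%:R ^+ 3); pose MV := EX piV (fun d => d%:R ^+ 3).
have e3 : expb (fun d => d%:R ^+ 3 : R) by exact: (expbX 3 (expb_natr _)).
have Y0 : 0 <= MU / muU + MV / muV.
  by rewrite addr_ge0// divr_ge0 ?(ltW muU0) ?(ltW muV0)//; apply: EX_ge0.
have mV0 : 0 <= m^-1 by rewrite invr_ge0 ltW.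
have Kw0 : 0 <= rate_lip piU piV / m ^+ 2.
  by rewrite divr_ge0 ?sqr_ge0//; exact: rate_lip_ge0.
have KL0 : 0 <= matched_curv piU C.
  by rewrite mulr_ge0 ?mulr_ge0//; apply: EX_ge0 => //; exact: expb_sq.
have Kq0 : 0 <= open_lip piU by exact: open_lip_ge0.
have [B [e [K [K' [[B1 YB K0 K'0] [e0 es te se]]]]]] :=
  exists_parameters C subV Kq0 mV0 Kw0 KL0 muU0 muV0 s1 tau0 eta4 Y0 Kq0.
have B0 : 0 < B by exact: lt_le_trans B1.
pose cU := (1 + (C * K'.+1)%:R) * (EX piU (fun d => d%:R ^+ 2) / (e ^+ 2 * muU ^+ 2)).
pose cV := 2 * (EX piV (fun d => d%:R ^+ 2) / (e ^+ 2 * muV ^+ 2)) +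
      K%:R * ((e ^+ 2 * muV ^+ 2)^-1 + (e ^+ 2 * muV ^+ 3)^-1).
have hfrac := omega_frac_near e0.
have hU := N_large (cU / (eta / 4)); have hV := N_large (cV * muV / muU / (eta / 4)).
have h1 := N_large (e * muU)^-1; have h2 := N_large (muV / (e * muU)).
near=> n.
have NR : 0 < (N n)%:R :> R by rewrite ltr0n N_ge1.
have TN : (T n)%:R * muV = (N n)%:R * muU by rewrite T_def; field; rewrite gt_eqF.
have TR : 0 < (T n)%:R :> R by rewrite -(pmulr_lgt0 _ muV0) TN mulr_gt0.
have sT0 : 0 <= s * (T n)%:R by rewrite mulr_ge0// ltW.
have /andP[t1 t2] := truncn_itv sT0.
set t := Num.truncn _ in t1 t2 *.
have eU : 0 < e * muU by rewrite mulr_gt0.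
have tT : (t <= T n)%N.
  by rewrite -(ler_nat R); apply: (le_trans t1); rewrite ler_piMl ?ltW.
have n1 : 1 <= e * ((N n)%:R * muU).
  have : (e * muU)^-1 <= (N n)%:R by near: n.
  by rewrite -[X in X <= _]mul1r ler_pdivrMr// => h; rewrite mulrCA.
have n2 : muV <= e * ((N n)%:R * muU).
  have : muV / (e * muU) <= (N n)%:R by near: n.
  by rewrite ler_pdivrMr// => h; rewrite mulrCA.
have ht : `|t%:R * muV - s * ((N n)%:R * muU)| <= e * ((N n)%:R * muU).
  rewrite -TN mulrA -mulrBl normrM (gtr0_norm muV0) TN.
  apply: le_trans n2; rewrite ler_piMl ?(ltW muV0)//.
  rewrite distrC ger0_norm ?subr_ge0// lerBlDr addrC natr1 ltW//.
have frac : forall c, (1 <= c <= C)%N ->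
   `|#|[set u : 'I_(N n) | @omega n u == c]%SET|%:R - (N n)%:R * p c| <= e * (N n)%:R by near: n.
have nU : cU / (N n)%:R <= eta / 4.
  have : cU / (eta / 4) <= (N n)%:R by near: n.
  by rewrite !ler_pdivrMr// mulrC.
have nV : cV / (T n)%:R <= eta / 4.
  have : cV * muV / muU / (eta / 4) <= (N n)%:R by near: n.
  rewrite !ler_pdivrMr// => h; rewrite -(ler_pM2r muV0) -mulrA TN.
  by apply: (le_trans h); rewrite le_eqVlt; apply/orP; left; apply/eqP; ring.
apply: (le_trans (@matching_size_law_bound R piU piV C p subU subV muU0 muV0 C1 p0 pC p1 m Phi
  m0 Fb Phi0 dPhi (N n) (T n) (@omega n) t K K' s e B tau s0 s1 (N_ge1 n) TN
  (@omega_range n) frac tT ht K0 K'0 B1 e0 es n1 tau0 te)).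
rewrite lee_fin -/cU -/cV -/MU -/MV.
have YE : MU / (B * muU) + MV / (B * muV) = (MU / muU + MV / muV) / B.
  by field; rewrite !gt_eqF.
move: YB se nU nV YE; rewrite -/(grid_error piU C K' e B); lra.
Unshelve. all: by end_near. Qed.

End Asymptotics.

(** * Solutions of the equation, and the endpoint s = 1 *)

Section Endpoint.
Variables (R : realType) (piU piV : probability nat R) (C : nat) (p : nat -> R).
Hypothesis subU : sub_gaussian piU.
Hypothesis subV : sub_gaussian piV.
Hypothesis muU0 : 0 < mean piU.
Hypothesis muV0 : 0 < mean piV.
Hypothesis C1 : (1 <= C)%N.
Hypothesis p0 : forall c : nat, (1 <= c <= C)%N -> 0 <= p c.
Hypothesis pC : forall c : nat, (C < c)%N -> p c = 0.
Hypothesis p1 : \sum_(1 <= c < C.+1) p c = 1.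
Local Notation muU := (mean piU).
Local Notation muV := (mean piV).
Local Notation F := (fluid_rate piU piV p).
Local Notation Lam := (fluid_matched piU C p).

Let cM (f h : R -> R) (x : R) : {for x, continuous f} -> {for x, continuous h} ->
  {for x, continuous (fun g => f g * h g)}.
Proof. exact: continuousM. Qed.

Let cB (a : R) (f : R -> R) (x : R) : {for x, continuous f} -> {for x, continuous (fun g => a - f g)}.
Proof. by apply: continuousB; exact: cst_continuous. Qed.

Let c_cst (a x : R) : {for x, continuous (fun=> a : R)}.
Proof. exact: cst_continuous. Qed.

Lemma derive1n_gen_fun_continuous (pi : probability nat R) k : sub_gaussian pi ->
  continuous (derive1n k (gen_fun pi)).
Proof.
move=> subG g; apply: differentiable_continuous; apply/derivable1_diffP.
exact: derivable_derive1n_gen_fun.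
Qed.

Lemma Gamma_continuous : continuous (Gamma (gen_fun piU) C p).
Proof.
have dc k : continuous (fun g : R => derive1n k (gen_fun piU) (1 - g)).
  move=> g; apply: (@continuous_comp _ _ _ (fun g : R => 1 - g) (derive1n k (gen_fun piU))).
    by apply: cB; exact: id.
  exact: derive1n_gen_fun_continuous.
move=> g.
apply: (@continuousD _ R R (fun g : R => derive1n 1 (gen_fun piU) (1 - g))); first exact: dc.
apply: continuous_sumr => k x.
apply: (cM (f := fun g : R => (1 - cumul p k) * g ^+ k / k`!%:R)); last exact: dc.
apply: (cM (f := fun g : R => (1 - cumul p k) * g ^+ k)) => //.
by apply: (cM (h := fun g : R => g ^+ k)) => //; exact: exprn_continuous.
Qed.

Lemma greedy_rhs_continuous (g : R) : 0 <= g < 1 ->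
  {for g, continuous (greedy_rhs (gen_fun piU) (gen_fun piV) muU muV C p)}.
Proof.
move=> g01; have gc : {for g, continuous (Gamma (gen_fun piU) C p)} by exact: Gamma_continuous.
apply: cM.
  apply: cB.
  apply: (@continuous_comp _ _ _ (fun g => 1 - Gamma (gen_fun piU) C p g / muU) (gen_fun piV)).
    by apply: cB; apply: cM.
  have c : continuous (gen_fun piV) := derive1n_gen_fun_continuous (k := 0) subV.
  exact: c.
apply: continuousV; last exact: cM.
rewrite (GammaE subU C1 pC p1) mulf_neq0//; first by rewrite mulf_neq0// ?invr_eq0 gt_eqF.
by rewrite gt_eqF// (fluid_Gamma_gt0 subU muU0 C1 p0 pC p1).
Qed.

Variables (m : R) (Phi : R -> R).
Hypothesis m0 : 0 < m.
Hypothesis Fb : forall g : R, 0 <= g <= 1 -> m <= F g <= 1.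
Hypothesis Phi0 : Phi 0 = 0.
Hypothesis dPhi : forall x : R, -1 < x -> is_derive x (1 : R) Phi (slowness F x).
Local Notation G := (fluid_time Phi).
Local Notation rhs := (greedy_rhs (gen_fun piU) (gen_fun piV) muU muV C p).

Lemma rhsE (g : R) : 0 <= g < 1 -> rhs g = F g.
Proof. exact: (greedy_rhsE subU subV muU0 muV0 C1 p0 pC p1). Qed.

Lemma fluid_time_solution :
  greedy_ode_solution (gen_fun piU) (gen_fun piV) muU muV C p G.
Proof.
split; first exact/continuous_subspaceT/(fluid_time_continuous m0 Fb Phi0 dPhi).
  exact: (fluid_time0 m0 Fb Phi0 dPhi).
move=> s; rewrite in_itv/= => /andP[s0 s1].
have s01 : 0 <= s <= 1 by rewrite !ltW.
rewrite rhsE; first by apply: (fluid_time_derive m0 Fb Phi0 dPhi); rewrite s0.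
rewrite (fluid_time_ge0 m0 Fb Phi0 dPhi)/=.
exact: le_lt_trans (fluid_time_le m0 Fb Phi0 dPhi s01) s1.
Qed.

Lemma solution_unique (H : R -> R) :
  greedy_ode_solution (gen_fun piU) (gen_fun piV) muU muV C p H -> {in `[0, 1], H =1 G}.
Proof.
move=> [Hc H0 dH].
exact: (fluid_time_unique m0 Fb Phi0 dPhi greedy_rhs_continuous rhsE Hc H0 dH).
Qed.

Variables (N T : nat -> nat) (omega : forall n : nat, 'I_(N n) -> nat).
Hypothesis N_ge1 : forall n : nat, (1 <= N n)%N.
Hypothesis N_infty : N n @[n --> \oo] --> \oo.
Hypothesis T_def : forall n : nat, (T n)%:R = muU / muV * (N n)%:R.
Hypothesis omega_range : forall (n : nat) (u : 'I_(N n)), (1 <= @omega n u <= C)%N.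
Hypothesis omega_frac : forall c : nat, (1 <= c <= C)%N ->
  #|[set u : 'I_(N n) | @omega n u == c]%SET|%:R / (N n)%:R @[n --> \oo] --> p c.

(** The result at s = 1 - d is transferred to 1: the remaining arrivals, about d T of them, add at
    most one edge each, and [Lam] and [G] are Lipschitz. *)
Lemma matching_size_law_near_end (tau eta : R) : 0 < tau -> 0 < eta ->
  \forall n \near \oo, (matching_size_law piU piV (T n) (@omega n) (T n)
     [pred k : nat | (tau * (N n)%:R < `|k%:R - (N n)%:R * Lam (G 1)|)%R] <= eta%:E)%E.
Proof.
move=> tau0 eta0; have tau4 : 0 < tau / 4 by rewrite divr_gt0.
have KL0 : 0 <= matched_curv piU C.
  by rewrite mulr_ge0 ?mulr_ge0//; apply: EX_ge0 => //; exact: expb_sq.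
have muKL : 0 <= muU + matched_curv piU C by rewrite addr_ge0// ltW.
have mUV : 0 <= muU / muV by rewrite divr_ge0// ltW.
(* Three demands on d: s >= 0, a change of [Lam] along [G] below tau / 4, and at most tau N / 4 late
   arrivals up to rounding. *)
have [|d d0 /and4P[d1 d2 d3 _]] := @exists_small R
  [:: (1, 1); (muU + matched_curv piU C, tau / 4); (muU / muV, tau / 4)].
  by apply/and4P; split => //=; apply/andP; split.
rewrite /= mul1r in d1 d2 d3; pose s := 1 - d.
have s0 : 0 <= s by rewrite subr_ge0.
have s1 : s < 1 by rewrite /s ltrBlDr ltrDl.
have near_s := matching_size_law_near subU subV muU0 muV0 C1 p0 pC p1 m0 Fb Phi0 dPhi
  N_ge1 N_infty T_def omega_range omega_frac s0 s1 tau4 eta0.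
have largeN := N_large N_infty (4 / tau).
have Gs01 := (fluid_timeP m0 Fb Phi0 dPhi s).1; have G101 := (fluid_timeP m0 Fb Phi0 dPhi 1).1.
have LG : `|Lam (G 1) - Lam (G s)| <= tau / 4.
  apply: le_trans d2.
  have LT (y z : R) : 0 <= y <= 1 -> 0 <= z <= 1 ->
     `|Lam z - Lam y - muU * fluid_open piU p y * (z - y)| <= matched_curv piU C * (z - y) ^+ 2.
    move=> y01 z01; rewrite /fluid_open mulrCA mulfV ?mulr1 ?gt_eqF//.
    exact: (fluid_matched_taylor subU muU0 muV0 C1 p0 pC p1).
  have q01 (g : R) : 0 <= g <= 1 -> 0 <= fluid_open piU p g <= 1.
    by move=> g01; exact: (fluid_open_bnd subU muU0 C1 p0 pC p1 g01).
  apply: (le_trans (Lam_lip q01 muU0 KL0 LT Gs01 G101)); rewrite ler_wpM2l//.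
  apply: (le_trans (fluid_time_lip m0 Fb Phi0 dPhi 1 s)).
  by rewrite mul1r /s subKr gtr0_norm.
near=> n.
have NR : 0 < (N n)%:R :> R by rewrite ltr0n N_ge1.
have N4 : 1 <= tau / 4 * (N n)%:R.
  have : 4 / tau <= (N n)%:R by near: n.
  rewrite ler_pdivrMr// => h; lra.
have : (matching_size_law piU piV (T n) (@omega n) (Num.truncn (s * (T n)%:R))
     [pred k : nat | (tau / 4 * (N n)%:R < `|k%:R - (N n)%:R * Lam (G s)|)%R] <= eta%:E)%E by near: n.
apply: le_trans.
have sT0 : 0 <= s * (T n)%:R by rewrite mulr_ge0.
have /andP[t1 t2] := truncn_itv sT0; set t := Num.truncn _ in t1 t2 *.
have tT : (t <= T n)%N by rewrite -(ler_nat R); apply: (le_trans t1); rewrite ler_piMl// ltW.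
apply: matching_size_law_le => // k j jt /=.
(* The second quarter absorbs the rounding of s T, as tau N / 4 >= 1. With a quarter for the change
   of [Lam] and one for the deviation at s, this makes tau N. *)
have jR : j%:R <= tau / 4 * (N n)%:R + tau / 4 * (N n)%:R.
  have : j%:R <= (T n)%:R - t%:R :> R by rewrite -natrB// ler_nat.
  have : d * (T n)%:R <= tau / 4 * (N n)%:R.
    by rewrite T_def mulrA ler_wpM2r// mulrC.
  by move: t2 N4; rewrite -natr1 /s; lra.
have NL : `|(N n)%:R * (Lam (G 1) - Lam (G s))| <= tau / 4 * (N n)%:R.
  by rewrite normrM normr_nat mulrC ler_wpM2r.
rewrite natrD; set x := k%:R; set L1 := Lam (G 1) in NL *; set Ls := Lam (G s) in NL *.
rewrite (_ : x + j%:R - _ = (x - (N n)%:R * Ls) + j%:R - (N n)%:R * (L1 - Ls)); last by ring.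
move=> h; have := lt_le_trans h (ler_normB _ _).
move=> /lt_le_trans /(_ (lerD (ler_normD _ _) (lexx _))).
rewrite normr_nat; move: jR NL; lra.
Unshelve. all: by end_near. Qed.

End Endpoint.

Theorem theorem3 (R : realType) (piU piV : probability nat R)
    (C : nat) (p : nat -> R)
    (N T : nat -> nat) (omega : forall n : nat, 'I_(N n) -> nat)
    (piU_subG : sub_gaussian piU) (piV_subG : sub_gaussian piV)
    (muU_gt0 : 0 < mean piU) (muV_gt0 : 0 < mean piV)
    (C_ge1 : (1 <= C)%N)
    (p_ge0 : forall c : nat, (1 <= c <= C)%N -> 0 <= p c)
    (p_gtC : forall c : nat, (C < c)%N -> p c = 0)
    (p_sum1 : \sum_(1 <= c < C.+1) p c = 1)
    (N_ge1 : forall n : nat, (1 <= N n)%N)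
    (N_infty : N n @[n --> \oo] --> \oo)
    (T_def : forall n : nat, (T n)%:R = mean piU / mean piV * (N n)%:R)
    (omega_range : forall (n : nat) (u : 'I_(N n)), (1 <= omega n u <= C)%N)
    (omega_frac : forall c : nat, (1 <= c <= C)%N ->
       #|[set u : 'I_(N n) | omega n u == c]%SET|%:R / (N n)%:R
         @[n --> \oo] --> p c) :
  exists G : R -> R,
    let phiU := gen_fun piU in
    let phiV := gen_fun piV in
    let solution := greedy_ode_solution phiU phiV (mean piU) (mean piV) C p in
    let ratio (n m : nat) : R := m%:R / ((N n)%:R * mean_capacity C p) in
    [/\ solution G,
        (forall H : R -> R, solution H -> {in `[0, 1], H =1 G}),
        cvg_in_probability
          (fun n => matching_size_law piU piV (T n) (@omega n) (T n))
          ratio (limit_ratio phiU C p (G 1)) &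
        forall s : R, s \in `[0, 1] ->
          cvg_in_probability
            (fun n => matching_size_law piU piV (T n) (@omega n)
                        (Num.truncn (s * (T n)%:R)))
            ratio (limit_ratio phiU C p (G s))].
Proof.
have [m [m0 Fb]] := fluid_rate_bnd piU_subG piV_subG muU_gt0 muV_gt0 C_ge1 p_ge0 p_gtC p_sum1.
have Flip (g g' : R) : 0 <= g <= 1 -> 0 <= g' <= 1 ->
    `|fluid_rate piU piV p g - fluid_rate piU piV p g'| <= rate_lip piU piV * `|g - g'|.
  exact: (fluid_rate_lip piU_subG piV_subG muU_gt0 muV_gt0 C_ge1 p_ge0 p_gtC p_sum1).
have [Phi [Phi0 dPhi]] :=
  exists_primitive m0 (rate_lip_ge0 piU_subG piV_subG muU_gt0 muV_gt0) Fb Flip.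
pose Lam := fluid_matched piU C p; pose G := fluid_time Phi.
have Ec0 := Ec_gt0 p_ge0 p_gtC p_sum1.
(* Multiplying the event by N times the mean capacity reduces the convergence to deviations of the
   size from N [Lam]. *)
have cvg_law (t : nat -> nat) (s : R) :
    (forall tau eta : R, 0 < tau -> 0 < eta ->
      \forall n \near \oo, (matching_size_law piU piV (T n) (@omega n) (t n)
        [pred k : nat | (tau * (N n)%:R < `|k%:R - (N n)%:R * Lam (G s)|)%R] <= eta%:E)%E) ->
    cvg_in_probability (fun n => matching_size_law piU piV (T n) (@omega n) (t n))
      (fun n k => k%:R / ((N n)%:R * mean_capacity C p)) (limit_ratio (gen_fun piU) C p (G s)).
  move=> H eps eps0.
  have eventE n : ([pred k : nat | (eps < `|k%:R / ((N n)%:R * mean_capacity C p) -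
        limit_ratio (gen_fun piU) C p (G s)|)%R] : pred nat) =
      [pred k : nat | (eps * mean_capacity C p * (N n)%:R < `|k%:R - (N n)%:R * Lam (G s)|)%R].
    have NR : 0 < (N n)%:R :> R by rewrite ltr0n N_ge1.
    have c0 : 0 < (N n)%:R * mean_capacity C p by rewrite mulr_gt0.
    apply/funext => k /=.
    rewrite (limit_ratioE piU_subG muU_gt0 muV_gt0 C_ge1 p_ge0 p_gtC p_sum1); last exact: (fluid_timeP m0 Fb Phi0 dPhi s).1.
    rewrite (_ : _ - _ = (k%:R - (N n)%:R * Lam (G s)) / ((N n)%:R * mean_capacity C p)); last first.
      by rewrite /Lam; field; rewrite !gt_eqF.
    rewrite normrM normfV (gtr0_norm c0) ltr_pdivlMr//.
    by rewrite mulrA mulrAC.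
  have tau0 : 0 < eps * mean_capacity C p by rewrite mulr_gt0.
  under eq_fun => n do rewrite eventE.
  have law0 n Q : (0 <= matching_size_law piU piV (T n) (@omega n) (t n) Q)%E.
    exact: matching_size_law_ge0.
  have fin (x : \bar R) (y : R) : (0 <= x)%E -> (x <= y%:E)%E -> x \is a fin_num.
    by move=> x0 xy; rewrite ge0_fin_numE// (le_lt_trans xy) ?ltry.
  (* The law takes extended real values; its eventual finiteness comes from the bound with eta =
     1. *)
  apply/fine_cvgP; split.
    have := H _ 1 tau0 ltr01; apply: filterS => n; exact: fin.
  apply/cvgrPdist_le => eta eta0; have := H _ eta tau0 eta0; apply: filterS => n h.
  have fx := fin _ _ (law0 n _) h.
  rewrite sub0r normrN ger0_norm; first by rewrite /= -lee_fin fineK.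
  by rewrite fine_ge0.
have end1 (tau eta : R) : 0 < tau -> 0 < eta -> \forall n \near \oo,
    (matching_size_law piU piV (T n) (@omega n) (T n)
      [pred k : nat | (tau * (N n)%:R < `|k%:R - (N n)%:R * Lam (G 1)|)%R] <= eta%:E)%E.
  exact: (matching_size_law_near_end piU_subG piV_subG muU_gt0 muV_gt0 C_ge1 p_ge0 p_gtC p_sum1
    m0 Fb Phi0 dPhi N_ge1 N_infty T_def omega_range omega_frac).
exists G; split.
- exact: (fluid_time_solution piU_subG piV_subG muU_gt0 muV_gt0 C_ge1 p_ge0 p_gtC p_sum1 m0 Fb Phi0 dPhi).
- exact: (solution_unique piU_subG piV_subG muU_gt0 muV_gt0 C_ge1 p_ge0 p_gtC p_sum1 m0 Fb Phi0 dPhi).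
- exact: (cvg_law T 1 end1).
move=> s; rewrite in_itv/= => /andP[s0]; rewrite le_eqVlt => /orP[/eqP ->|s1].
  apply: cvg_law => tau eta tau0 eta0; have := end1 tau eta tau0 eta0.
  by apply: filterS => n; rewrite mul1r natrK.
apply: cvg_law => tau eta tau0 eta0.
exact: (matching_size_law_near piU_subG piV_subG muU_gt0 muV_gt0 C_ge1 p_ge0 p_gtC p_sum1
  m0 Fb Phi0 dPhi N_ge1 N_infty T_def omega_range omega_frac).
Qed.
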